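(* Let $\mathcal{G}$ be a locally compact, $\sigma$-compact and étale groupoid with compact unit space $\mathcal{G}^{(0)}$, let $X$ be an invariant open dense subset of $\mathcal{G}^{(0)}$ and let $\partial X=\mathcal{G}^{(0)}\setminus X$. Suppose the reduction groupoid $\mathcal{G}(\partial X)$ is topologically amenable. Then for any element $T$ of the reduced groupoid $C^*$-algebra $C^*_r(\mathcal{G})$, the following conditions are equivalent: (1) $T$ is invertible modulo $C^*_r(\mathcal{G}(X))$. (2) The image $\varsigma(T)$ of $T$ under the symbol morphism is invertible in $\Gamma_b(E^\partial_u)^{\mathcal{G}(\partial X)}$. (3) For each $\omega\in\partial X$ the limit operator $\lambda_\omega(T)$ is invertible, and $\sup_{\omega\in\partial X}\|\lambda_\omega(T)^{-1}\|<\infty$. (4) For each $\omega\in\partial X$ the limit operator $\lambda_\omega(T)$ is invertible.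
   Context: Groupoids. A groupoid $\mathcal{G}$ has unit space $\mathcal{G}^{(0)}$, source and range maps $s,r$; $\mathcal{G}_x=s^{-1}(x)$, $\mathcal{G}^x=r^{-1}(x)$. A locally compact groupoid carries a locally compact Hausdorff topology for which composition and inversion are continuous and $r$ is open; it is étale if $r$ is a local homeomorphism. A subset $Y\subseteq\mathcal{G}^{(0)}$ is invariant if $r^{-1}(Y)=s^{-1}(Y)$; the reduction is $\mathcal{G}(Y)=r^{-1}(Y)\cap s^{-1}(Y)$. Reduced algebra (étale case). $C_c(\mathcal{G})$ is a $*$-algebra with $(f*g)(\gamma)=\sum_{\alpha\in\mathcal{G}_{s(\gamma)}}f(\gamma\alpha^{-1})g(\alpha)$ and $f^*(\gamma)=\overline{f(\gamma^{-1})}$. For $x\in\mathcal{G}^{(0)}$ the regular representation $\lambda_x:C_c(\mathcal{G})\to\mathfrak{B}(\ell^2(\mathcal{G}_x))$ is $(\lambda_x(f)\xi)(\gamma)=\sum_{\alpha\in\mathcal{G}_x}f(\gamma\alpha^{-1})\xi(\alpha)$. $C^*_r(\mathcal{G})$ is the completion of $C_c(\mathcal{G})$ in the norm $\sup_x\|\lambda_x(f)\|$, and each $\lambda_x$ extends to it. $C^*_r(\mathcal{G}(X))$ is regarded as an ideal of $C^*_r(\mathcal{G})$ via extension by zero $C_c(\mathcal{G}(X))\subseteq C_c(\mathcal{G})$; ''invertible modulo'' it means that the image in the quotient is invertible. For $\omega\in\partial X$, $\lambda_\omega(T)$ is the limit operator of $T$ at $\omega$. Topological amenability. A locally compact groupoid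 $\mathcal{H}$ is topologically amenable if there is a sequence of families $m^{(n)}=\{m^{(n)}_x:x\in\mathcal{H}^{(0)}\}$ of positive finite Radon measures on $\mathcal{H}$ such that: $\|m^{(n)}_x\|_1\le1$ and $m^{(n)}_x(\mathcal{H}\setminus s^{-1}(x))=0$ for all $x,n$; $x\mapsto\int f\,dm^{(n)}_x$ is continuous for all $f\in C_c(\mathcal{H})$ and all $n$; $\|m^{(n)}_x\|_1\to1$ uniformly on compact subsets of $\mathcal{H}^{(0)}$; $\|m^{(n)}_{s(\gamma)}-\gamma m^{(n)}_{r(\gamma)}\|_1\to0$ uniformly on compact subsets of $\mathcal{H}$, where $\gamma m$ is the push-forward under right multiplication $\alpha\mapsto\alpha\gamma$, $\mathcal{H}_{r(\gamma)}\to\mathcal{H}_{s(\gamma)}$. Operator fibre space and symbol. Let $E^\partial=\bigsqcup_{x\in\partial X}\mathfrak{B}(\ell^2(\mathcal{G}_x))$, with the topology in which a net $T_{x_i}$ converges to $T_x$ iff $x_i\to x$ and, whenever $\gamma'_i\to\gamma'$, $\gamma''_i\to\gamma''$ with $s(\gamma'_i)=x_i=s(\gamma''_i)$, one has $\langle T_{x_i}\delta_{\gamma'_i},\delta_{\gamma''_i}\rangle\to\langle T_x\delta_{\gamma'},\delta_{\gamma''}\rangle$. For $x\in\partial X$ let $\mathbb{C}[\mathcal{G}_x]$ be the set of $T=(T_{\gamma',\gamma''})_{\gamma',\gamma''\in\mathcal{G}_x}\in\mathfrak{B}(\ell^2(\mathcal{G}_x))$ for which there is a compact $K\subseteq\mathcal{G}(\partial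 X)$ such that $T_{\gamma',\gamma''}\ne0$ implies $\gamma''\gamma'^{-1}\in K$, and let $C^*_u(\mathcal{G}_x)$ be its norm closure. $\Gamma_b(E^\partial_u)^{\mathcal{G}(\partial X)}$ is the set of continuous sections $\varphi$ of $E^\partial$ with $\varphi(x)\in C^*_u(\mathcal{G}_x)$ for all $x$, $\sup_x\|\varphi(x)\|<\infty$, and $\varphi(r(\gamma))=R_\gamma^*\varphi(s(\gamma))R_\gamma$ for all $\gamma\in\mathcal{G}(\partial X)$, where $R_\gamma:\ell^2(\mathcal{G}_{r(\gamma)})\to\ell^2(\mathcal{G}_{s(\gamma)})$, $\delta_\alpha\mapsto\delta_{\alpha\gamma}$. Operations are pointwise and the norm is the supremum norm; $\varphi$ is invertible in this set if its pointwise inverse exists and belongs to the set. The symbol morphism $\varsigma:C^*_r(\mathcal{G})\to\Gamma_b(E^\partial_u)^{\mathcal{G}(\partial X)}$ is $\varsigma(T)(\omega)=\lambda_\omega(T)$, $\omega\in\partial X$. *)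

(* Defs.v *)
From HB Require Import structures.
From mathcomp Require Import all_boot all_order all_algebra.
From mathcomp Require Import complex finmap.
From mathcomp Require Import all_classical all_reals all_analysis.
From mathcomp Require Import ring lra.
From mathcomp.analysis.showcase Require summability.

Set Implicit Arguments.
Unset Strict Implicit.
Unset Printing Implicit Defensive.

Import Order.TTheory GRing.Theory Num.Theory.
Import numFieldNormedType.Exports.

Local Open Scope classical_set_scope.
Local Open Scope ring_scope.

(* A topological groupoid, presented with a space of objects and a space of
   arrows. The product [gmul a b] is meaningful only when [gsrc a = grng b]
   and is unconstrained otherwise. Continuity of [grng] and [gid] says that
   [gid] is a homeomorphism onto the space of units, so that [gobj] is the unit
   space with the topology induced from the arrows. *)
Record topGroupoid := TopGroupoid {
  gobj : topologicalType ;
  garr :> topologicalType ;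
  gsrc : garr -> gobj ;
  grng : garr -> gobj ;
  gid : gobj -> garr ;
  gmul : garr -> garr -> garr ;
  ginv : garr -> garr ;
  gsrc_id : forall x, gsrc (gid x) = x ;
  grng_id : forall x, grng (gid x) = x ;
  gsrc_mul : forall a b, gsrc a = grng b -> gsrc (gmul a b) = gsrc b ;
  grng_mul : forall a b, gsrc a = grng b -> grng (gmul a b) = grng a ;
  gmulA : forall a b c, gsrc a = grng b -> gsrc b = grng c ->
    gmul a (gmul b c) = gmul (gmul a b) c ;
  gmul1 : forall a, gmul a (gid (gsrc a)) = a ;
  g1mul : forall a, gmul (gid (grng a)) a = a ;
  gsrc_inv : forall a, gsrc (ginv a) = grng a ;
  grng_inv : forall a, grng (ginv a) = gsrc a ;
  gmulV : forall a, gmul a (ginv a) = gid (grng a) ;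
  gVmul : forall a, gmul (ginv a) a = gid (gsrc a) ;
  gsrc_continuous : continuous gsrc ;
  grng_continuous : continuous grng ;
  gid_continuous : continuous gid ;
  gmul_continuous : {within [set p : garr * garr | gsrc p.1 = grng p.2],
    continuous (fun p => gmul p.1 p.2)} ;
  ginv_continuous : continuous ginv
}.

Definition locally_compact_groupoid (G : topGroupoid) :=
  [/\ hausdorff_space G, locally_compact [set: G] &
      forall U : set G, open U -> open (@grng G @` U)].

Definition local_homeomorphism (S T : topologicalType) (f : S -> T) :=
  forall x, exists U : set S,
    [/\ open U, U x, open (f @` U), {within U, continuous f} &
      exists2 g : T -> S, {within f @` U, continuous g} &
        forall y, U y -> g (f y) = y].

Definition etale (G : topGroupoid) := local_homeomorphism (@grng G).

Definition sigma_compact (T : topologicalType) :=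
  exists2 K : nat -> set T, (forall n, compact (K n)) &
    \bigcup_n K n = [set: T].

Definition invariant_units (G : topGroupoid) (Y : set (gobj G)) :=
  @grng G @^-1` Y = @gsrc G @^-1` Y.

Definition boundary (G : topGroupoid) (X : set (gobj G)) : set (gobj G) := ~` X.

Section Reduction.
Variables (G : topGroupoid) (Y : set (gobj G)).

Definition redset : set G := @grng G @^-1` Y `&` @gsrc G @^-1` Y.

Lemma red_srcP (a : redset) : gsrc (val a) \in Y.
Proof. by case: a => a /= /set_mem[_ Ya]; exact: mem_set. Qed.

Lemma red_rngP (a : redset) : grng (val a) \in Y.
Proof. by case: a => a /= /set_mem[Ya _]; exact: mem_set. Qed.

Lemma red_idP (x : Y) : gid (val x) \in redset.
Proof.
apply/mem_set; split => /=; rewrite ?gsrc_id ?grng_id; exact: set_valP.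
Qed.

Lemma red_invP (a : redset) : ginv (val a) \in redset.
Proof.
by apply/mem_set; split => /=; rewrite ?gsrc_inv ?grng_inv;
  [exact: set_mem (red_srcP a)|exact: set_mem (red_rngP a)].
Qed.

Definition red_src (a : redset) : Y := exist (fun x => x \in Y) _ (red_srcP a).
Definition red_rng (a : redset) : Y := exist (fun x => x \in Y) _ (red_rngP a).
Definition red_id (x : Y) : redset := exist (fun x => x \in redset) _ (red_idP x).
Definition red_inv (a : redset) : redset := exist (fun x => x \in redset) _ (red_invP a).
Definition red_mul (a b : redset) : redset := insubd a (gmul (val a) (val b)).

Lemma red_srcE (a b : redset) :
  red_src a = red_rng b -> gsrc (val a) = grng (val b).
Proof. by move/(congr1 val). Qed.

Lemma red_mulE (a b : redset) : red_src a = red_rng b ->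
  val (red_mul a b) = gmul (val a) (val b).
Proof.
move=> /red_srcE ab; rewrite val_insubd ifT//; apply/mem_set; split => /=.
  by rewrite grng_mul//; exact: set_mem (red_rngP a).
by rewrite gsrc_mul//; exact: set_mem (red_srcP b).
Qed.

Lemma set_val_continuous (T : topologicalType) (A : set T) :
  continuous (fun a : A => val a).
Proof. by apply/continuousP => U oU; exists U. Qed.

Lemma set_type_continuous (S T : topologicalType) (A : set T) (f : S -> A) :
  continuous (fun s => val (f s)) -> continuous f.
Proof.
move=> cf; apply: (@continuous_comp_initial A S T set_val f).
by rewrite (_ : _ \o _ = fun s => val (f s))//; apply/funext => s /=.
Qed.

Lemma red_src_continuous : continuous red_src.
Proof.
apply: set_type_continuous => a; apply: (cvg_comp val (@gsrc G)).
  exact: set_val_continuous.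
exact: gsrc_continuous.
Qed.

Lemma red_rng_continuous : continuous red_rng.
Proof.
apply: set_type_continuous => a; apply: (cvg_comp val (@grng G)).
  exact: set_val_continuous.
exact: grng_continuous.
Qed.

Lemma red_id_continuous : continuous red_id.
Proof.
apply: set_type_continuous => a; apply: (cvg_comp val (@gid G)).
  exact: set_val_continuous.
exact: gid_continuous.
Qed.

Lemma red_inv_continuous : continuous red_inv.
Proof.
apply: set_type_continuous => a; apply: (cvg_comp val (@ginv G)).
  exact: set_val_continuous.
exact: ginv_continuous.
Qed.

Lemma red_mul_continuous :
  {within [set p : redset * redset | red_src p.1 = red_rng p.2],
    continuous (fun p => red_mul p.1 p.2)}.
Proof.
apply: set_type_continuous; apply/subspace_continuousP => -[a b] /= ab.
rewrite red_mulE//.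
pose v (p : redset * redset) : G * G := (val p.1, val p.2).
have cv : continuous v.
  move=> p; apply: cvg_pair => /=.
    by apply: (cvg_comp _ _ cvg_fst); exact: set_val_continuous.
  by apply: (cvg_comp _ _ cvg_snd); exact: set_val_continuous.
have /subspace_continuousP/(_ (v (a, b)) (red_srcE ab)) := @gmul_continuous G.
move=> cm U /cm hU.
have : \forall p \near ((a, b) : redset * redset),
    gsrc (v p).1 = grng (v p).2 -> U (gmul (v p).1 (v p).2) by exact: (cv (a, b) _ hU).
rewrite /nbhs/= /within/=; apply: filterS => -[c d] /= h cd.
by rewrite red_mulE//; exact/h/red_srcE.
Qed.

(* The reduction to an arbitrary set of units; arrows and units carry the
   subspace topology. *)
Definition reduction : topGroupoid.
Proof.
apply: (@TopGroupoid Y redset red_src red_rng red_id red_mul red_inv).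
- by move=> x; apply: val_inj; exact: gsrc_id.
- by move=> x; apply: val_inj; exact: grng_id.
- move=> a b ab; apply: val_inj; rewrite /= red_mulE//.
  exact/gsrc_mul/red_srcE.
- move=> a b ab; apply: val_inj; rewrite /= red_mulE//.
  exact/grng_mul/red_srcE.
- move=> a b c ab bc.
  have a_bc : red_src a = red_rng (red_mul b c).
    by apply: val_inj; rewrite /= red_mulE// grng_mul//; exact: red_srcE.
  have ab_c : red_src (red_mul a b) = red_rng c.
    apply: val_inj; rewrite /= red_mulE// gsrc_mul//; exact: red_srcE.
  apply: val_inj; rewrite !red_mulE//.
  by apply: gmulA; exact: red_srcE.
- move=> a; apply: val_inj; rewrite red_mulE ?gmul1//.
  by apply: val_inj; rewrite /= grng_id.
- move=> a; apply: val_inj; rewrite red_mulE ?g1mul//.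
  by apply: val_inj; rewrite /= gsrc_id.
- by move=> a; apply: val_inj; exact: gsrc_inv.
- by move=> a; apply: val_inj; exact: grng_inv.
- move=> a; apply: val_inj; rewrite red_mulE ?gmulV//.
  by apply: val_inj; rewrite /= grng_inv.
- move=> a; apply: val_inj; rewrite red_mulE ?gVmul//.
  by apply: val_inj; rewrite /= gsrc_inv.
- exact: red_src_continuous.
- exact: red_rng_continuous.
- exact: red_id_continuous.
- exact: red_mul_continuous.
- exact: red_inv_continuous.
Defined.

End Reduction.

Local Notation normc := Normc.normc.
(* The usual topology of the complex numbers; [R[i]] comes without one. *)
HB.instance Definition _ (R : rcfType) := NormedModule.copy R[i] R[i]^o.

Lemma normc_ge0 (R : rcfType) (z : R[i]) : 0 <= normc z.
Proof. by case: z => a b; exact: sqrtr_ge0. Qed.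

Section L2.
Variables (R : realType) (T : choiceType) (D : set T).
Implicit Types (f g : T -> R[i]).

Definition sqnorm f : \bar R := \esum_(t in D) (normc (f t) ^+ 2)%:E.

Definition l2_pred : {pred T -> R[i]} :=
  fun f => `[< (forall t, ~ D t -> f t = 0) /\ (sqnorm f < +oo)%E >].

Lemma sqnorm_ge0 f : (0 <= sqnorm f)%E.
Proof. by apply: esum_ge0 => t _; rewrite lee_fin sqr_ge0. Qed.

Lemma le_sqnormZ (a : R[i]) f :
  (sqnorm (a *: f)%R <= (normc a ^+ 2)%:E * sqnorm f)%E.
Proof.
apply: ge_ereal_sup => _ [X [finX XD] <-].
rewrite (_ : (\sum_(t \in X) (normc ((a *: f) t) ^+ 2)%:E)%E =
  ((normc a ^+ 2)%:E * \sum_(t \in X) (normc (f t) ^+ 2)%:E)%E).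
  rewrite lee_wpmul2l ?lee_fin ?sqr_ge0//.
  by apply: ereal_sup_ubound; exists X.
rewrite !fsbig_finite// ge0_sume_distrr//; last first.
  by move=> t _; rewrite lee_fin sqr_ge0.
by apply: eq_bigr => t _; rewrite -EFinM -exprMn -Normc.normcM.
Qed.

Lemma le_sqnormD f g :
  (sqnorm (f + g)%R <= sqnorm f + sqnorm f + (sqnorm g + sqnorm g))%E.
Proof.
have ge0 h (t : T) : D t -> (0 <= (normc (h t) ^+ 2)%:E)%E.
  by move=> _; rewrite lee_fin sqr_ge0.
rewrite /sqnorm -!esumD//; do ?by move=> t Dt; rewrite ?adde_ge0 ?ge0.
apply: le_esum => t _; rewrite -!EFinD lee_fin.
have h : normc ((f + g) t) ^+ 2 <= (normc (f t) + normc (g t)) ^+ 2.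
  rewrite (_ : (f + g) t = f t + g t)//.
  apply: lerXn2r; rewrite ?nnegrE ?addr_ge0 ?normc_ge0//.
  exact: (le_normcD (f t) (g t)).
apply: (le_trans h); have := sqr_ge0 (normc (f t) - normc (g t)); nra.
Qed.

Lemma l2_submod : submod_closed l2_pred.
Proof.
split; first (apply/asboolP; split => //).
  rewrite /sqnorm esum1 ?ltry// => t _.
  by rewrite (_ : (0 : T -> R[i]) t = 0)// Normc.normc0 expr0n.
move=> a f g /asboolP[f0 fD] /asboolP[g0 gD]; apply/asboolP; split.
  move=> t Dt; rewrite (_ : (a *: f + g) t = a *: f t + g t)//.
  by rewrite f0// g0// scaler0 addr0.
apply: (le_lt_trans (le_sqnormD _ _)).
have afD : (sqnorm (a *: f)%R < +oo)%E.
  apply: (le_lt_trans (le_sqnormZ _ _)).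
  by rewrite lte_mul_pinfty// lee_fin sqr_ge0.
by rewrite !lte_add_pinfty.
Qed.

HB.instance Definition _ :=
  GRing.isSubmodClosed.Build R[i] (T -> R[i]) l2_pred l2_submod.

(* The Hilbert space of square-summable families on [D], extended by zero to
   [T]; the ambient index type avoids transports when [D] varies. *)
Record l2 := L2 { l2val :> T -> R[i] ; l2valP : l2val \in l2_pred }.

HB.instance Definition _ := [isSub of l2 for l2val].
HB.instance Definition _ := [Choice of l2 by <:].
HB.instance Definition _ := [SubChoice_isSubLmodule of l2 by <:].

Definition l2norm (xi : l2) : R := Num.sqrt (fine (sqnorm xi)).

Definition inner (xi eta : l2) : R[i] :=
  summability.sum (fun t => xi t * (eta t)^*).

Lemma delta_l2 (t : T) : (fun u => ((u == t) && (u \in D))%:R) \in l2_pred.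
Proof.
apply/asboolP; split => [u Du|].
  by rewrite (memNset Du) andbF.
rewrite /sqnorm (_ : (fun u => _) =
    fun u => if u \in [set t] `&` D then 1%:E else 0%E); last first.
  apply/funext => u; rewrite (_ : (u \in _) = (u == t) && (u \in D)); last first.
    by rewrite in_setI; congr andb; apply/idP/eqP; rewrite inE.
  by case: ifP => _; rewrite ?Normc.normc1 ?Normc.normc0 ?expr1n ?expr0n.
rewrite -esum_mkcondr.
rewrite esum_fset//; last by apply: sub_finite_set (finite_set1 t) => u [_ []].
rewrite fsbig_finite ?sumEFin ?ltry//.
by apply: sub_finite_set (finite_set1 t) => u [_ []].
Qed.

(* The basis vector at [t], which is zero if [t] is not in [D]. *)
Definition delta (t : T) : l2 := L2 (delta_l2 t).

Lemma inner_delta (xi : l2) (t : T) : D t -> inner xi (delta t) = xi t.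
Proof.
have ? := @summability.totally_filter T.
move=> Dt; apply: cvg_lim => //; apply: cvg_near_cst.
exists (finmap.fset1 t) => // A /= tA.
rewrite /summability.partial_sum.
have At : t \in A by apply: (finmap.fsubsetP tA); rewrite finmap.inE.
have dE u : delta t u = ((u == t) && (u \in D))%:R by [].
rewrite (bigD1 (finmap.FSetSub At))//= big1 ?addr0 => [|[u Au]].
  by rewrite ?dE eqxx mem_set// conjC1 mulr1.
by rewrite -val_eqE/= ?dE => /negPf ->; rewrite conjC0 mulr0.
Qed.

Lemma sqnorm_fin (xi : l2) : sqnorm xi \is a fin_num.
Proof.
have /asboolP[_ h] := l2valP xi.
by rewrite ge0_fin_numE ?sqnorm_ge0.
Qed.

Lemma le_l2normD (xi eta : l2) :
  l2norm (xi + eta) <= 2 * (l2norm xi + l2norm eta).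
Proof.
rewrite /l2norm -[leRHS]ger0_norm; last by rewrite mulr_ge0// addr_ge0 ?sqrtr_ge0.
rewrite -sqrtr_sqr ler_wsqrtr//.
have ge0 z : 0 <= fine (sqnorm z) by rewrite fine_ge0 ?sqnorm_ge0.
rewrite exprMn (sqrrD (Num.sqrt _)) !(sqr_sqrtr (ge0 _)).
have : fine (sqnorm (xi + eta)) <=
    fine (sqnorm xi + sqnorm xi + (sqnorm eta + sqnorm eta))%E.
  by rewrite fine_le ?fin_numD ?sqnorm_fin// le_sqnormD.
rewrite !fineD ?fin_numD ?sqnorm_fin// => h; apply: (le_trans h).
have := ge0 xi; have := ge0 eta.
have := mulr_ge0 (sqrtr_ge0 (fine (sqnorm xi))) (sqrtr_ge0 (fine (sqnorm eta))).
nra.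
Qed.

Lemma l2normN (xi : l2) : l2norm (- xi) = l2norm xi.
Proof.
congr (Num.sqrt (fine _)); apply: eq_esum => t _.
by rewrite (_ : (- xi) t = - xi t)// normcN.
Qed.

Lemma l2norm0 : l2norm 0 = 0.
Proof.
rewrite /l2norm /sqnorm esum1 ?fine0 ?sqrtr0// => t _.
by rewrite (_ : (0 : l2) t = 0)// Normc.normc0 expr0n.
Qed.

Definition bop_pred : {pred l2 -> l2} :=
  fun A => `[< linear A /\
    exists M : R, forall xi, l2norm (A xi) <= M * l2norm xi >].

Lemma bop_zmod : zmod_closed bop_pred.
Proof.
split.
  apply/asboolP; split.
    by move=> a x y; rewrite /= [RHS]addr0 scaler0.
  by exists 0 => xi; rewrite mul0r l2norm0.
move=> A B /asboolP[lA [M hM]] /asboolP[lB [N hN]]; apply/asboolP; split.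
  move=> a x y; have E z : (A - B) z = A z - B z by [].
  by rewrite !E lA lB scalerBr opprD addrACA.
exists (2 * (M + N)) => xi; have -> : (A - B) xi = A xi - B xi by [].
apply: (le_trans (le_l2normD _ _)); rewrite l2normN -mulrA ler_wpM2l//.
by rewrite mulrDl lerD.
Qed.

HB.instance Definition _ := GRing.isZmodClosed.Build _ bop_pred bop_zmod.

Record bop := Bop { bopval :> l2 -> l2 ; bopvalP : bopval \in bop_pred }.

HB.instance Definition _ := [isSub of bop for bopval].
HB.instance Definition _ := [Choice of bop by <:].
HB.instance Definition _ := [SubChoice_isSubZmodule of bop by <:].

Lemma bop1_subproof : id \in bop_pred.
Proof. by apply/asboolP; split => //; exists 1 => xi; rewrite mul1r. Qed.

Lemma bopM_subproof (A B : bop) : A \o B \in bop_pred.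
Proof.
have /asboolP[lA [M hM]] := bopvalP A.
have /asboolP[lB [N hN]] := bopvalP B.
apply/asboolP; split => [a x y|].
  by rewrite /= lB lA.
exists (`|M| * N) => xi /=; apply: (le_trans (hM _)).
apply: (@le_trans _ _ (`|M| * l2norm (B xi))).
  by rewrite ler_wpM2r ?sqrtr_ge0 ?ler_norm.
by rewrite -mulrA ler_wpM2l.
Qed.

Definition bop1 : bop := Bop bop1_subproof.
Definition bopM (A B : bop) : bop := Bop (bopM_subproof A B).

Lemma bopMA : associative bopM.
Proof. by move=> A B C; exact: val_inj. Qed.

Lemma bop1M : left_id bop1 bopM.
Proof. by move=> A; exact: val_inj. Qed.

Lemma bopM1 : right_id bop1 bopM.
Proof. by move=> A; exact: val_inj. Qed.

Lemma bopMDl : left_distributive bopM +%R.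
Proof. by move=> A B C; exact: val_inj. Qed.

Lemma bopMDr : right_distributive bopM +%R.
Proof.
move=> A B C; apply: val_inj; apply/funext => xi /=.
have /asboolP[lA _] := bopvalP A.
by have := lA 1 (B xi) (C xi); rewrite !scale1r.
Qed.

HB.instance Definition _ := GRing.Zmodule_isPzRing.Build bop
  bopMA bop1M bopM1 bopMDl bopMDr.

Definition opnorm (A : bop) : R :=
  sup [set l2norm (A xi) | xi in [set xi | l2norm xi <= 1]].

Definition inverse_of (A B : bop) := A * B = 1 /\ B * A = 1.

Definition invertible (A : bop) := exists B, inverse_of A B.
End L2.

Section CompactlySupported.
Variables (R : realType) (T : topologicalType).

Definition Cc : set (T -> R[i]) :=
  [set f | continuous f /\ compact (closure [set t | f t != 0])].

End CompactlySupported.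

Definition fibre (G : topGroupoid) (x : gobj G) : set G :=
  [set a | gsrc a = x].

(* Measurable spaces are pointed in the library, while the arrows of a groupoid
   may form an empty type: a measure attached to a unit [x] lives on the arrows
   pointed by the identity at [x]. The Borel sets do not depend on [x]. *)
Definition arrows_at (H : topGroupoid) (x : gobj H) : Type := garr H.

HB.instance Definition _ (H : topGroupoid) (x : gobj H) :=
  Topological.copy (arrows_at x) (garr H).
HB.instance Definition _ (H : topGroupoid) (x : gobj H) :=
  isPointed.Build (arrows_at x) (gid x).

Section GroupoidCalculus.
Variable G : topGroupoid.
Implicit Types a b : G.

Lemma gmulVK a b : gsrc a = gsrc b -> gmul (gmul a (ginv b)) b = a.
Proof.
by move=> ab; rewrite -gmulA ?gsrc_inv ?grng_inv// gVmul -ab gmul1.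
Qed.

Lemma gmulK a b : gsrc a = grng b -> gmul (gmul a b) (ginv b) = a.
Proof. by move=> ab; rewrite -gmulA ?grng_inv// gmulV -ab gmul1. Qed.

Lemma gVmulK a b : gsrc a = grng b -> gmul (ginv a) (gmul a b) = b.
Proof.
by move=> ab; rewrite gmulA ?gsrc_inv ?gVmul// ab g1mul.
Qed.

Lemma ginvK a : ginv (ginv a) = a.
Proof.
have := gVmulK (gsrc_inv a); rewrite gVmul => h; rewrite -[RHS]h.
have -> : gsrc a = gsrc (ginv (ginv a)) by rewrite gsrc_inv grng_inv.
by rewrite gmul1.
Qed.

End GroupoidCalculus.

Section ReducedAlgebra.
Variables (R : realType) (G : topGroupoid).

Definition is_regular_rep (f : G -> R[i]) x (A : bop R (fibre x)) :=
  forall (xi : l2 R (fibre x)) (c : G), fibre x c ->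
    A xi c = \sum_(a \in fibre x) f (gmul c (ginv a)) * xi a.

(* For etale [G] and [f] in [Cc G] such a bounded operator exists, see
   [regular_repP]; elsewhere [regular_rep] may default to 0. *)
Definition regular_rep (f : G -> R[i]) (x : gobj G) : bop R (fibre x) :=
  xget 0 [set A | is_regular_rep f A].

Let finite_rows (f : G -> R[i]) x := forall c : G, fibre x c ->
  finite_set (fibre x `&` [set a | f (gmul c (ginv a)) != 0]).

Let good f x := finite_rows f x /\ exists A : bop R (fibre x), is_regular_rep f A.

Let goodD f g x : good f x -> good g x -> good (f \+ g) x.
Proof.
move=> [ff [A hA]] [fg [B hB]]; split.
  move=> c xc; apply: sub_finite_set (_ : finite_set (_ `|` _)); last first.
    by rewrite finite_setU; split; [exact: (ff c xc)|exact: (fg c xc)].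
  move=> a [xa] /= fga.
  have [fa0|fa0] := eqVneq (f (gmul c (ginv a))) 0; last by left.
  by right; split => //=; apply: contra fga => /eqP ->; rewrite fa0 addr0.
exists (A + B) => xi c xc.
have -> : (A + B) xi c = A xi c + B xi c by [].
rewrite hA// hB//.
pose Q := fibre x `&` [set a | f (gmul c (ginv a)) != 0] `|`
  fibre x `&` [set a | g (gmul c (ginv a)) != 0].
have Qx : Q `<=` fibre x by move=> a [[]|[]].
have finQ : finite_set Q by rewrite finite_setU; split; [exact: ff|exact: fg].
have Q0 h : (forall a, fibre x a -> ~ Q a -> h (gmul c (ginv a)) = 0) ->
    \sum_(a \in fibre x) h (gmul c (ginv a)) * xi a =
    \sum_(a \in Q) h (gmul c (ginv a)) * xi a.
  move=> h0; rewrite (fsbig_widen Q (fibre x))// => a [xa Qa] /=.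
  by rewrite h0// mul0r.
have f0 a : fibre x a -> ~ Q a -> f (gmul c (ginv a)) = 0.
  by move=> xa Qa; apply: contrapT => /eqP fa; apply: Qa; left.
have g0 a : fibre x a -> ~ Q a -> g (gmul c (ginv a)) = 0.
  by move=> xa Qa; apply: contrapT => /eqP ga; apply: Qa; right.
rewrite !Q0//; last by move=> a xa Qa /=; rewrite f0// g0// addr0.
by rewrite -fsbig_split//; apply: eq_fsbigr => a _ /=; rewrite mulrDl.
Qed.

Let good0 x : good (fun=> 0) x.
Proof.
split; first by move=> c xc; rewrite (_ : _ `&` _ = set0)//;
  apply/seteqP; split => // a [_] /=; rewrite eqxx.
exists 0 => xi c xc; rewrite fsbig1// => a _; exact: mul0r.
Qed.

(* [f] is bounded and supported in a bisection. *)
Let good_bisection (f : G -> R[i]) (B : set G) (M : R) x :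
  set_inj B (@grng G) -> set_inj B (@gsrc G) ->
  (forall a, ~ B a -> f a = 0) -> (forall a, B a -> normc (f a) <= M) ->
  good f x.
Proof.
move=> injr injs fB fM.
pose P := [set c | fibre x c /\
  exists a, fibre x a /\ B (gmul c (ginv a))].
pose e c := xget c (fibre x `&` [set a | B (gmul c (ginv a))]).
have eP c : P c -> fibre x (e c) /\ B (gmul c (ginv (e c))).
  move=> [_ [a xBa]].
  pose Q := fibre x `&` [set a | B (gmul c (ginv a))].
  by have : Q (xget c Q) by apply: xgetPex; exists a.
have eU c a : fibre x c -> fibre x a -> B (gmul c (ginv a)) -> a = e c.
  move=> xc xa Ba; have [|xe Be] := eP c; first by split => //; exists a.
  have cV b : fibre x b -> gsrc c = grng (ginv b).
    by move=> xb; rewrite grng_inv xc xb.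
  have /injr /(_ (mem_set Be)) ae : gmul c (ginv a) \in B by exact: mem_set.
  have {}ae := ae _; rewrite (grng_mul (cV _ xa)) (grng_mul (cV _ xe)) in ae.
  have {}ae := ae erefl.
  by rewrite -[a]ginvK -(gVmulK (cV _ xa)) ae (gVmulK (cV _ xe)) ginvK.
have eI : {in P &, injective e}.
  move=> c c' /set_mem Pc /set_mem Pc' ecc'.
  have [xe Be] := eP _ Pc; have [_] := eP _ Pc'; rewrite -ecc' => Be'.
  have cE d : P d -> gsrc d = gsrc (e c) by move=> [-> _]; rewrite xe.
  have /injs /(_ (mem_set Be')) cc' : gmul c (ginv (e c)) \in B.
    exact: mem_set.
  have cV d : P d -> gsrc d = grng (ginv (e c)).
    by move=> Pd; rewrite grng_inv; exact: cE.
  have {}cc' := cc' _; rewrite (gsrc_mul (cV _ Pc)) (gsrc_mul (cV _ Pc')) in cc'.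
  have {}cc' := cc' erefl.
  by rewrite -(gmulVK (cE _ Pc)) cc' (gmulVK (cE _ Pc')).
pose A0 (xi : l2 R (fibre x)) (c : G) : R[i] :=
  if c \in P then f (gmul c (ginv (e c))) * xi (e c) else 0.
have A0E xi c : fibre x c ->
    A0 xi c = \sum_(a \in fibre x) f (gmul c (ginv a)) * xi a.
  move=> xc; rewrite /A0; case: ifPn => [/set_mem Pc|/negP Pc].
    have [xe Be] := eP _ Pc.
    rewrite -(fsbig_widen [set e c] (fibre x)) ?fsbig_set1//.
      by move=> a ->.
    move=> a [xa ae] /=; rewrite fB ?mul0r// => Ba; apply: ae.
    exact: eU.
  rewrite fsbig1// => a xa; rewrite fB ?mul0r// => Ba; apply: Pc.
  by apply/mem_set; split => //; exists a.
have A0n xi : (sqnorm (fibre x) (A0 xi) <=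
    (M ^+ 2)%:E * sqnorm (fibre x) xi)%E.
  apply: (@le_trans _ _ (\esum_(c in P) (M ^+ 2 * normc (xi (e c)) ^+ 2)%:E)%E).
    rewrite /sqnorm (_ : P = fibre x `&` P); last first.
      by apply/seteqP; split=> [c Pc|c []//]; split => //; case: Pc.
    rewrite esum_mkcondr; apply: le_esum => c xc; rewrite /A0.
    case: ifPn => [/set_mem Pc|_]; last by rewrite Normc.normc0 expr0n.
    have [xe Be] := eP _ Pc; rewrite lee_fin -exprMn Normc.normcM.
    apply: lerXn2r; rewrite ?nnegrE ?mulr_ge0 ?normc_ge0//.
      exact: le_trans (normc_ge0 _) (fM _ Be).
    by rewrite ler_wpM2r ?normc_ge0// fM.
  rewrite -(reindex_esum P (e @` P) e (fun a => (M ^+ 2 * normc (xi a) ^+ 2)%:E));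
    last exact: inj_bij.
  apply: ge_ereal_sup => _ [X [finX XP] <-].
  rewrite fsbig_finite//; under eq_bigr do rewrite EFinM.
  rewrite -ge0_sume_distrr; last by move=> a _; rewrite lee_fin sqr_ge0.
  rewrite lee_wpmul2l ?lee_fin ?sqr_ge0//; apply: ereal_sup_ubound.
  exists X; last by rewrite fsbig_finite.
  by split=> // a /XP[c Pc <-]; have [] := eP _ Pc.
have A0l2 xi : A0 xi \in l2_pred (fibre x).
  apply/asboolP; split=> [c xc|].
    by rewrite /A0 memNset// => Pc; apply: xc; case: Pc.
  apply: (le_lt_trans (A0n xi)).
  by rewrite lte_mul_pinfty ?lee_fin ?sqr_ge0// ltey_eq sqnorm_fin.
pose A1 (xi : l2 R (fibre x)) : l2 R (fibre x) := L2 (A0l2 xi).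
have A1b : A1 \in @bop_pred R G (fibre x).
  apply/asboolP; split=> [k u v|].
    apply: val_inj; apply/funext => c.
    have -> : val (k *: A1 u + A1 v) c = k * A0 u c + A0 v c by [].
    have -> : val (A1 (k *: u + v)) c = A0 (k *: u + v) c by [].
    rewrite /A0.
    case: ifPn => _; last by rewrite mulr0 addr0.
    rewrite (_ : (k *: u + v) (e c) = k * u (e c) + v (e c))//.
    by rewrite mulrDr !mulrA [f _ * k]mulrC.
  exists `|M| => xi; rewrite /l2norm.
  rewrite -[X in X * _]sqrtr_sqr -sqrtrM ?sqr_ge0// ler_wsqrtr//.
  have := sqnorm_fin (A1 xi); have := sqnorm_fin xi => xfin Afin.
  by rewrite -lee_fin EFinM !fineK//; exact: A0n.
split; last by exists (Bop A1b) => xi c xc; exact: A0E.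
move=> c xc; apply: sub_finite_set (finite_set1 (e c)) => a [xa /= fa].
apply: eU => //; apply: contrapT => Ba; move: fa; rewrite fB ?eqxx//.
Qed.

Let good_cover (f : G -> R[i]) (W : G -> set G) (s : seq G) x :
  (forall p, set_inj (W p) (@grng G)) -> (forall p, set_inj (W p) (@gsrc G)) ->
  (forall p, exists M, forall a, W p a -> normc (f a) <= M) ->
  (forall a, f a != 0 -> exists2 p, p \in s & W p a) -> good f x.
Proof.
move=> injr injs; elim: s f => [|p s IH] f fM fW.
  rewrite (_ : f = fun=> 0); first exact: good0.
  by apply/funext => a; apply: contrapT => /eqP /fW[].
pose g a := if a \in W p then f a else 0.
pose h a := if a \in W p then 0 else f a.
rewrite (_ : f = g \+ h); last first.
  by apply/funext => a; rewrite /g /h /=; case: ifP; rewrite ?addr0 ?add0r.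
apply: goodD.
  have [M fMp] := fM p; apply: (@good_bisection g (W p) M) => //.
    by move=> a Wa; rewrite /g memNset.
  by move=> a Wa; rewrite /g mem_set//; exact: fMp.
apply: IH => [q|a].
  have [M fMq] := fM q; exists M => a Wa; rewrite /h; case: ifP => _.
    by rewrite Normc.normc0; exact: le_trans (normc_ge0 _) (fMq _ Wa).
  exact: fMq.
rewrite /h; case: ifPn => [|/negP Wa /fW[q]]; first by rewrite eqxx.
by rewrite inE => /orP[/eqP -> /mem_set//|qs Wq]; exists q.
Qed.

Lemma regular_repP (f : G -> R[i]) x : etale G -> Cc f ->
  is_regular_rep f (regular_rep f x).
Proof.
move=> eG [cf Kf]; set K := closure _ in Kf.
have [W [oW W1 Wr Ws WM]] : exists W : G -> set G, [/\ forall p, open (W p),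
    forall p, W p p, forall p, set_inj (W p) (@grng G),
    forall p, set_inj (W p) (@gsrc G) &
    forall p, exists M, forall a, W p a -> normc (f a) <= M].
  have /choice[U Up] : forall p : G, exists U : set G,
      [/\ open U, U p & set_inj U (@grng G)].
    move=> p; have [U [oU Up _ _ [g _ gK]]] := eG p.
    exists U; split => // a b /set_mem Ua /set_mem Ub ab.
    by rewrite -(gK a)// -(gK b)// ab.
  pose V p := U p `&` (@ginv G @^-1` U (ginv p)) `&`
    (f @^-1` ball (f p) 1).
  exists V; split => p.
  - have [oU _ _] := Up p; have [oUi _ _] := Up (ginv p).
    apply: openI; [apply: openI => //|].
      by apply: open_comp => // a _; exact: ginv_continuous.
    by apply: open_comp => [a _|]; [exact: cf|exact: ball_open].
  - have [_ pU _] := Up p; have [_ pUi _] := Up (ginv p).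
    by split => //; apply: ballxx.
  - have [_ _ iU] := Up p.
    by move=> a b /set_mem[[Ua _] _] /set_mem[[Ub _] _];
      apply: iU; exact: mem_set.
  - have [_ _ iU] := Up (ginv p).
    move=> a b /set_mem[[_ Ua] _] /set_mem[[_ Ub] _] ab.
    rewrite -[a]ginvK -[b]ginvK; congr ginv.
    by apply: iU; rewrite ?inE// !grng_inv.
  - exists (normc (f p) + 1) => a [_]; rewrite /= -ball_normE/= => pa.
    rewrite -lecR rmorphD/= rmorph1.
    have : `|f a| <= `|f p| + `|f p - f a|.
      by rewrite distrC; have := ler_normD (f p) (f a - f p); rewrite addrC subrK.
    by move=> h; apply: (le_trans h); rewrite lerD2l ltW.
have [s sK] : exists s : seq G, K `<=` [set a | exists2 p, p \in s & W p a].
  have : @compact (arrows_at x) K by [].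
  rewrite compact_cover => /(_ G setT W).
  case=> [p _|a _|s _ sK]; [exact: oW|by exists a|].
  by exists (finmap.enum_fset s) => a /sK[p ps Wa]; exists p.
have [_ [A fA]] : good f x.
  apply: (@good_cover f W s) => // a fa.
  by apply: sK; exact: subset_closure.
rewrite /regular_rep; apply: (@xgetPex _ 0 [set A | is_regular_rep f A]).
by exists A.
Qed.



(* The product of the algebras of bounded operators on the spaces
   [l2 (fibre x)]. *)
Definition opfield := forall x : gobj G, bop R (fibre x).

(* The completion of [Cc G] for the norm [sup_x (opnorm (regular_rep f x))],
   realized as the closure, for the uniform norm, of the image of [Cc G] under
   the product of the regular representations. The extension of
   [regular_rep ^~ x] to the completion is then the evaluation at [x]. *)
Definition Cred : set opfield :=
  [set T | forall e : R, 0 < e ->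
    exists2 f : G -> R[i], Cc f &
      forall x, opnorm (T x - regular_rep f x) <= e].

(* [valL_ 0 f] is the extension of [f] by zero. *)
Definition Cred_reduction (X : set (gobj G)) : set opfield :=
  [set T | forall e : R, 0 < e ->
    exists2 f : reduction X -> R[i], Cc f &
      forall x, opnorm (T x - regular_rep (valL_ 0 f) x) <= e].

(* Invertibility of the class of [T] in the quotient of [A] by [J]. *)
Definition invertible_modulo (A J : set opfield) (T : opfield) :=
  exists2 S : opfield, A S &
    J (fun x => T x * S x - 1) /\ J (fun x => S x * T x - 1).

End ReducedAlgebra.

Definition borel (H : topGroupoid) (x : gobj H) :=
  g_sigma_algebraType (@open (arrows_at x)).

Section Amenability.
Variables (R : realType) (H : topGroupoid).

(* Inner regularity by compact sets; meant for finite Borel measures. *)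
Definition radon (x : gobj H) (mu : set (borel x) -> \bar R) :=
  forall A : set (borel x), measurable A ->
    mu A = ereal_sup [set mu K | K in [set K : set H | compact K /\ K `<=` A]].

Definition cintegral (x : gobj H) (mu : {measure set (borel x) -> \bar R})
    (f : H -> R[i]) : R[i] :=
  Complex (\int[mu]_(a in [set: borel x]) complex.Re (f a))
          (\int[mu]_(a in [set: borel x]) complex.Im (f a)).

Definition total_variation (nu : set H -> \bar R) : \bar R :=
  ereal_sup [set v | exists (n : nat) (A : 'I_n -> set H),
    [/\ forall i, <<s @open H >> (A i), trivIset [set: 'I_n] A,
        \bigcup_i A i = [set: H] & v = (\sum_(i < n) `|nu (A i)|)%E]].

(* Push-forward of [mu], restricted to the arrows of source [grng c], under
   [a |-> gmul a c]. *)
Definition rtranslate (c : H) (mu : set H -> \bar R) (A : set H) : \bar R :=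
  mu (fibre (grng c) `&` (fun a => gmul a c) @^-1` A).

(* The norm of a positive measure is its total mass. *)
Definition topologically_amenable :=
  exists m : nat -> forall x : gobj H, {finite_measure set (borel x) -> \bar R},
    (forall n x, radon (m n x)) /\
    [/\ forall n x, (m n x [set: H] <= 1)%E /\ m n x (~` fibre x) = 0%E,
        forall n (f : H -> R[i]), Cc f ->
          continuous (fun x => cintegral (m n x) f),
        forall K : set (gobj H), compact K -> forall e : R, 0 < e ->
          \forall n \near \oo, forall x, K x ->
            (`|m n x [set: H] - 1| <= e%:E)%E &
        forall K : set H, compact K -> forall e : R, 0 < e ->
          \forall n \near \oo, forall c, K c ->
            (total_variation (fun A => m n (gsrc c) A -
               rtranslate c (m n (grng c)) A) <= e%:E)%E].

End Amenability.

Section Symbol.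
Variables (R : realType) (G : topGroupoid).

Lemma rtrans_bij (c : G) :
  set_bij (fibre (gsrc c)) (fibre (grng c)) (fun b => gmul b (ginv c)).
Proof.
split.
- by move=> b /= sb; rewrite /fibre/= gsrc_mul ?grng_inv ?gsrc_inv.
- move=> a b /set_mem sa /set_mem sb /(congr1 (fun d => gmul d c)).
  by rewrite !gmulVK.
- move=> a /= sa; exists (gmul a c); last exact: gmulK.
  by rewrite /fibre/= gsrc_mul.
Qed.

(* [rtrans c] is the unitary R_c, mapping [delta a] to [delta (gmul a c)]. *)
Lemma rtrans_l2 (c : G) (xi : l2 R (fibre (grng c))) :
  (fun b : G => if b \in fibre (gsrc c) then xi (gmul b (ginv c)) else 0)
    \in l2_pred (fibre (gsrc c)).
Proof.
have /asboolP[xi0 xiD] := l2valP xi; apply/asboolP; split => [t Dt|].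
  by rewrite memNset.
move: xiD; rewrite /sqnorm (reindex_esum _ _ _ _ (rtrans_bij c)).
by move=> xiD; under eq_esum => t Dt do rewrite mem_set//.
Qed.

Definition rtrans (c : G) (xi : l2 R (fibre (grng c))) :
    l2 R (fibre (gsrc c)) := L2 (rtrans_l2 xi).

Definition coef (x : gobj G) (A : bop R (fibre x)) (a b : G) : R[i] :=
  inner (A (delta R (fibre x) a)) (delta R (fibre x) b).

Variable Y : set (gobj G).

Definition opbundle := {w : Y & bop R (fibre (val w))}.

(* Nets are families indexed by a type endowed with a filter. *)
Definition opbundle_cvg (I : Type) (F : set_system I) (A : I -> opbundle)
    (A0 : opbundle) :=
  (fun i => projT1 (A i)) @ F --> projT1 A0 /\
  forall (a b : I -> G) (a0 b0 : G),
    (forall i, fibre (val (projT1 (A i))) (a i)) ->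
    (forall i, fibre (val (projT1 (A i))) (b i)) ->
    a @ F --> a0 -> b @ F --> b0 ->
    (fun i => coef (projT2 (A i)) (a i) (b i)) @ F
      --> coef (projT2 A0) a0 b0.

Definition opsection := forall w : Y, bop R (fibre (val w)).

Definition continuous_section (phi : opsection) :=
  forall (I : Type) (F : set_system I), ProperFilter F ->
    forall (w : I -> Y) (w0 : Y), w @ F --> w0 ->
      opbundle_cvg F (fun i => existT _ (w i) (phi (w i)))
        (existT _ w0 (phi w0)).

Definition banded (x : gobj G) : set (bop R (fibre x)) :=
  [set A | exists K : set G, [/\ compact K, K `<=` redset Y &
    forall a b, fibre x a -> fibre x b -> coef A a b != 0 ->
      K (gmul b (ginv a))]].

Definition Cu (x : gobj G) : set (bop R (fibre x)) :=
  [set A | forall e : R, 0 < e -> exists2 B, banded B & opnorm (A - B) <= e].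

(* phi (r c) = R_c^* (phi (s c)) R_c, with the adjoint tested on vectors. *)
Definition equivariant (phi : opsection) :=
  forall (c : redset Y) (xi eta : l2 R (fibre (grng (val c)))),
    inner (phi (red_rng c) xi) eta =
    inner (phi (red_src c) (rtrans xi)) (rtrans eta).

Definition Gamma : set opsection :=
  [set phi | [/\ continuous_section phi, forall w, Cu (phi w),
    exists M : R, forall w, opnorm (phi w) <= M & equivariant phi]].

Definition invertible_in (A : set opsection) (phi : opsection) :=
  A phi /\ exists2 psi, A psi & forall w, inverse_of (phi w) (psi w).

Definition limit_operator (T : opfield R G) (w : Y) : bop R (fibre (val w)) :=
  T (val w).

Definition symbol (T : opfield R G) : opsection := limit_operator T.

End Symbol.

Arguments Cred R G : clear implicits.
Arguments Cred_reduction R {G} X.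
Arguments topologically_amenable R H : clear implicits.
Arguments Gamma R {G} Y.
Arguments limit_operator {R G} Y T w.
Arguments symbol {R G} Y T.

(* Main.v *)
(**
The regular representations at the boundary are studied by localization. As
G(boundary X) is amenable, there are functions xi in C_c(G) whose Gram kernels
sum_d conj(xi(d)) xi(d c) are close to 1 on any prescribed compact subset of
G(boundary X). Cutting a vector v on a source fibre into the pieces
a |-> xi(d a^-1) v(a) hence changes the quadratic form of lambda_w(T) v little,
while each piece lives on a right translate of a fixed compact set; by
invariance and the local product structure of an etale groupoid, on such sets
lambda_x depends continuously on the unit x.

Two consequences carry the theorem. First, sup over the boundary of
|lambda_w(T)| controls the distance from T to C*_r(G(X)), so the quotient is
seen by the limit operators. Second, if the lower bounds of the lambda_w(T) were
not uniform, almost minimal vectors could be localized at finer and finer scales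
inside one another, and compactness of the boundary would give one limit operator
that is not bounded below; this is (4) => (3). Given the uniform bound, a
polynomial in T* T, multiplied by T*, inverts T approximately on the boundary,
and a Neumann series corrects it.
*)

Require Import Defs.
From HB Require Import structures.
From mathcomp Require Import all_boot all_order all_algebra.
From mathcomp Require Import complex finmap.
From mathcomp Require Import all_classical all_reals all_analysis.
From mathcomp Require Import measurable_realfun.
From mathcomp Require Import ring lra.
From mathcomp.analysis.showcase Require summability.

Set Implicit Arguments.
Unset Strict Implicit.
Unset Printing Implicit Defensive.

Import Order.TTheory GRing.Theory Num.Theory.
Import numFieldNormedType.Exports.

Local Open Scope classical_set_scope.
Local Open Scope ring_scope.

Local Notation normc := Normc.normc.

(** * Complex numbers and topology *)

(** Norms are never handled through adjoints on infinite fibres. For [f] in C_c(G) and a finitely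
    supported v, the squared norm of lambda_x(f) v is the quadratic form of the kernel [gram f],
    that is of f* f, so all estimates concern finite sums, and density of finite vectors does the
    rest. As [gram f] has compact support, [gram xi] has to be near 1 only there and on the units,
    where it governs the total energy of the pieces. The obstacle in (4) => (3) is an order of
    quantifiers. The inverse at a unit y decides how small a quotient |T v|^2 / |v|^2 is impossible
    near y, hence which set [L j] to use, and [L j] in turn decides on which neighbourhood of y
    vectors can be transported; no scale can be fixed in advance. A finite cover leaves the scales j
    <= N, and a vector must be localized at all of them around one common arrow c, because the unit
    [grng c] is what selects j. The ratio 1/16 between consecutive levels absorbs the factor 8 lost
    in each localization. *)

Section Complex.
Variable R : realType.
Implicit Types z w : R[i].

Lemma normcE z : `|z| = (normc z)%:C%C.
Proof. by case: z. Qed.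

Lemma normc_gt0 z : (0 < normc z) = (z != 0).
Proof.
rewrite lt_neqAle normc_ge0 andbT eq_sym; congr (~~ _).
by apply/eqP/eqP => [/Normc.eq0_normc|->]//; rewrite Normc.normc0.
Qed.

Lemma normcB z w : normc (z - w) = normc (w - z).
Proof. by rewrite -normcN opprB. Qed.

Lemma le_normc_add z w : normc (z + w) <= normc z + normc w.
Proof. exact: le_normcD. Qed.

Lemma normc_conj z : normc z^* = normc z.
Proof. by have := norm_conjC z; rewrite !normcE => /complexI. Qed.

(** Balls of [R[i]] have radii in [R[i]]; a positive complex number is real, so real radii
    suffice. *)
Lemma cvgCP (T : Type) (F : set_system T) (FF : Filter F) (f : T -> R[i]) z :
  f @ F --> z <-> forall e : R, 0 < e -> \forall t \near F, normc (f t - z) < e.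
Proof.
split=> [/cvgrPdist_lt h e e0|h].
  have /h : (0 : R[i]) < e%:C%C by rewrite ltcR.
  by apply: filterS => t; rewrite normcE ltcR normcB.
apply/cvgrPdist_lt => e e0.
have eR : e = (complex.Re e)%:C%C by case: e e0 => a b; rewrite ltcE /= => /andP[/eqP -> _].
move: e0; rewrite eR ltcR => /h; apply: filterS => t.
by rewrite normcE ltcR normcB.
Qed.

Lemma normc_sqrE z : ((normc z) ^+ 2)%:C%C = z * z^*.
Proof. by rewrite -normCK normcE rmorphXn. Qed.

Lemma le_Re_normc z : `|complex.Re z| <= normc z.
Proof.
case: z => a b /=; rewrite -sqrtr_sqr ler_wsqrtr// lerDl sqr_ge0//.
Qed.

Lemma le_Im_normc z : `|complex.Im z| <= normc z.
Proof.
case: z => a b /=; rewrite -sqrtr_sqr ler_wsqrtr// lerDr sqr_ge0//.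
Qed.

Lemma normc_le_ReIm z : normc z <= `|complex.Re z| + `|complex.Im z|.
Proof.
case: z => a b /=; rewrite -[leRHS]ger0_norm ?addr_ge0// -sqrtr_sqr ler_wsqrtr//.
rewrite sqrrD !real_normK ?num_real//.
by rewrite addrAC lerDl mulrn_wge0// mulr_ge0.
Qed.

Lemma normc_sum (I : Type) (s : seq I) (F : I -> R[i]) :
  normc (\sum_(i <- s) F i) <= \sum_(i <- s) normc (F i).
Proof.
elim: s => [|i s IH]; first by rewrite !big_nil Normc.normc0.
by rewrite !big_cons (le_trans (le_normc_add _ _))// lerD2l.
Qed.

End Complex.

Section ComplexCvg.
Variables (R : realType) (T : Type) (F : set_system T).
Context {FF : Filter F}.

Lemma cvg_complex (f : T -> R) (a : R) :
  f @ F --> a -> (fun t => (f t)%:C%C) @ F --> a%:C%C.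
Proof.
move=> fa; apply/cvgCP => e e0.
have /cvgrPdist_lt/(_ e e0) := fa; apply: filterS => t.
by rewrite -rmorphB /= expr0n addr0 sqrtr_sqr distrC.
Qed.

Lemma cvg_normc (f : T -> R[i]) z : f @ F --> z -> (fun t => normc (f t)) @ F --> normc z.
Proof.
move=> /cvgCP fz; apply/cvgrPdist_lt => e /fz; apply: filterS => t /=.
apply: le_lt_trans; rewrite ler_norml; apply/andP; split.
  have := le_normc_add (f t - z) z; rewrite subrK; lra.
have := le_normc_add (z - f t) (f t); rewrite subrK normcB; lra.
Qed.

Lemma cvg_conjc (f : T -> R[i]) z : f @ F --> z -> (fun t => (f t)^*) @ F --> z^*.
Proof.
move=> /cvgCP fz; apply/cvgCP => e /fz; apply: filterS => t.
by rewrite -rmorphB normc_conj.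
Qed.

Lemma cvg_Re (f : T -> R[i]) z :
  f @ F --> z -> (fun t => complex.Re (f t)) @ F --> complex.Re z.
Proof.
move=> /cvgCP fz; apply/cvgrPdist_lt => e /fz; apply: filterS => t.
by rewrite distrC -raddfB; exact: le_lt_trans (le_Re_normc _).
Qed.

Lemma cvg_bigsum (I : eqType) (s : seq I) (f : I -> T -> R[i]) (a : I -> R[i]) :
  (forall i, i \in s -> f i @ F --> a i) ->
  (fun t => \sum_(i <- s) f i t) @ F --> \sum_(i <- s) a i.
Proof.
elim: s => [_|i s IH fa].
  rewrite big_nil (_ : (fun t => _) = (fun=> 0)); first exact: cvg_cst.
  by apply/funext => t; rewrite big_nil.
rewrite big_cons (_ : (fun t => _) = (fun t => f i t + \sum_(j <- s) f j t)).
  apply: (cvgD (fa i _) (IH _)); first by rewrite inE eqxx.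
  by move=> j js; apply: fa; rewrite inE js orbT.
by apply/funext => t; rewrite big_cons.
Qed.

End ComplexCvg.

Lemma urysohn_function (R : realType) (X : topologicalType) (A B : set X) :
  normal_space X -> closed A -> closed B -> A `&` B = set0 ->
  exists u : X -> R, [/\ continuous u, forall x, 0 <= u x <= 1,
    forall x, A x -> u x = 0 & forall x, B x -> u x = 1].
Proof.
move=> nX clA clB AB; have us := (@normal_separatorP R X).1 nX _ _ clA clB AB.
exists (Urysohn A B); split.
- exact: Urysohn_continuous.
- by move=> x; have := Urysohn_range (R := R) (A := A) (B := B) (imageT _ x); rewrite /= in_itv.
- by move=> x Ax; apply: (Urysohn_sub0 us); exists x.
- by move=> x Bx; apply: (Urysohn_sub1 us); exists x.
Qed.

(** The ramp is zero as soon as [u x <= 1 / 2], so its support stays in the closed set where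
    [u >= 1 / 2], whereas the support of [u] itself may touch its zero set. *)
Lemma continuous_ramp (R : realType) (X : topologicalType) (u : X -> R) :
  continuous u -> continuous (fun x => Num.max 0 (2 * u x - 1)).
Proof.
move=> cu x; apply: (@continuous_max R X (fun=> 0) (fun x => 2 * u x - 1)).
  exact: cvg_cst.
by apply: cvgB; [apply: cvgM; [exact: cvg_cst|exact: cu]|exact: cvg_cst].
Qed.

(** * Cutoffs and extensions in locally compact Hausdorff spaces *)

Section Topology.
Variable X : topologicalType.

Lemma compact_set_val (A K : set X) : compact K -> K `<=` A ->
  compact ((fun a : A => val a) @^-1` K).
Proof.
move=> cK KA F PF FK.
have PG : ProperFilter ((@set_val X A) @ F) by exact: fmap_proper_filter.
have [|p [Kp clp]] := cK _ PG; first exact: FK.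
have Ap : p \in A by exact/mem_set/KA.
exists (exist (fun x => x \in A) p Ap); split => // U V FU [_ [[W oW <-]] /= Wp WV].
have FU' : F (fun a => (set_val @` U) (set_val a)).
  by apply: filterS FU => a Ua; exists a.
have [] := clp _ W FU'; first exact: open_nbhs_nbhs.
move=> _ [[a Ua <-] Wa]; exists a; split => //; exact: WV.
Qed.

Hypothesis HX : hausdorff_space X.
Hypothesis LX : locally_compact [set: X].
(** The compactification is compact Hausdorff, hence normal: Urysohn and Tietze are applied there
    and the results restricted to [X]. *)
Let opc := one_point_compactification X.

Let opc_hausdorff : hausdorff_space opc.
Proof. exact: one_point_compactification_hausdorff. Qed.

Let opc_normal : normal_space opc.
Proof.
by apply: compact_normal => //; exact: one_point_compactification_compact.
Qed.

Lemma closed_compact_closure (A B : set X) :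
  closed B -> compact B -> A `<=` B -> compact (closure A).
Proof.
move=> clB cB AB; apply: (subclosed_compact (@closed_closure _ _) cB).
by rewrite ((closure_id B).1 clB); exact: closureS.
Qed.

Lemma bump_ex (R : realType) (K U : set X) : compact K -> open U -> K `<=` U ->
  exists chi : X -> R, [/\ continuous chi, forall x, 0 <= chi x <= 1,
    forall x, K x -> chi x = 1, forall x, ~ U x -> chi x = 0 &
    compact (closure [set x | chi x != 0])].
Proof.
move=> cK oU KU.
pose A : set opc := ~` (Some @` U); pose B : set opc := Some @` K.
have clA : closed A by apply/open_closedC/one_point_compactification_open_some.
have clB : closed B.
  apply: compact_closed => //; apply: continuous_compact => //.
  apply: continuous_subspaceT => x.
  exact: one_point_compactification_some_continuous.
have AB : A `&` B = set0.
  by apply/seteqP; split => // p [nU [x Kx xp]]; apply: nU; exists x => //; exact: KU.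
have [u [cu u01 uA uB]] := urysohn_function R opc_normal clA clB AB.
pose v (x : X) : R := u (Some x).
have cv : continuous v.
  move=> x; apply: (cvg_comp (Some : X -> opc) u) (cu _).
  exact: one_point_compactification_some_continuous.
exists (fun x => Num.max 0 (2 * v x - 1)); split.
- exact: continuous_ramp.
- move=> x; have /andP[] := u01 (Some x); rewrite -/(v x) => ? ?.
  by rewrite le_max lexx/= ge_max ler01/=; lra.
- move=> x Kx; rewrite /v uB; last by exists x.
  by rewrite max_r; lra.
- move=> x Ux; rewrite /v uA; last by move=> [y Uy [yx]]; apply: Ux; rewrite -yx.
  by rewrite max_l; lra.
(* [u] vanishes at infinity because [A] contains [None]; so [C] misses a neighbourhood of infinity,
   and its points in [X] lie in a compact set. *)
pose C := [set p | 1/2 <= u p].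
have : nbhs (None : opc) (~` C).
  apply: open_nbhs_nbhs; split.
    apply: closed_openC.
    by apply: (@preimage_closed _ _ u [set x | 1/2 <= x]) => [p _|]; [exact: cu|exact: closed_ge].
  by rewrite /C /= uA; [lra|case].
move=> [W [cW clW] WC].
apply: (closed_compact_closure clW cW) => x /= vx.
apply: contrapT => nWx; have := WC (Some x).
case; first by left; exists x.
rewrite /C /= -/(v x) leNgt; apply/negP => vx2; move/eqP: vx; apply.
by rewrite max_l//; lra.
Qed.

(** Adding infinity to [H] with value 0 keeps [f] continuous, since [f] vanishes off [K]; Tietze
    then applies in the compactification. The support of [g] is not controlled, so a cutoff has to
    be applied afterwards. *)
Lemma compactly_supported_extension (R : realType) (H K : set X) (f : X -> R) M :
  closed H -> compact K -> {within H, continuous f} ->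
  (forall x, H x -> `|f x| <= M) -> (forall x, H x -> ~ K x -> f x = 0) ->
  exists2 g : X -> R, continuous g & forall x, H x -> g x = f x.
Proof.
move=> clH cK cf fM fK.
pose A : set opc := Some @` H `|` [set None].
pose f0 (p : opc) : R := if p is Some x then f x else 0.
have clA : closed A.
  have -> : A = ~` (Some @` (~` H)).
    apply/seteqP; split => [p [[x Hx <-]|->]|[x nH|_]]; [|by case| |by right].
      by move=> [y nHy [yx]]; apply: nHy; rewrite yx.
    left; exists x => //; apply: contrapT => nHx; apply: nH; by exists x.
  by apply/open_closedC/one_point_compactification_open_some/closed_openC.
have fA p : A p -> `|f0 p| <= `|M|.
  move=> [[x Hx <-]|->] /=; last by rewrite normr0.
  by apply: le_trans (fM x Hx) (ler_norm _).
have cf0 : {within A, continuous (f0 : opc -> R^o)}.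
  apply/subspace_continuousP => p [[x Hx <-]|->] V.
    move=> Vf; have /subspace_continuousP/(_ x Hx V Vf) := cf.
    rewrite !nbhs_simpl /within /=.
    move=> h; change (nbhs x [set y | A (Some y) -> V (f0 (Some y))]).
    apply: filterS h => y h [[z Hz [zy]]|//]; apply: h; by rewrite -zy.
  move=> V0; rewrite !nbhs_simpl /within /=; exists K.
    by split => //; exact: compact_closed.
  move=> q hq Aq; have f0q : f0 q = 0.
    case: hq Aq => [[x nK <-]|->] //= [[y Hy [yx]]|//].
    by apply: fK; rewrite -yx// in nK *.
  by change (V (f0 q)); rewrite f0q; exact: nbhs_singleton V0.
have M0 : 0 < `|M| + 1 by rewrite ltr_pwDr.
have fA1 p : A p -> `|f0 p| <= `|M| + 1.
  by move=> /fA /le_trans; apply; rewrite lerDl.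
have [g [gf cg _]] := continuous_bounded_extension opc_normal clA M0 cf0 fA1.
exists (g \o Some) => [x|x Hx].
  apply: (cvg_comp (Some : X -> opc) g) (cg _).
  exact: one_point_compactification_some_continuous.
by rewrite /= -gf//; apply/mem_set; left; exists x.
Qed.

End Topology.

Lemma le_of_eps (R : realType) (x y c : R) : 0 <= c ->
  (forall e, 0 < e -> x <= y + c * e) -> x <= y.
Proof.
move=> c0 h; apply/ler_addgt0Pr => e e0.
have c1 : 0 < c + 1 by rewrite ltr_wpDl.
apply: le_trans (h (e / (c + 1)) (divr_gt0 e0 c1)) _; rewrite lerD2l.
rewrite mulrA ler_pdivrMr// mulrC ler_wpM2l ?(ltW e0)//; lra.
Qed.

Lemma big_support (I : eqType) (V : nmodType) (s s' : seq I) (F : I -> V) :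
  uniq s -> uniq s' -> (forall i, i \in s -> i \notin s' -> F i = 0) ->
  (forall i, i \in s' -> i \notin s -> F i = 0) ->
  \sum_(i <- s) F i = \sum_(i <- s') F i.
Proof.
move=> us us' h h'.
rewrite (bigID (mem s')) /= [X in _ + X]big_seq_cond [X in _ + X]big1 ?addr0; last first.
  by move=> i /andP[]; exact: h.
rewrite [RHS](bigID (mem s)) /= [X in _ = _ + X]big_seq_cond [X in _ = _ + X]big1 ?addr0; last first.
  by move=> i /andP[]; exact: h'.
rewrite -[LHS]big_filter -[RHS]big_filter; apply: perm_big; apply: uniq_perm; rewrite ?filter_uniq//.
by move=> i; rewrite !mem_filter andbC.
Qed.

(** * Square-summable vectors and bounded operators *)

Section L2Norm.
Variables (R : realType) (T : choiceType) (D : set T).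
Local Notation l2 := (l2 R D).
Implicit Types (xi eta : l2) (s : seq T).

(** Duplicate-free lists play the role of finite subsets of [D]: the squared norm is the supremum of
    sums over them. *)
Definition in_dom s := uniq s /\ forall t, t \in s -> D t.

Lemma sqnorm_ge_seq (f : T -> R[i]) s : in_dom s ->
  ((\sum_(t <- s) normc (f t) ^+ 2)%:E <= sqnorm D f)%E.
Proof.
move=> [us sD]; apply: esum_ge; exists [set` s].
  by split => [|t /= ts]; [exact: finite_seq|exact: sD].
by rewrite -fsbig_seq// sumEFin.
Qed.

Lemma sqnorm_le_seq (f : T -> R[i]) (M : R) :
  (forall s, in_dom s -> \sum_(t <- s) normc (f t) ^+ 2 <= M) ->
  (sqnorm D f <= M%:E)%E.
Proof.
move=> h; apply: ge_ereal_sup => _ [X [fX XD] <-].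
rewrite fsbig_finite//= sumEFin lee_fin; apply: h; split => [|t].
  exact: finmap.fset_uniq.
by rewrite in_fset_set// => /set_mem /XD.
Qed.

Lemma l2norm_ge0 xi : 0 <= l2norm xi.
Proof. exact: sqrtr_ge0. Qed.

Lemma l2norm_sqr xi : l2norm xi ^+ 2 = fine (sqnorm D xi).
Proof. by rewrite sqr_sqrtr// fine_ge0// sqnorm_ge0. Qed.

Lemma l2norm_ge_seq xi s : in_dom s ->
  \sum_(t <- s) normc (xi t) ^+ 2 <= l2norm xi ^+ 2.
Proof.
by move=> /sqnorm_ge_seq h; rewrite l2norm_sqr -lee_fin fineK ?sqnorm_fin// h.
Qed.

Lemma l2norm_le_seq xi (M : R) :
  (forall s, in_dom s -> \sum_(t <- s) normc (xi t) ^+ 2 <= M) ->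
  l2norm xi ^+ 2 <= M.
Proof.
by move=> /sqnorm_le_seq h; rewrite l2norm_sqr -lee_fin fineK ?sqnorm_fin// h.
Qed.

Lemma l2_out xi t : ~ D t -> xi t = 0.
Proof. by have /asboolP[h _] := l2valP xi; exact: h. Qed.

Lemma l2norm_ge_coord xi t : normc (xi t) <= l2norm xi.
Proof.
have [Dt|nD] := pselect (D t); last by rewrite l2_out// Normc.normc0 l2norm_ge0.
rewrite -(@ler_pXn2r _ 2)// ?nnegrE ?normc_ge0 ?l2norm_ge0//.
have /(l2norm_ge_seq xi) : in_dom [:: t] by split => // u; rewrite inE => /eqP ->.
by rewrite big_seq1.
Qed.

Lemma l2norm_eq0 xi : l2norm xi = 0 -> xi = 0.
Proof.
move=> h; apply: val_inj; apply/funext => t.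
apply: Normc.eq0_normc; apply/eqP; rewrite eq_le normc_ge0 andbT -h.
exact: l2norm_ge_coord.
Qed.

Lemma l2normZ_le (a : R[i]) xi : l2norm (a *: xi) <= normc a * l2norm xi.
Proof.
rewrite -(@ler_pXn2r _ 2)// ?nnegrE ?mulr_ge0 ?normc_ge0 ?l2norm_ge0//.
apply: l2norm_le_seq => s sD; rewrite exprMn.
apply: le_trans (ler_wpM2l (sqr_ge0 _) (l2norm_ge_seq xi sD)).
rewrite mulr_sumr ler_sum// => t _.
by rewrite (_ : (a *: xi) t = a * xi t)// Normc.normcM exprMn.
Qed.

Lemma l2normZ (a : R[i]) xi : l2norm (a *: xi) = normc a * l2norm xi.
Proof.
apply/eqP; rewrite eq_le l2normZ_le/=.
have [->|a0] := eqVneq a 0; first by rewrite Normc.normc0 mul0r l2norm_ge0.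
have := l2normZ_le a^-1 (a *: xi); rewrite scalerA mulVf// scale1r.
have an : 0 < normc a by rewrite normc_gt0.
by rewrite Normc.normcV mulrC ler_pdivlMr// mulrC.
Qed.

(* Uses [|a + b|^2 <= (1 + c) |a|^2 + (1 + 1/c) |b|^2] with [c = |eta| / |xi|]. *)
Lemma l2normD xi eta : l2norm (xi + eta) <= l2norm xi + l2norm eta.
Proof.
have [x0|x0] := eqVneq (l2norm xi) 0; first by rewrite (l2norm_eq0 x0) add0r lerDr l2norm_ge0.
have [y0|y0] := eqVneq (l2norm eta) 0; first by rewrite (l2norm_eq0 y0) addr0 lerDl l2norm_ge0.
have {}x0 : 0 < l2norm xi by rewrite lt_def x0 l2norm_ge0.
have {}y0 : 0 < l2norm eta by rewrite lt_def y0 l2norm_ge0.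
rewrite -(@ler_pXn2r _ 2)// ?nnegrE ?addr_ge0 ?l2norm_ge0//.
apply: l2norm_le_seq => s sD.
set x := l2norm xi in x0 *; set y := l2norm eta in y0 *.
pose c := y / x; have c0 : 0 < c by exact: divr_gt0.
have h : \sum_(t <- s) normc ((xi + eta) t) ^+ 2 <=
    (1 + c) * (\sum_(t <- s) normc (xi t) ^+ 2) +
    (1 + c^-1) * (\sum_(t <- s) normc (eta t) ^+ 2).
  rewrite !mulr_sumr -big_split /=; apply: ler_sum => t _.
  apply: (@le_trans _ _ ((normc (xi t) + normc (eta t)) ^+ 2)).
    by rewrite ler_pXn2r ?nnegrE ?addr_ge0 ?normc_ge0//; exact: le_normc_add.
  set a := normc _; set b := normc _.
  rewrite -subr_ge0.
  have -> : (1 + c) * a ^+ 2 + (1 + c^-1) * b ^+ 2 - (a + b) ^+ 2 = c^-1 * (c * a - b) ^+ 2.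
    by field; rewrite gt_eqF.
  by rewrite mulr_ge0 ?sqr_ge0// invr_ge0 ltW.
apply: (le_trans h); apply: (@le_trans _ _ ((1 + c) * x ^+ 2 + (1 + c^-1) * y ^+ 2)).
  by apply: lerD; rewrite ler_wpM2l ?l2norm_ge_seq ?addr_ge0 ?ler01 ?invr_ge0 ?(ltW c0).
by rewrite le_eqVlt; apply/orP; left; apply/eqP; rewrite /c; field; rewrite !gt_eqF.
Qed.

Lemma bop_bounded (A : bop R D) : linear A /\
  exists2 M : R, 0 <= M & forall xi, l2norm (A xi) <= M * l2norm xi.
Proof.
have /asboolP[lA [M hM]] := bopvalP A; split => //; exists `|M| => // xi.
by apply: le_trans (hM xi) _; rewrite ler_wpM2r ?l2norm_ge0// ler_norm.
Qed.

Lemma bopZ (A : bop R D) a xi : A (a *: xi) = a *: A xi.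
Proof.
have [lA _] := bop_bounded A; have A0 : A 0 = 0.
  by have := lA (-1) 0 0; rewrite !scaleN1r oppr0 addr0 addNr.
by have := lA a xi 0; rewrite !addr0 A0 addr0.
Qed.

Lemma bopD (A : bop R D) xi eta : A (xi + eta) = A xi + A eta.
Proof. by have [lA _] := bop_bounded A; have := lA 1 xi eta; rewrite !scale1r. Qed.

Lemma bopB (A : bop R D) xi eta : A (xi - eta) = A xi - A eta.
Proof. by rewrite -scaleN1r bopD bopZ scaleN1r. Qed.

Lemma le_opnorm (A : bop R D) xi : l2norm (A xi) <= opnorm A * l2norm xi.
Proof.
have [_ [M M0 hM]] := bop_bounded A.
have ub : has_ubound [set l2norm (A z) | z in [set z | l2norm z <= 1]].
  exists M => _ [z /= z1 <-]; apply: le_trans (hM z) _.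
  by rewrite -[leRHS]mulr1 ler_wpM2l.
have [x0|x0] := eqVneq (l2norm xi) 0.
  rewrite (l2norm_eq0 x0) l2norm0 mulr0.
  by have := bopZ A 0 0; rewrite !scale0r => ->; rewrite l2norm0.
have x1 : 0 < l2norm xi by rewrite lt_def x0 l2norm_ge0.
have nV : normc ((l2norm xi)^-1%:C%C : R[i]) = (l2norm xi)^-1.
  by rewrite /= expr0n addr0 sqrtr_sqr ger0_norm// invr_ge0 ltW.
have : l2norm (A ((l2norm xi)^-1%:C%C *: xi)) <= opnorm A.
  apply: ub_le_sup => //; exists ((l2norm xi)^-1%:C%C *: xi) => //=.
  by rewrite l2normZ nV mulVf.
by rewrite bopZ l2normZ nV mulrC ler_pdivrMr.
Qed.

Lemma opnorm_le (A : bop R D) (M : R) : 0 <= M ->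
  (forall xi, l2norm (A xi) <= M * l2norm xi) -> opnorm A <= M.
Proof.
move=> M0 h; apply: ge_sup.
  by exists (l2norm (A 0)); exists 0 => //=; rewrite l2norm0.
move=> _ [z /= z1 <-]; apply: le_trans (h z) _.
by rewrite -[leRHS]mulr1 ler_wpM2l.
Qed.

Lemma opnorm_ge0 (A : bop R D) : 0 <= opnorm A.
Proof.
have [_ [M M0 hM]] := bop_bounded A.
apply: (@le_trans _ _ (l2norm (A 0))); first exact: l2norm_ge0.
apply: ub_le_sup; last by exists 0 => //=; rewrite l2norm0.
exists M => _ [z /= z1 <-]; apply: le_trans (hM z) _.
by rewrite -[leRHS]mulr1 ler_wpM2l.
Qed.

Lemma opnormD (A B : bop R D) : opnorm (A + B) <= opnorm A + opnorm B.
Proof.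
apply: opnorm_le => [|xi]; first by rewrite addr_ge0 ?opnorm_ge0.
rewrite mulrDl; apply: le_trans (l2normD (A xi) (B xi)) _.
by rewrite lerD// le_opnorm.
Qed.

Lemma opnormN (A : bop R D) : opnorm (- A) = opnorm A.
Proof.
have h (B : bop R D) : opnorm (- B) <= opnorm B.
  apply: opnorm_le (opnorm_ge0 B) _ => xi.
  by rewrite (_ : (- B) xi = - B xi)// l2normN le_opnorm.
by apply/eqP; rewrite eq_le h -{1}[A]opprK h.
Qed.

Lemma opnormB (A B : bop R D) : opnorm (A - B) = opnorm (B - A).
Proof. by rewrite -opnormN opprB. Qed.

Lemma opnormM (A B : bop R D) : opnorm (A * B) <= opnorm A * opnorm B.
Proof.
apply: opnorm_le => [|xi]; first by rewrite mulr_ge0 ?opnorm_ge0.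
apply: le_trans (le_opnorm A (B xi)) _.
by rewrite -mulrA ler_wpM2l ?opnorm_ge0// le_opnorm.
Qed.

Lemma opnorm0 : opnorm (0 : bop R D) = 0.
Proof.
apply/eqP; rewrite eq_le opnorm_ge0 andbT; apply: opnorm_le => // xi.
by rewrite (_ : (0 : bop R D) xi = 0)// l2norm0 mul0r.
Qed.

Lemma opnorm1_le : opnorm (1 : bop R D) <= 1.
Proof. by apply: opnorm_le => // xi; rewrite mul1r. Qed.

Lemma opnorm_eq0 (A : bop R D) : opnorm A <= 0 -> A = 0.
Proof.
move=> h; apply: val_inj; apply/funext => xi; apply: l2norm_eq0.
apply/eqP; rewrite eq_le l2norm_ge0 andbT; apply: le_trans (le_opnorm A xi) _.
by rewrite mulr_le0_ge0 ?l2norm_ge0.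
Qed.

Lemma inverse_bounded_below (A B : bop R D) xi : inverse_of A B ->
  l2norm xi <= opnorm B * l2norm (A xi).
Proof.
move=> [_ BA]; apply: le_trans (le_opnorm B (A xi)).
by rewrite (_ : B (A xi) = (B * A) xi)// BA.
Qed.

Lemma inverse_unique (A B C : bop R D) : inverse_of A B -> inverse_of A C -> B = C.
Proof. by move=> [_ BA] [CA _]; rewrite -[B]mulr1 -CA mulrA BA mul1r. Qed.

End L2Norm.

Section FiniteVectors.
Variables (R : realType) (T : choiceType) (D : set T).
Local Notation l2 := (l2 R D).
Implicit Types (xi eta : l2) (s : seq T) (v : T -> R[i]).

Lemma l2_intro (f : T -> R[i]) (M : R) : (forall t, ~ D t -> f t = 0) ->
  (forall s, in_dom D s -> \sum_(t <- s) normc (f t) ^+ 2 <= M) -> f \in l2_pred D.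
Proof.
move=> f0 fM; apply/asboolP; split => //.
by apply: le_lt_trans (sqnorm_le_seq fM) (ltry _).
Qed.

Definition energy s v : R := \sum_(t <- s) normc (v t) ^+ 2.

Lemma energy_ge0 s v : 0 <= energy s v.
Proof. by rewrite sumr_ge0// => t _; rewrite sqr_ge0. Qed.

Lemma energy_le s s' v : uniq s -> uniq s' ->
  (forall t, t \in s -> v t != 0 -> t \in s') -> energy s v <= energy s' v.
Proof.
move=> us us' ss'.
have -> : energy s v = energy [seq t <- s | v t != 0] v.
  apply: big_support => //; first exact: filter_uniq.
    move=> t ts; rewrite mem_filter ts andbT negbK => /eqP ->.
    by rewrite Normc.normc0 expr0n.
  by move=> t; rewrite mem_filter => /andP[_ ->].
have -> : energy s' v = energy [seq t <- s' | (t \in s) && (v t != 0)] v +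
    energy [seq t <- s' | ~~ ((t \in s) && (v t != 0))] v.
  by rewrite /energy !big_filter (bigID (fun t => (t \in s) && (v t != 0))).
rewrite -[leLHS]addr0 lerD ?energy_ge0// /energy le_eqVlt; apply/orP; left.
apply/eqP/big_support; rewrite ?filter_uniq// => t; rewrite !mem_filter.
  by move=> /andP[v0 ts]; rewrite v0 ts/= ss'.
by move=> /andP[/andP[-> ->]].
Qed.

(** The test [t \in D] puts this family in [l2] for every list, so that [fvec] takes no proof
    argument. *)
Definition fvec_fun s v (t : T) : R[i] := if (t \in s) && (t \in D) then v t else 0.

Lemma fvec_l2 s v : fvec_fun s v \in l2_pred D.
Proof.
apply: (@l2_intro _ (energy (undup s) v)) => [t nD|s' [us' _]].
  by rewrite /fvec_fun [t \in D]memNset ?andbF.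
apply: le_trans (_ : _ <= energy s' (fvec_fun s v)) _ => //.
apply: le_trans (_ : _ <= energy (undup s) (fvec_fun s v)) _.
  apply: energy_le => // [|t _]; first exact: undup_uniq.
  by rewrite /fvec_fun mem_undup; case: (t \in s); rewrite //= eqxx.
apply: ler_sum => t _; rewrite /fvec_fun; case: ifP => // _.
by rewrite Normc.normc0 expr0n sqr_ge0.
Qed.

Definition fvec s v : l2 := L2 (fvec_l2 s v).

Lemma fvecE s v t : in_dom D s -> fvec s v t = if t \in s then v t else 0.
Proof.
move=> [_ sD]; rewrite /= /fvec_fun; case: ifPn => [/andP[->]//|].
by case: ifP => //= ts; rewrite mem_set//; exact: sD.
Qed.

Lemma l2norm_fvec s v : in_dom D s -> l2norm (fvec s v) ^+ 2 = energy s v.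
Proof.
move=> sD; apply/eqP; rewrite eq_le; apply/andP; split; last first.
  apply: le_trans (l2norm_ge_seq (fvec s v) sD).
  rewrite le_eqVlt; apply/orP; left; apply/eqP; apply: eq_big_seq => t ts.
  by rewrite fvecE// ts.
apply: l2norm_le_seq => s' [us' _].
apply: le_trans (_ : energy s' (fvec s v) <= _); first by [].
apply: le_trans (energy_le (s' := s) us' sD.1 _) _.
  by move=> t _; rewrite fvecE//; case: ifP => //; rewrite eqxx.
by apply: ler_sum => t _; rewrite fvecE//; case: ifP => // _;
  rewrite Normc.normc0 expr0n sqr_ge0.
Qed.

Lemma l2norm_fvec_le xi s : in_dom D s -> l2norm (fvec s xi) <= l2norm xi.
Proof.
move=> sD; rewrite -(@ler_pXn2r _ 2)// ?nnegrE ?l2norm_ge0//.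
by rewrite l2norm_fvec// l2norm_ge_seq.
Qed.

(** A list whose energy is within [e ^+ 2] of the supremum leaves at most [e ^+ 2] for any list
    disjoint from it. *)
Lemma fvec_dense xi (e : R) : 0 < e ->
  exists2 s, in_dom D s & l2norm (xi - fvec s xi) <= e.
Proof.
move=> e0; pose N := l2norm xi ^+ 2.
have [s sD sN] : exists2 s, in_dom D s & N - e ^+ 2 <= energy s xi.
  apply: contrapT => h.
  have : N <= N - e ^+ 2.
    apply: l2norm_le_seq => s sD; rewrite leNgt; apply/negP => hs.
    by apply: h; exists s => //; exact: ltW.
  by rewrite leNgt gtrBl exprn_gt0.
exists s => //; rewrite -(@ler_pXn2r _ 2)// ?nnegrE ?l2norm_ge0 ?(ltW e0)//.
apply: l2norm_le_seq => s' [us' s'D].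
pose u := [seq t <- s' | t \notin s].
have uD : in_dom D (u ++ s).
  split; last by move=> t; rewrite mem_cat mem_filter => /orP[/andP[_ /s'D//]|/sD.2].
  rewrite cat_uniq sD.1 filter_uniq// andbT /=; apply/hasPn => t ts.
  by rewrite mem_filter ts.
have := l2norm_ge_seq xi uD; rewrite big_cat /= -/(energy s xi) -/(energy u xi) -/N => h.
suff -> : \sum_(t <- s') normc ((xi - fvec s xi) t) ^+ 2 = energy u xi.
  by rewrite -(lerD2r (energy s xi)); apply: le_trans h _; rewrite -lerBlDl.
have E t : (xi - fvec s xi) t = if t \in s then 0 else xi t.
  rewrite (_ : (xi - fvec s xi) t = xi t - fvec s xi t)// fvecE//.
  by case: ifP; rewrite ?subrr ?subr0.
rewrite /energy big_filter [RHS]big_mkcond; apply: eq_bigr => t _.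
by rewrite E; case: (t \in s); rewrite ?Normc.normc0 ?expr0n.
Qed.

(** On finite vectors lambda_x(f) has finite sums as coordinates, and this reduces operator bounds
    to them. *)
Lemma bop_bound_dense (A : bop R D) (M : R) : 0 <= M ->
  (forall s v, in_dom D s -> l2norm (A (fvec s v)) <= M * l2norm (fvec s v)) ->
  forall xi, l2norm (A xi) <= M * l2norm xi.
Proof.
move=> M0 h xi; apply: (@le_of_eps _ _ _ (opnorm A)); first exact: opnorm_ge0.
move=> e e0; have [s sD se] := fvec_dense xi e0.
rewrite -[in leLHS](subrK (fvec s xi) xi) bopD.
apply: le_trans (l2normD _ _) _; rewrite addrC lerD//.
  by apply: le_trans (h s xi sD) _; rewrite ler_wpM2l// l2norm_fvec_le.
by apply: le_trans (le_opnorm A _) _; rewrite ler_wpM2l// opnorm_ge0.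
Qed.

Lemma bop_bounded_below_dense (A : bop R D) (M : R) : 0 <= M ->
  (forall s v, in_dom D s -> M * l2norm (fvec s v) <= l2norm (A (fvec s v))) ->
  forall xi, M * l2norm xi <= l2norm (A xi).
Proof.
move=> M0 h xi; apply: (@le_of_eps _ _ _ (opnorm A + M)).
  by rewrite addr_ge0// opnorm_ge0.
move=> e e0; have [s sD se] := fvec_dense xi e0.
have h1 : l2norm xi <= e + l2norm (fvec s xi).
  by rewrite -[in leLHS](subrK (fvec s xi) xi) (le_trans (l2normD _ _))// lerD2r.
have h2 : l2norm (A (fvec s xi)) <= l2norm (A xi) + opnorm A * e.
  have -> : fvec s xi = xi - (xi - fvec s xi) by rewrite opprB addrC subrK.
  rewrite bopB; apply: le_trans (l2normD _ _) _; rewrite l2normN lerD2l.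
  by apply: le_trans (le_opnorm A _) _; rewrite ler_wpM2l// opnorm_ge0.
have h3 := ler_wpM2l M0 h1; rewrite mulrDr in h3.
have := h s xi sD; rewrite mulrDl; lra.
Qed.

End FiniteVectors.

(** * Completeness of the algebra of bounded operators *)

Section Completeness.
Variable R : realType.

Lemma complex_cauchy (u : nat -> R[i]) (r : nat -> R) :
  (forall n m, (n <= m)%N -> normc (u m - u n) <= r n) -> r @ \oo --> 0 ->
  exists l : R[i], u @ \oo --> l.
Proof.
move=> ur r0.
(* [g] will be the real and then the imaginary part, both 1-Lipschitz. *)
have key (g : R[i] -> R) : (forall z w, `|g z - g w| <= normc (z - w)) ->
    exists l : R, g \o u @ \oo --> l.
  move=> gn; suff /cauchy_cvgP h : cauchy (g \o u @ \oo) by exists (lim (g \o u @ \oo)).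
  apply/cauchy_ballP => e e0.
  have e2 : 0 < e / 2 by exact: divr_gt0.
  have /cvgrPdist_lt/(_ _ e2)[N _ hN] := r0.
  have rN : r N < e / 2.
    by apply: le_lt_trans (hN N (leqnn N)); rewrite sub0r normrN ler_norm.
  exists ([set x | exists2 n, (N <= n)%N & x = g (u n)],
          [set x | exists2 n, (N <= n)%N & x = g (u n)]) => /=.
    by split; exists N => // n Nn /=; exists n.
  move=> [_ _] [/= [n Nn ->] [m Nm ->]]; rewrite -ball_normE /ball_ /=.
  have -> : g (u n) - g (u m) = (g (u n) - g (u N)) - (g (u m) - g (u N)) by ring.
  apply: le_lt_trans (ler_normB _ _) _.
  have := le_trans (gn (u n) (u N)) (ur _ _ Nn).
  have := le_trans (gn (u m) (u N)) (ur _ _ Nm).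
  lra.
have [a ua] : exists a : R, (@complex.Re R) \o u @ \oo --> a.
  by apply: key => z w; rewrite -raddfB le_Re_normc.
have [b ub] : exists b : R, (@complex.Im R) \o u @ \oo --> b.
  by apply: key => z w; rewrite -raddfB le_Im_normc.
exists (a +i* b)%C; apply/cvgCP => e e0.
have e2 : 0 < e / 2 by exact: divr_gt0.
have /cvgrPdist_lt/(_ _ e2) ha := ua; have /cvgrPdist_lt/(_ _ e2) hb := ub.
near=> n; apply: le_lt_trans (normc_le_ReIm _) _; rewrite [ltRHS]splitr ltrD//.
  rewrite raddfB /= distrC; near: n; exact: ha.
rewrite raddfB /= distrC; near: n; exact: hb.
Unshelve. all: by end_near. Qed.

Variables (T : choiceType) (D : set T).

(** The limit is built coordinate by coordinate; the estimates of finite sums of squares pass to the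
    limit and give both square-summability and the rate [r n]. *)
Lemma bop_complete (S : nat -> bop R D) (r : nat -> R) :
  (forall n m, (n <= m)%N -> opnorm (S m - S n) <= r n) -> r @ \oo --> 0 ->
  exists A : bop R D, forall n, opnorm (A - S n) <= r n.
Proof.
move=> Sr r0.
have rge0 n : 0 <= r n by apply: le_trans (Sr n n (leqnn n)); exact: opnorm_ge0.
have Sd n m xi : (n <= m)%N -> l2norm (S m xi - S n xi) <= r n * l2norm xi.
  move=> nm; apply: le_trans (le_opnorm (S m - S n) xi) _.
  by rewrite ler_wpM2r ?l2norm_ge0// Sr.
have /choice[L0 L0P] : forall p : l2 R D * T, exists l : R[i], (fun n => S n p.1 p.2) @ \oo --> l.
  move=> [xi t] /=; apply: (@complex_cauchy _ (fun n => r n * l2norm xi)).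
    move=> n m nm; apply: le_trans (Sd n m xi nm).
    exact: (l2norm_ge_coord (S m xi - S n xi) t).
  by rewrite -[0](mul0r (l2norm xi)); apply: cvgM => //; exact: cvg_cst.
pose L xi t := L0 (xi, t).
have LP xi t : (fun n => S n xi t) @ \oo --> L xi t by exact: (L0P (xi, t)).
have Lun xi t l : (fun n => S n xi t) @ \oo --> l -> L xi t = l.
  by move=> h; apply: cvg_unique (LP xi t) h; exact: norm_hausdorff.
have Ld xi n s : in_dom D s ->
    \sum_(t <- s) normc (L xi t - S n xi t) ^+ 2 <= (r n * l2norm xi) ^+ 2.
  move=> sD.
  have h : (fun m => \sum_(t <- s) normc (S m xi t - S n xi t) ^+ 2) @ \oo -->
      \sum_(t <- s) normc (L xi t - S n xi t) ^+ 2.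
    elim: s {sD} => [|t s IH].
      rewrite big_nil (_ : (fun _ => _) = (fun=> 0)); first exact: cvg_cst.
      by apply/funext => m; rewrite big_nil.
    rewrite big_cons (_ : (fun _ => _) = (fun m => normc (S m xi t - S n xi t) ^+ 2 +
      \sum_(t <- s) normc (S m xi t - S n xi t) ^+ 2)); last first.
      by apply/funext => m; rewrite big_cons.
    apply: cvgD IH; rewrite expr2; under eq_fun do rewrite expr2.
    have hh : (fun m => normc (S m xi t - S n xi t)) @ \oo --> normc (L xi t - S n xi t).
      by apply: cvg_normc; exact: (cvgB (LP xi t) (cvg_cst _)).
    exact: (cvgM hh hh).
  apply: (@cvgr_to_le _ _ _ _ _ _ _ h).
  exists n => // m nm /=; apply: le_trans (l2norm_ge_seq (S m xi - S n xi) sD) _.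
  by rewrite ler_pXn2r ?nnegrE ?l2norm_ge0 ?mulr_ge0 ?l2norm_ge0//; exact: Sd.
have Ll2 xi : L xi \in l2_pred D.
  have d0 : (fun t => L xi t - S 0%N xi t) \in l2_pred D.
    apply: (l2_intro _ (Ld xi 0%N)) => t nD; rewrite l2_out// subr0.
    apply: Lun; rewrite (_ : (fun _ => _) = (fun=> 0)); first exact: cvg_cst.
    by apply/funext => n; rewrite l2_out.
  have -> : L xi = val (L2 d0 + S 0%N xi).
    by apply/funext => t; rewrite (_ : val _ t = L xi t - S 0%N xi t + S 0%N xi t)// subrK.
  exact: l2valP.
pose B xi : l2 R D := L2 (Ll2 xi).
have Bd n xi : l2norm (B xi - S n xi) <= r n * l2norm xi.
  rewrite -(@ler_pXn2r _ 2)// ?nnegrE ?mulr_ge0 ?l2norm_ge0//.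
  by apply: l2norm_le_seq => s /Ld; exact.
have BB : B \in @bop_pred R T D.
  apply/asboolP; split => [a xi eta|].
    apply: val_inj; apply/funext => t.
    have -> : val (a *: B xi + B eta) t = a * L xi t + L eta t by [].
    apply: Lun; under eq_fun do rewrite bopD bopZ.
    by apply: cvgD (LP eta t); apply: cvgM (LP xi t); exact: cvg_cst.
  exists (r 0%N + opnorm (S 0%N)) => xi; rewrite -(subrK (S 0%N xi) (B xi)).
  by rewrite mulrDl; apply: le_trans (l2normD _ _) _; rewrite lerD// le_opnorm.
exists (Bop BB) => n; apply: opnorm_le (rge0 n) _ => xi; exact: Bd.
Qed.

End Completeness.

Lemma near_seq (T : eqType) (I : Type) (F : set_system I) (FF : Filter F)
    (s : seq T) (P : T -> I -> Prop) :
  (forall a, a \in s -> \forall i \near F, P a i) ->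
  \forall i \near F, forall a, a \in s -> P a i.
Proof.
elim: s => [_|a s IH h]; first by apply: filterE.
have ha : \forall i \near F, P a i by apply: h; rewrite inE eqxx.
have hs : \forall i \near F, forall b, b \in s -> P b i.
  by apply: IH => b bs; apply: h; rewrite inE bs orbT.
apply: filterS2 ha hs => i Pa Ps b; rewrite inE => /orP[/eqP ->//|]; exact: Ps.
Qed.

(** * Etale groupoids and their convolution algebra *)

Section Covers.
Variable X : topologicalType.

(** Near-covering compactness along the filter of finite subsets of [X]; the sets [P x] only need to
    be neighbourhoods of the points of [K]. *)
Lemma compact_finite_cover (K : set X) (P : X -> set X) : compact K ->
  (forall x, K x -> nbhs x (P x)) ->
  exists s : seq X, (forall a, a \in s -> K a) /\
    (forall x, K x -> exists2 a, a \in s & P a x).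
Proof.
move=> /compact_near_coveringP cK nP.
have tf := @summability.totally_filter X.
have [x Kx|A _ hA] := cK _ (@summability.totally X)
    (fun i x => exists2 a, a \in (i : seq X) & K a /\ P a x) _.
  exists (P x, [set i : {fset X} | (finmap.fset1 x `<=` i)%fset]).
    by split; [exact: nP|exists (finmap.fset1 x)].
  move=> [x' i] /= [Px' xi]; exists x => //.
  by apply: (finmap.fsubsetP xi); rewrite finmap.inE.
have {}hA := hA A (finmap.fsubset_refl A).
exists [seq a <- (A : seq X) | `[< K a >]]; split.
  by move=> a; rewrite mem_filter => /andP[/asboolP].
move=> x /hA[a aA [Ka Pa]]; exists a => //.
by rewrite mem_filter aA andbT; apply/asboolP.
Qed.

Lemma near_neq (I : Type) (F : set_system I) (FF : Filter F) (f g : I -> X) (a b : X) :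
  hausdorff_space X -> a <> b -> f @ F --> a -> g @ F --> b ->
  \forall i \near F, f i <> g i.
Proof.
rewrite open_hausdorff => hX ab fa gb.
have /hX[[U V] /= [/set_mem Ua /set_mem Vb] [oU oV UV]] : a != b by exact/eqP.
have hU : \forall i \near F, U (f i) by apply: fa; exact: open_nbhs_nbhs.
have hV : \forall i \near F, V (g i) by apply: gb; exact: open_nbhs_nbhs.
apply: filterS2 hU hV => i Ui Vi fg.
have : (U `&` V) (g i) by split => //; rewrite -fg.
by rewrite (eqP UV).
Qed.

End Covers.

Section EtaleGroupoid.
Variable G : topGroupoid.
Hypothesis HG : hausdorff_space G.
Hypothesis EG : etale G.

Lemma gobj_hausdorff : hausdorff_space (gobj G).
Proof.
move=> x y xy.
suff : gid x = gid y by move/(congr1 (@gsrc G)); rewrite !gsrc_id.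
apply: HG => U V Ux Vy.
have [z [Uz Vz]] := xy _ _ (@gid_continuous G x U Ux) (@gid_continuous G y V Vy).
by exists (gid z).
Qed.

Lemma fibre_closed (y : gobj G) : closed (fibre y).
Proof.
apply: (@preimage_closed _ _ (@gsrc G) [set y]).
  by move=> a _; exact: gsrc_continuous.
exact/accessible_closed_set1/hausdorff_accessible/gobj_hausdorff.
Qed.

(* Only the range map is assumed to be a local homeomorphism; the inversion
   exchanges it with the source map. *)
Lemma src_section (a : G) : exists (U : set G) (sigma : gobj G -> G),
  [/\ open U, U a, sigma @ gsrc a --> a,
    \forall y \near gsrc a, gsrc (sigma y) = y &
    forall b, U b -> sigma (gsrc b) = b].
Proof.
have [U [oU Ua oI _ [g cg gK]]] := EG (ginv a).
have fa : (@grng G @` U) (gsrc a) by exists (ginv a) => //; rewrite grng_inv.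
have nfa : nbhs (gsrc a) (@grng G @` U) by exact: open_nbhs_nbhs.
exists (@ginv G @^-1` U), (fun y => ginv (g y)); split.
- by apply: open_comp => // b _; exact: ginv_continuous.
- by [].
- have : g @ gsrc a --> ginv a.
    have ga : g (gsrc a) = ginv a by rewrite -grng_inv gK.
    have := cg; rewrite continuous_open_subspace// => /(_ _ (mem_set fa)).
    by rewrite /continuous_at ga.
  move=> h; rewrite -[X in _ --> X]ginvK.
  exact: (cvg_comp _ _ h (@ginv_continuous G _)).
- by apply: filterS nfa => _ [u Uu <-]; rewrite gK// gsrc_inv.
- by move=> b Ub; rewrite -grng_inv gK// ginvK.
Qed.

(** This is the local product structure: over units near [y], the arrows of the compact set [L] are
    among the values of finitely many disjoint local sections passing through the fibre of [y]. *)
Lemma local_sections (L : set G) (y : gobj G) : compact L ->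
  exists (s : seq G) (sigma : G -> gobj G -> G),
  [/\ uniq s, forall a, a \in s -> gsrc a = y,
    forall a, a \in s -> sigma a y = a /\ sigma a @ y --> a &
    \forall y' \near y, [/\ forall a, a \in s -> gsrc (sigma a y') = y',
      uniq [seq sigma a y' | a <- s] &
      forall b, L b -> gsrc b = y' -> b \in [seq sigma a y' | a <- s]]].
Proof.
move=> cL.
have /choice[U /choice[sigma Us]] := src_section.
(* Arrows of [L] not over [y] are covered by the complement of the closed fibre; only the members
   centred on the fibre meet it, and these give [s]. *)
pose P a := if gsrc a == y then U a else ~` fibre y.
have [|s0 [s0L s0P]] := @compact_finite_cover G L P cL.
  move=> a La; rewrite /P; case: eqP => ay.
    by have [oU Ua _ _ _] := Us a; exact: open_nbhs_nbhs.
  apply: open_nbhs_nbhs; split => //.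
  exact/closed_openC/fibre_closed.
pose s := undup [seq a <- s0 | gsrc a == y].
have sy a : a \in s -> gsrc a = y by rewrite mem_undup mem_filter => /andP[/eqP].
exists s, sigma; split => //; first exact: undup_uniq.
  by move=> a /sy ay; have [_ Ua sa _ sK] := Us a; rewrite -ay; split => //; exact: sK.
have n1 : \forall y' \near y, forall a, a \in s -> gsrc (sigma a y') = y'.
  by apply: near_seq => a /sy ay; have [_ _ _ + _] := Us a; rewrite ay.
have n2 : \forall y' \near y, forall a, a \in s -> forall b, b \in s ->
    a != b -> sigma a y' <> sigma b y'.
  apply: near_seq => a asx; apply: near_seq => b bs.
  have [->|ab] := eqVneq a b; first by apply: filterE => ? /eqP.
  have [_ _ sa _ _] := Us a; have [_ _ sb _ _] := Us b.
  rewrite (sy _ asx) in sa; rewrite (sy _ bs) in sb.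
  have /eqP ab' := ab.
  by apply: filterS (near_neq _ HG ab' sa sb) => y' h _; exact: h.
(* What the sections of [s] miss in [L] is compact, so its image under the source is closed; it does
   not contain [y], hence it avoids a neighbourhood of [y]. *)
pose C := L `&` ~` [set b | exists2 a, a \in s & U a b].
have clC : closed (@gsrc G @` C).
  apply: compact_closed; first exact: gobj_hausdorff.
  apply: continuous_compact.
    by apply: continuous_subspaceT => a; exact: gsrc_continuous.
  apply: (subclosed_compact _ cL); last by move=> a [].
  apply: closedI; first exact: compact_closed.
  apply/open_closedC; rewrite openE => b [a asx Uab]; rewrite /interior.
  have [oU _ _ _ _] := Us a.
  have : nbhs b (U a) by exact: open_nbhs_nbhs.
  by apply: filterS => c Uac; exists a.
have Cy : ~ (@gsrc G @` C) y.
  move=> [b [Lb nU] bY]; have [a as0] := s0P b Lb; rewrite /P.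
  case: eqP => [ay Uab|_ /(_ bY)//].
  by apply: nU; exists a => //; rewrite mem_undup mem_filter as0 ay eqxx.
have n3 : \forall y' \near y, ~ (@gsrc G @` C) y'.
  by apply: open_nbhs_nbhs; split => //; exact: closed_openC.
near=> y'.
have h1 : forall a, a \in s -> gsrc (sigma a y') = y' by near: y'; exact: n1.
have h2 : forall a, a \in s -> forall b, b \in s -> a != b ->
  sigma a y' <> sigma b y' by near: y'; exact: n2.
have h3 : ~ (@gsrc G @` C) y' by near: y'; exact: n3.
split => //.
  rewrite map_inj_in_uniq ?undup_uniq// => a b asx bs e.
  by apply: contrapT => /eqP ab; exact: (h2 a asx b bs ab e).
move=> b Lb bY; apply: contrapT => nb; apply: h3; exists b => //; split => //.
move=> [a asx Uab]; apply: nb; apply/mapP; exists a => //.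
by have [_ _ _ _ sK] := Us a; rewrite -bY sK.
Unshelve. all: by end_near. Qed.

Lemma fibre_finite (L : set G) (y : gobj G) : compact L ->
  exists2 s : seq G, in_dom (fibre y) s & forall b, L b -> gsrc b = y -> b \in s.
Proof.
move=> /(local_sections y)[s [sigma [us sy sc /nbhs_singleton[h1 h2 h3]]]].
exists [seq sigma a y | a <- s] => //; split => // _ /mapP[a asx ->]; exact: h1.
Qed.

(** Near [z0] the sum runs over finitely many sections, so continuity along each of them suffices.
    The map [p] allows both sums depending on an arrow, with [p] the source, and sums depending on a
    unit, with [p] the identity. *)
Lemma fibre_sum_continuous (R : realType) (Z : topologicalType) (p : Z -> gobj G)
    (L : set G) (Phi : G -> Z -> R[i]) (z0 : Z) :
  compact L -> p @ z0 --> p z0 ->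
  (forall a z, gsrc a = p z -> Phi a z != 0 -> L a) ->
  (forall a, gsrc a = p z0 -> forall u : Z -> G, (\forall z \near z0, gsrc (u z) = p z) ->
     u @ z0 --> a -> (fun z => Phi (u z) z) @ z0 --> Phi a z0) ->
  (fun z => \sum_(a \in fibre (p z)) Phi a z) @ z0 -->
    \sum_(a \in fibre (p z0)) Phi a z0.
Proof.
move=> cL cp PL cPhi.
have [s [sigma [us sy sc hn]]] := local_sections (p z0) cL.
have hz : \forall z \near z0, [/\ forall a, a \in s -> gsrc (sigma a (p z)) = p z,
      uniq [seq sigma a (p z) | a <- s] &
      forall b, L b -> gsrc b = p z -> b \in [seq sigma a (p z) | a <- s]].
  exact: cp _ hn.
have E z : [/\ forall a, a \in s -> gsrc (sigma a (p z)) = p z,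
      uniq [seq sigma a (p z) | a <- s] &
      forall b, L b -> gsrc b = p z -> b \in [seq sigma a (p z) | a <- s]] ->
    \sum_(a \in fibre (p z)) Phi a z = \sum_(a <- s) Phi (sigma a (p z)) z.
  move=> [h1 h2 h3].
  rewrite -(fsbig_widen [set` [seq sigma a (p z) | a <- s]] (fibre (p z))).
  - by rewrite -fsbig_seq// big_map.
  - by move=> b /= /mapP[a asx ->]; exact: h1.
  - move=> b [pb nb] /=; apply: contrapT => /eqP Pb; apply: nb.
    by apply: h3 => //; exact: PL Pb.
have -> : \sum_(a \in fibre (p z0)) Phi a z0 = \sum_(a <- s) Phi a z0.
  rewrite (E z0 (nbhs_singleton hz)); apply: eq_big_seq => a asx.
  by have [-> _] := sc a asx.
have c1 : (fun z => \sum_(a <- s) Phi (sigma a (p z)) z) @ z0 --> \sum_(a <- s) Phi a z0.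
  apply: (@cvg_bigsum R Z (nbhs z0) _ G s (fun a z => Phi (sigma a (p z)) z)
    (fun a => Phi a z0)) => a asx.
  apply: cPhi; first exact: sy.
    by apply: filterS hz => z [+ _ _]; apply.
  by apply: (cvg_comp _ _ cp); have [] := sc a asx.
apply: cvg_trans c1; apply: near_eq_cvg.
by apply: filterS hz => z /E ->.
Qed.

End EtaleGroupoid.

Section GroupoidAlgebra.
Variable G : topGroupoid.
Implicit Types (a b c : G) (x y : gobj G).

Lemma ginv_mul a b : gsrc a = gsrc b -> ginv (gmul a (ginv b)) = gmul b (ginv a).
Proof.
move=> ab.
have h : gsrc a = grng (ginv b) by rewrite grng_inv.
have h' : gsrc b = grng (ginv a) by rewrite grng_inv.
have e : gsrc (gmul b (ginv a)) = grng (gmul a (ginv b)).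
  by rewrite !gsrc_mul// gsrc_inv grng_mul.
have h2 : gmul (gmul b (ginv a)) (gmul a (ginv b)) = gid (grng b).
  rewrite -gmulA//; last by rewrite gsrc_inv grng_mul.
  by rewrite gVmulK// gmulV.
have := gmulK e; rewrite h2.
have -> : grng b = grng (ginv (gmul a (ginv b))) by rewrite grng_inv gsrc_mul// gsrc_inv.
by rewrite g1mul.
Qed.

Lemma gmul_divK a b c : gsrc a = gsrc c -> gsrc b = gsrc c ->
  gmul (gmul a (ginv b)) (gmul b (ginv c)) = gmul a (ginv c).
Proof.
move=> ac bc; rewrite gmulA.
- by rewrite gmulVK// ac.
- by rewrite gsrc_mul ?grng_inv ?gsrc_inv ?grng_mul ?grng_inv// ac.
- by rewrite grng_inv.
Qed.

Lemma grng_div a b : gsrc a = gsrc b -> grng (gmul a (ginv b)) = grng a.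
Proof. by move=> ab; rewrite grng_mul// grng_inv. Qed.

Lemma gsrc_div a b : gsrc a = gsrc b -> gsrc (gmul a (ginv b)) = grng b.
Proof. by move=> ab; rewrite gsrc_mul ?gsrc_inv// grng_inv. Qed.

Lemma gmul_inj c a b : gsrc a = grng c -> gsrc b = grng c -> gmul a c = gmul b c -> a = b.
Proof. by move=> ac bc h; rewrite -(gmulK ac) h gmulK. Qed.

Hypothesis HG : hausdorff_space G.

Lemma gmul_cvg (I : Type) (F : set_system I) (FF : Filter F) (u v : I -> G) a b :
  u @ F --> a -> v @ F --> b -> gsrc a = grng b ->
  (\forall i \near F, gsrc (u i) = grng (v i)) ->
  (fun i => gmul (u i) (v i)) @ F --> gmul a b.
Proof.
move=> ua vb ab uv W Wab.
have /subspace_continuousP/(_ (a, b) ab W Wab) h := @gmul_continuous G.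
have {}h : nbhs (a, b) [set p : G * G | gsrc p.1 = grng p.2 -> W (gmul p.1 p.2)] := h.
have cuv : (fun i => (u i, v i)) @ F --> (a, b) by exact: cvg_pair.
have h2 : \forall i \near F, gsrc (u i) = grng (v i) -> W (gmul (u i) (v i)) := cuv _ h.
by apply: filterS2 uv h2 => i e; exact.
Qed.

(** The composable pairs form a closed set, the unit space being Hausdorff. *)
Lemma compact_mul (K L : set G) : compact K -> compact L ->
  compact [set c | exists a b, [/\ K a, L b, gsrc a = grng b & c = gmul a b]].
Proof.
move=> cK cL.
pose P := [set p : G * G | gsrc p.1 = grng p.2].
have clP : closed P.
  rewrite -[P]setCK; apply: open_closedC; rewrite openE => -[a b] np; rewrite /interior /=.
  have c1 : (fun p : G * G => gsrc p.1) @ (a, b) --> gsrc a.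
    by apply: (cvg_comp _ _ cvg_fst); exact: gsrc_continuous.
  have c2 : (fun p : G * G => grng p.2) @ (a, b) --> grng b.
    by apply: (cvg_comp _ _ cvg_snd); exact: grng_continuous.
  exact: (near_neq _ (gobj_hausdorff HG) np c1 c2).
rewrite (_ : [set c | _] = (fun p => gmul p.1 p.2) @` ((K `*` L) `&` P)).
  apply: continuous_compact.
    by apply: continuous_subspaceW (@gmul_continuous G) => p [].
  apply: compact_closedI => //; exact: compact_setX.
apply/seteqP; split => [_ [a [b [Ka Lb ab ->]]]|_ [[a b] [[/= Ka Lb] ab] <-]].
  by exists (a, b).
by exists a, b.
Qed.

Lemma compact_inv (K : set G) : compact K -> compact (@ginv G @` K).
Proof.
apply: continuous_compact; apply: continuous_subspaceT => a.
exact: ginv_continuous.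
Qed.

Hypothesis EG : etale G.

(** A kernel supported in [K] has finitely many nonzero entries in each column: right translation by
    [a] identifies them with arrows of [K] over [grng a]. *)
Lemma finite_col (K : set G) x (s : seq G) : compact K -> in_dom (fibre x) s ->
  exists2 t, in_dom (fibre x) t &
    forall a c, a \in s -> fibre x c -> K (gmul c (ginv a)) -> c \in t.
Proof.
move=> cK; elim: s => [_|a s IH [/= /andP[nas us] sx]].
  by exists [::].
have [t [ut tx] tP] : exists2 t, in_dom (fibre x) t &
    forall a c, a \in s -> fibre x c -> K (gmul c (ginv a)) -> c \in t.
  by apply: IH; split => // b bs; apply: sx; rewrite inE bs orbT.
have [u [uu ux] uP] := fibre_finite HG EG (grng a) cK.
have ax : gsrc a = x by apply: sx; rewrite inE eqxx.
exists (undup ([seq gmul c a | c <- u] ++ t)).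
  split; first exact: undup_uniq.
  move=> c; rewrite mem_undup mem_cat => /orP[/mapP[d du ->]|/tx//].
  by rewrite /fibre /= gsrc_mul// ux.
move=> b c; rewrite inE mem_undup mem_cat => /orP[/eqP ->|bs] cx Kc; last first.
  by rewrite (tP b c bs cx Kc) orbT.
apply/orP; left; apply/mapP; exists (gmul c (ginv a)).
  by apply: uP => //; rewrite gsrc_div// cx.
by rewrite gmulVK// cx.
Qed.

Lemma finite_row (K : set G) x (s : seq G) : compact K -> in_dom (fibre x) s ->
  exists2 t, in_dom (fibre x) t &
    forall a c, a \in s -> fibre x c -> K (gmul a (ginv c)) -> c \in t.
Proof.
move=> cK sx; have [t tx tP] := finite_col (compact_inv cK) sx.
exists t => // a c asx cx Kac; apply: (tP a) => //.
by exists (gmul a (ginv c)) => //; rewrite ginv_mul// cx sx.2.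
Qed.

Lemma fibre_sum_seq (V : nmodType) (D : set G) (s : seq G) (F : G -> V) : in_dom D s ->
  (forall a, D a -> F a != 0 -> a \in s) -> \sum_(a \in D) F a = \sum_(a <- s) F a.
Proof.
move=> [us sD] Fs; rewrite -(fsbig_widen [set` s] D).
- by rewrite -fsbig_seq.
- by move=> a /= /sD.
- by move=> a [Da /= nas]; apply: contrapT => /eqP /(Fs a Da).
Qed.

End GroupoidAlgebra.

(** * Convolution and kernels invariant under right translation *)

Section Convolution.
Variables (R : realType) (G : topGroupoid).
Hypothesis HG : hausdorff_space G.
Hypothesis EG : etale G.
Implicit Types (a b c : G) (x y : gobj G) (f g : G -> R[i]).

Definition gconv f g c : R[i] :=
  \sum_(a \in fibre (gsrc c)) f (gmul c (ginv a)) * g a.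

Definition star f c : R[i] := (f (ginv c))^*.

(** At a b^-1 this is the inner product of two columns of the matrix f(c a^-1), see [gram_div]; it
    is the kernel of lambda(f)^* lambda(f). *)
Definition gram f := gconv (star f) f.

Definition supp f : set G := closure [set a | f a != 0].

Lemma supp_compact f : Cc f -> compact (supp f). Proof. by case. Qed.

Lemma in_supp f a : f a != 0 -> supp f a.
Proof. by move=> fa; exact: subset_closure. Qed.

Lemma Cc_intro f (K : set G) : continuous f -> compact K ->
  (forall a, f a != 0 -> K a) -> Cc f.
Proof.
move=> cf cK fK; split => //.
exact: closed_compact_closure (compact_closed HG cK) cK fK.
Qed.

Lemma CcD f g : Cc f -> Cc g -> Cc (fun a => f a + g a).
Proof.
move=> [cf kf] [cg kg]; apply: (Cc_intro _ (compactU kf kg)).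
  by move=> a; exact: (cvgD (cf a) (cg a)).
move=> a; have [fa|fa] := eqVneq (f a) 0; last by move=> _; left; exact: in_supp.
by rewrite fa add0r => ga; right; exact: in_supp.
Qed.

Lemma CcMl (k : G -> R[i]) f : continuous k -> Cc f -> Cc (fun a => k a * f a).
Proof.
move=> ck [cf kf]; apply: (Cc_intro _ kf).
  by move=> a; exact: (cvgM (ck a) (cf a)).
move=> a; have [->|fa] := eqVneq (f a) 0; first by rewrite mulr0 eqxx.
by move=> _; exact: in_supp.
Qed.

Lemma CcZ (k : R[i]) f : Cc f -> Cc (fun a => k * f a).
Proof. by apply: CcMl => a; exact: cvg_cst. Qed.

Lemma star_Cc f : Cc f -> Cc (star f).
Proof.
move=> [cf kf]; apply: (Cc_intro _ (compact_inv kf)).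
  move=> a; apply: cvg_conjc; apply: (cvg_comp _ _ (@ginv_continuous G a)); exact: cf.
move=> a; rewrite /star conjC_eq0 => fa; exists (ginv a); last exact: ginvK.
exact: in_supp.
Qed.

Lemma gconv_supp f g c : gconv f g c != 0 ->
  exists a b, [/\ supp f a, supp g b, gsrc a = grng b & c = gmul a b].
Proof.
move=> fg; have [b [bc fb gb]] : exists b, [/\ gsrc b = gsrc c,
    f (gmul c (ginv b)) != 0 & g b != 0].
  apply: contrapT => h; move/eqP: fg; apply; apply: fsbig1 => b bc.
  have [->|gb] := eqVneq (g b) 0; first by rewrite mulr0.
  have [->|fb] := eqVneq (f (gmul c (ginv b))) 0; first by rewrite mul0r.
  by exfalso; apply: h; exists b.
exists (gmul c (ginv b)), b; split; rewrite ?gmulVK ?gsrc_div//; exact: in_supp.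
Qed.

Lemma gconv_Cc f g : Cc f -> Cc g -> Cc (gconv f g).
Proof.
move=> [cf kf] [cg kg]; apply: (Cc_intro _ (compact_mul HG kf kg)); last exact: gconv_supp.
move=> c.
apply: (@fibre_sum_continuous G HG EG R G (@gsrc G) (supp g)
  (fun a c => f (gmul c (ginv a)) * g a) c kg).
- exact: gsrc_continuous.
- move=> a z _; have [->|ga] := eqVneq (g a) 0; first by rewrite mulr0 eqxx.
  by move=> _; exact: in_supp.
move=> a ac u us ua; apply: cvgM; last by apply: (cvg_comp _ _ ua); exact: cg.
apply: (cvg_comp _ f) (cf _); apply: gmul_cvg => //.
- by apply: (cvg_comp _ _ ua); exact: ginv_continuous.
- by rewrite grng_inv.
- by apply: filterS us => z uz; rewrite grng_inv.
Qed.

Lemma gram_Cc f : Cc f -> Cc (gram f).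
Proof. by move=> cf; apply: gconv_Cc => //; exact: star_Cc. Qed.

Lemma gconv_div f g a b x : fibre x a -> fibre x b ->
  gconv f g (gmul a (ginv b)) =
    \sum_(c \in fibre x) f (gmul a (ginv c)) * g (gmul c (ginv b)).
Proof.
move=> ax bx; have ab : gsrc a = gsrc b by rewrite ax.
rewrite /gconv gsrc_div// (reindex_fsbig _ _ _ _ (rtrans_bij b)) bx.
apply: eq_fsbigr => c /set_mem cx.
rewrite ginv_mul ?cx// gmul_divK// ?ax ?cx ?bx//.
Qed.

Lemma gram_div f a b x : fibre x a -> fibre x b ->
  gram f (gmul a (ginv b)) =
    \sum_(c \in fibre x) (f (gmul c (ginv a)))^* * f (gmul c (ginv b)).
Proof.
move=> ax bx; rewrite /gram (gconv_div _ _ ax bx); apply: eq_fsbigr => c /set_mem cx.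
by rewrite /star ginv_mul// ax cx.
Qed.

Hypothesis CG : compact [set: gobj G].

(** The sum of |f| over a fibre is a continuous function of the unit, and the unit space is compact.
    It is taken in [R[i]] to fit [fibre_sum_continuous]. *)
Lemma fibre_sum_bounded f : Cc f ->
  exists2 N : R, 0 <= N & forall x s, in_dom (fibre x) s -> \sum_(a <- s) normc (f a) <= N.
Proof.
move=> [cf kf].
pose S x : R[i] := \sum_(a \in fibre x) (normc (f a))%:C%C.
have cS : continuous S.
  move=> x.
  apply: (@fibre_sum_continuous G HG EG R (gobj G) id (supp f)
    (fun a _ => (normc (f a))%:C%C) x kf).
  - exact: cvg_id.
  - move=> a z _; have [->|fa] := eqVneq (f a) 0.
      by rewrite Normc.normc0 eqxx.
    by move=> _; exact: in_supp.
  - move=> a _ u _ ua; apply: cvg_complex; apply: cvg_normc.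
    by apply: (cvg_comp _ _ ua); exact: cf.
have tf := @summability.totally_filter nat.
have /compact_near_coveringP cG := CG.
have h : \forall N \near \oo, [set: gobj G] `<=` [set x | normc (S x) <= N%:R].
  apply: cG => x _.
  have [n nP] : exists n : nat, normc (S x) + 1 < n%:R.
    exists (Num.truncn (normc (S x) + 1)).+1; exact: truncnS_gt.
  exists ([set y | normc (S y - S x) < 1], [set k | (n <= k)%N]).
    by split; [by have /cvgCP/(_ _ ltr01) := cS x|exists n].
  move=> [y k] [/= Sy nk].
  have := le_normc_add (S y - S x) (S x); rewrite subrK.
  have : (n%:R : R) <= k%:R by rewrite ler_nat.
  lra.
have [N _ hN] := h.
exists N%:R => // x s sx.
apply: le_trans (hN N (leqnn N) x I).
have [t [ut tx] tP] := fibre_finite HG EG x kf.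
have SE : S x = (\sum_(a <- t) normc (f a))%:C%C.
  rewrite rmorph_sum /S (fibre_sum_seq (s := t))// => a ax.
  have [->|fa _] := eqVneq (f a) 0; first by rewrite Normc.normc0 eqxx.
  by apply: tP => //; exact: in_supp.
rewrite SE /= expr0n addr0 sqrtr_sqr ger0_norm; last first.
  by rewrite sumr_ge0// => a _; exact: normc_ge0.
(* Sums of |f| are energies of the square root of |f|, which makes [energy_le] available. *)
have h0 (u : seq G) : \sum_(a <- u) normc (f a) = energy u (fun a => (Num.sqrt (normc (f a)))%:C%C).
  apply: eq_bigr => a _.
  by rewrite /= expr0n addr0 sqrtr_sqr ger0_norm ?sqrtr_ge0// sqr_sqrtr// normc_ge0.
rewrite !h0; apply: energy_le => //; first exact: sx.1.
move=> a asx fa; apply: tP; last exact: sx.2.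
apply: in_supp; apply: contra_neq fa => ->.
by rewrite Normc.normc0 sqrtr0.
Qed.

(* Bounds the row and column sums of the kernel [f (a b^-1)]. *)
Definition Ibound f (N : R) := [/\ 0 <= N,
  forall x s, in_dom (fibre x) s -> \sum_(a <- s) normc (f a) <= N &
  forall x s, in_dom (fibre x) s -> \sum_(a <- s) normc (f (ginv a)) <= N].

Lemma Ibound_ex f : Cc f -> exists N, Ibound f N.
Proof.
move=> cf; have [N N0 hN] := fibre_sum_bounded cf.
have [M M0 hM] := fibre_sum_bounded (star_Cc cf).
exists (N + M); split; first exact: addr_ge0.
  by move=> x s /hN h; apply: le_trans h _; rewrite lerDl.
move=> x s /hM h; apply: le_trans (_ : _ <= M) _; last by rewrite lerDr.
by apply: le_trans h; apply: ler_sum => a _; rewrite /star normc_conj.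
Qed.

Lemma col_bound f N x (s : seq G) b : Ibound f N -> in_dom (fibre x) s -> fibre x b ->
  \sum_(a <- s) normc (f (gmul a (ginv b))) <= N.
Proof.
move=> [_ hN _] [us sx] bx.
rewrite -(big_map (fun a => gmul a (ginv b)) predT (fun a => normc (f a))).
apply: (hN (grng b)); split.
  rewrite map_inj_in_uniq// => a a' /sx ax /sx ax' /gmul_inj; apply; by rewrite grng_inv bx.
by move=> _ /mapP[a /sx ax ->]; rewrite /fibre /= gsrc_div// ax.
Qed.

Lemma row_bound f N x (s : seq G) b : Ibound f N -> in_dom (fibre x) s -> fibre x b ->
  \sum_(a <- s) normc (f (gmul b (ginv a))) <= N.
Proof.
move=> [_ _ hN] [us sx] bx.
have -> : \sum_(a <- s) normc (f (gmul b (ginv a))) =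
    \sum_(a <- [seq gmul a (ginv b) | a <- s]) normc (f (ginv a)).
  rewrite big_map; apply: eq_big_seq => a /sx ax.
  by rewrite ginv_mul// ax bx.
apply: (hN (grng b)); split.
  rewrite map_inj_in_uniq// => a a' /sx ax /sx ax' /gmul_inj; apply; by rewrite grng_inv bx.
by move=> _ /mapP[a /sx ax ->]; rewrite /fibre /= gsrc_div// ax.
Qed.

End Convolution.

(** * Regular representations and Schur multipliers *)

Section RegularRep.
Variables (R : realType) (G : topGroupoid).
Hypothesis HG : hausdorff_space G.
Hypothesis EG : etale G.
Implicit Types (a b c : G) (x y : gobj G) (f g : G -> R[i]) (s : seq G).

Lemma bop_ext x (A B : bop R (fibre x)) :
  (forall xi c, fibre x c -> A xi c = B xi c) -> A = B.
Proof.
move=> AB; apply: val_inj; apply/funext => xi; apply: val_inj; apply/funext => c.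
change (A xi c = B xi c).
have [xc|xc] := pselect (fibre x c); first exact: AB.
by rewrite !l2_out.
Qed.

Lemma regular_rep_unique f x (A : bop R (fibre x)) :
  is_regular_rep f A -> regular_rep f x = A.
Proof.
move=> fA; have h : is_regular_rep f (regular_rep f x).
  by apply: (@xgetPex _ 0 [set B | is_regular_rep f B]); exists A.
by apply: bop_ext => xi c cx; rewrite h// fA.
Qed.

Lemma regular_rep_seq f x (xi : l2 R (fibre x)) c s : Cc f -> fibre x c -> in_dom (fibre x) s ->
  (forall a, fibre x a -> f (gmul c (ginv a)) * xi a != 0 -> a \in s) ->
  regular_rep f x xi c = \sum_(a <- s) f (gmul c (ginv a)) * xi a.
Proof.
by move=> cf cx sx h; rewrite (regular_repP EG cf)// (fibre_sum_seq sx).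
Qed.

Lemma regular_rep_fvec f x s v c : Cc f -> fibre x c -> in_dom (fibre x) s ->
  regular_rep f x (fvec (fibre x) s v) c = \sum_(a <- s) f (gmul c (ginv a)) * v a.
Proof.
move=> cf cx sx; rewrite (regular_rep_seq cf cx sx).
  by apply: eq_big_seq => a asx; rewrite fvecE// asx.
by move=> a _; rewrite fvecE//; case: ifP => //; rewrite mulr0 eqxx.
Qed.

Lemma finite_row1 f x c : Cc f -> fibre x c ->
  exists2 s, in_dom (fibre x) s & forall a, fibre x a -> f (gmul c (ginv a)) != 0 -> a \in s.
Proof.
move=> [_ kf] cx; have [|s sx sP] := @finite_row _ HG EG _ x [:: c] kf.
  by split => // a; rewrite inE => /eqP ->.
exists s => // a ax fa; apply: (sP c) => //; first by rewrite inE.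
exact: in_supp.
Qed.

Lemma regular_repD f g x : Cc f -> Cc g ->
  regular_rep (fun a => f a + g a) x = regular_rep f x + regular_rep g x.
Proof.
move=> cf cg; apply: bop_ext => xi c cx.
have [s [us sx] sP] := finite_row1 cf cx; have [t [ut tx] tP] := finite_row1 cg cx.
have ux : in_dom (fibre x) (undup (s ++ t)).
  split; first exact: undup_uniq.
  by move=> a; rewrite mem_undup mem_cat => /orP[/sx|/tx].
have fu a : fibre x a -> f (gmul c (ginv a)) != 0 -> a \in undup (s ++ t).
  by move=> ax fa; rewrite mem_undup mem_cat sP.
have gu a : fibre x a -> g (gmul c (ginv a)) != 0 -> a \in undup (s ++ t).
  by move=> ax ga; rewrite mem_undup mem_cat tP ?orbT.
rewrite (_ : (_ + _ : bop R (fibre x)) xi c = regular_rep f x xi c + regular_rep g x xi c)//.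
rewrite !(regular_rep_seq (s := undup (s ++ t)))//.
- by rewrite -big_split; apply: eq_bigr => a _; rewrite mulrDl.
- by move=> a ax; rewrite mulf_eq0 => /norP[/gu-/(_ ax)].
- by move=> a ax; rewrite mulf_eq0 => /norP[/fu-/(_ ax)].
- exact: CcD.
- move=> a ax; rewrite mulf_eq0 => /norP[h _].
  have [fa|/(fu a ax)//] := eqVneq (f (gmul c (ginv a))) 0.
  by apply: gu => //; move: h; rewrite fa add0r.
Qed.

Lemma regular_rep_gconv f g x : Cc f -> Cc g ->
  regular_rep (gconv f g) x = regular_rep f x * regular_rep g x.
Proof.
move=> cf cg; apply: bop_ext => xi c cx.
have [s sx sP] := finite_row1 cf cx.
have [_ kg] := cg.
have [t tx tP] := finite_row HG EG kg sx.
rewrite (_ : (_ * _ : bop R (fibre x)) xi c = regular_rep f x (regular_rep g x xi) c)//.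
rewrite (regular_rep_seq (s := s) cf cx)//; last first.
  by move=> a ax; rewrite mulf_eq0 => /norP[/sP-/(_ ax)].
rewrite (regular_rep_seq (s := t) (gconv_Cc HG EG cf cg) cx)//; last first.
  move=> a ax; rewrite mulf_eq0 => /norP[h _].
  apply: contrapT => nat; move/eqP: h; apply.
  rewrite (gconv_div _ _ cx ax); apply: fsbig1 => b bx.
  have [->|fb] := eqVneq (f (gmul c (ginv b))) 0; first by rewrite mul0r.
  have [->|gb] := eqVneq (g (gmul b (ginv a))) 0; first by rewrite mulr0.
  by exfalso; apply: nat; apply: (tP b) => //; [exact: sP|exact: in_supp].
under [RHS]eq_big_seq => b bs.
  rewrite (regular_rep_seq (s := t) cg (sx.2 b bs))//; last first.
    move=> a ax; rewrite mulf_eq0 => /norP[h _].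
    by apply: (tP b) => //; exact: in_supp.
  rewrite mulr_sumr.
  over.
rewrite exchange_big /=; apply: eq_big_seq => a /tx.2 ax.
rewrite (gconv_div _ _ cx ax) (fibre_sum_seq (s := s))//; last first.
  by move=> b bx; rewrite mulf_eq0 => /norP[/sP-/(_ bx)].
by rewrite mulr_suml; apply: eq_bigr => b _; rewrite mulrA.
Qed.

Lemma col_support f x s : Cc f -> in_dom (fibre x) s ->
  exists2 t, in_dom (fibre x) t &
    forall a c, a \in s -> fibre x c -> f (gmul c (ginv a)) != 0 -> c \in t.
Proof.
move=> [_ kf] sx; have [t tx tP] := finite_col HG EG kf sx.
by exists t => // a c asx cx fa; apply: (tP a) => //; exact: in_supp.
Qed.

Lemma energyE (s : seq G) (v : G -> R[i]) :
  (energy s v)%:C%C = \sum_(a <- s) v a * (v a)^*.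
Proof. by rewrite rmorph_sum; apply: eq_bigr => a _; exact: normc_sqrE. Qed.

Definition qform (k : G -> R[i]) s (v : G -> R[i]) : R[i] :=
  \sum_(a <- s) \sum_(b <- s) k (gmul a (ginv b)) * (v b * (v a)^*).

Lemma qform_gram f x s v t : Cc f -> in_dom (fibre x) s -> in_dom (fibre x) t ->
  (forall a c, a \in s -> fibre x c -> f (gmul c (ginv a)) != 0 -> c \in t) ->
  qform (gram f) s v =
    \sum_(c <- t) (\sum_(a <- s) f (gmul c (ginv a)) * v a) *
                  (\sum_(a <- s) f (gmul c (ginv a)) * v a)^*.
Proof.
move=> cf sx tx tP.
under [RHS]eq_bigr => c _.
  rewrite rmorph_sum mulr_sumr.
  under eq_bigr do rewrite mulr_suml.
  over.
rewrite exchange_big /=; apply: eq_big_seq => a asx.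
rewrite exchange_big /=; apply: eq_big_seq => b bs.
rewrite (gram_div _ (sx.2 a asx) (sx.2 b bs)) (fibre_sum_seq (s := t))//; last first.
  by move=> c cx; rewrite mulf_eq0 => /norP[_]; exact: (tP b).
rewrite mulr_suml; apply: eq_bigr => c _.
by rewrite rmorphM /=; ring.
Qed.

(** It turns norms into quadratic forms of an invariant kernel, so cutting and transporting a vector
    become operations on the finitely many values of that kernel. *)
Lemma l2norm_regular_rep f x s v : Cc f -> in_dom (fibre x) s ->
  (l2norm (regular_rep f x (fvec (fibre x) s v)) ^+ 2)%:C%C = qform (gram f) s v.
Proof.
move=> cf sx; have [t tx tP] := col_support cf sx.
rewrite (qform_gram _ cf sx tx tP).
pose u c := \sum_(a <- s) f (gmul c (ginv a)) * v a.
have -> : regular_rep f x (fvec (fibre x) s v) = fvec (fibre x) t u.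
  apply: val_inj; apply/funext => c.
  change (regular_rep f x (fvec (fibre x) s v) c = fvec (fibre x) t u c).
  have [cx|cx] := pselect (fibre x c); last by rewrite !l2_out.
  rewrite (regular_rep_fvec v cf cx sx) (fvecE u c tx); case: ifPn => // ct.
  rewrite big_seq big1// => a asx.
  have [->|fa] := eqVneq (f (gmul c (ginv a))) 0; first by rewrite mul0r.
  by rewrite (tP a c) in ct.
by rewrite l2norm_fvec// energyE.
Qed.

(* [xi] cuts a vector down to the pieces [a |-> xi (d a^-1) v a]; the pieces
   reassemble through the Schur multiplier [gram xi]. *)
Definition piece (xi : G -> R[i]) d v a : R[i] := xi (gmul d (ginv a)) * v a.

(** Summing conj(xi(d a^-1)) xi(d b^-1) over d gives [gram xi] at a b^-1, so the forms of the pieces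
    add up exactly to the form of a Schur product; [t] must contain every d whose piece is
    nonzero. *)
Lemma pieces_qform (k xi : G -> R[i]) x s v t : in_dom (fibre x) s -> in_dom (fibre x) t ->
  (forall a d, a \in s -> fibre x d -> xi (gmul d (ginv a)) != 0 -> d \in t) ->
  \sum_(d <- t) qform k s (piece xi d v) = qform (fun c => k c * gram xi c) s v.
Proof.
move=> sx tx tP; rewrite exchange_big /=; apply: eq_big_seq => a asx.
rewrite exchange_big /=; apply: eq_big_seq => b bs.
rewrite (gram_div _ (sx.2 a asx) (sx.2 b bs)) (fibre_sum_seq (s := t))//; last first.
  by move=> c cx; rewrite mulf_eq0 => /norP[_]; exact: (tP b).
rewrite mulr_sumr mulr_suml; apply: eq_bigr => c _.
by rewrite /piece rmorphM /=; ring.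
Qed.

Lemma pieces_energy (xi : G -> R[i]) x s v t : in_dom (fibre x) s -> in_dom (fibre x) t ->
  (forall a d, a \in s -> fibre x d -> xi (gmul d (ginv a)) != 0 -> d \in t) ->
  (\sum_(d <- t) energy s (piece xi d v))%:C%C =
    \sum_(a <- s) gram xi (gmul a (ginv a)) * (v a * (v a)^*).
Proof.
move=> sx tx tP; rewrite rmorph_sum /=.
under eq_bigr do rewrite energyE.
rewrite exchange_big /=; apply: eq_big_seq => a asx.
rewrite (gram_div _ (sx.2 a asx) (sx.2 a asx)) (fibre_sum_seq (s := t))//; last first.
  by move=> c cx; rewrite mulf_eq0 => /norP[_]; exact: (tP a).
rewrite mulr_suml; apply: eq_bigr => c _.
by rewrite /piece rmorphM /=; ring.
Qed.

(** Each product is split by 2 |v_a| |v_b| <= |v_a|^2 + |v_b|^2, after which one half sees the row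
    sums and the other the column sums. *)
Lemma schur_test (K : G -> G -> R[i]) N s v :
  (forall b, b \in s -> \sum_(a <- s) normc (K a b) <= N) ->
  (forall a, a \in s -> \sum_(b <- s) normc (K a b) <= N) ->
  normc (\sum_(a <- s) \sum_(b <- s) K a b * (v b * (v a)^*)) <= N * energy s v.
Proof.
move=> hc hr.
apply: (@le_trans _ _ (\sum_(a <- s) \sum_(b <- s)
   (normc (K a b) * normc (v a) ^+ 2 + normc (K a b) * normc (v b) ^+ 2) / 2)).
  apply: le_trans (normc_sum _ _) _; apply: ler_sum => a _.
  apply: le_trans (normc_sum _ _) _; apply: ler_sum => b _.
  rewrite !Normc.normcM normc_conj -mulrDr -mulrA ler_wpM2l ?normc_ge0//.
  have := sqr_ge0 (normc (v a) - normc (v b)); nra.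
under eq_bigr do rewrite -mulr_suml big_split.
rewrite -mulr_suml big_split /= ler_pdivrMr// mulr_natr mulr2n lerD//.
  rewrite /energy mulr_sumr; rewrite big_seq [leRHS]big_seq; apply: ler_sum => a asx.
  by rewrite -mulr_suml ler_wpM2r ?sqr_ge0// hr.
rewrite exchange_big /= /energy mulr_sumr big_seq [leRHS]big_seq; apply: ler_sum => b bs.
by rewrite -mulr_suml ler_wpM2r ?sqr_ge0// hc.
Qed.

(** The bound on [h] is asked only where [k] is nonzero: [h] will be [1 - gram xi], which is small
    on a compact set only. *)
Lemma qform_Ibound (k h : G -> R[i]) N e x s v : Ibound k N -> 0 <= e ->
  in_dom (fibre x) s ->
  (forall a b, a \in s -> b \in s -> k (gmul a (ginv b)) != 0 ->
     normc (h (gmul a (ginv b))) <= e) ->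
  normc (qform (fun c => k c * h c) s v) <= e * N * energy s v.
Proof.
move=> kN e0 sx he.
have kh a b : a \in s -> b \in s ->
    normc (k (gmul a (ginv b)) * h (gmul a (ginv b))) <= e * normc (k (gmul a (ginv b))).
  move=> asx bs; rewrite Normc.normcM mulrC.
  have [->|k0] := eqVneq (k (gmul a (ginv b))) 0; first by rewrite Normc.normc0 !mulr0.
  by rewrite ler_wpM2r ?normc_ge0// he.
apply: (@schur_test (fun a b => k (gmul a (ginv b)) * h (gmul a (ginv b))) (e * N) s v) => b bs.
  apply: le_trans (_ : _ <= e * \sum_(a <- s) normc (k (gmul a (ginv b)))) _.
    by rewrite mulr_sumr big_seq [leRHS]big_seq; apply: ler_sum => a asx; exact: kh.
  by rewrite ler_wpM2l//; apply: (col_bound kN sx); exact: sx.2.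
apply: le_trans (_ : _ <= e * \sum_(a <- s) normc (k (gmul b (ginv a)))) _.
  by rewrite mulr_sumr big_seq [leRHS]big_seq; apply: ler_sum => a asx; exact: kh.
by rewrite ler_wpM2l//; apply: (row_bound kN sx); exact: sx.2.
Qed.

Hypothesis CG : compact [set: gobj G].

Lemma regular_rep_bounded f : Cc f ->
  exists2 M : R, 0 <= M & forall x, opnorm (regular_rep f x) <= M.
Proof.
move=> cf; have [N gN] := Ibound_ex HG EG CG (gram_Cc HG EG cf).
have [N0 _ _] := gN.
(* The Schur test for [gram f] bounds the squared norm by [N], at all units at once. *)
have [r r0 rN] : exists2 r, 0 <= r & r ^+ 2 = N.
  by exists (Num.sqrt N); [exact: sqrtr_ge0|exact: sqr_sqrtr].
exists r => // x; apply: (opnorm_le r0); apply: bop_bound_dense => // s v sx.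
have := @schur_test (fun a b => gram f (gmul a (ginv b))) N s v; rewrite -/(qform _ _ _).
rewrite -(l2norm_regular_rep v cf sx) -(l2norm_fvec v sx).
have := l2norm_ge0 (regular_rep f x (fvec (fibre x) s v)).
move: (l2norm (regular_rep f x _)) => n n0.
have := l2norm_ge0 (fvec (fibre x) s v); move: (l2norm (fvec (fibre x) s v)) => m m0.
rewrite /= expr0n addr0 sqrtr_sqr ger0_norm ?sqr_ge0// => h.
rewrite -(@ler_pXn2r _ 2)// ?nnegrE ?mulr_ge0//.
rewrite exprMn rN; apply: h => b bs.
  by apply: (col_bound gN sx); exact: sx.2.
by apply: (row_bound gN sx); exact: sx.2.
Qed.

End RegularRep.

(** * Cutting vectors and transporting them between fibres *)

Section Localization.
Variables (R : realType) (G : topGroupoid).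
Hypothesis HG : hausdorff_space G.
Hypothesis EG : etale G.
Implicit Types (a b c : G) (x y : gobj G) (f g : G -> R[i]) (s : seq G).

Lemma normc_complex (r : R) : normc r%:C%C = `|r|.
Proof. by rewrite /= expr0n addr0 sqrtr_sqr. Qed.

Definition rep_sq f x s v : R := l2norm (regular_rep f x (fvec (fibre x) s v)) ^+ 2.

Lemma rep_sq_ge0 f x s v : 0 <= rep_sq f x s v.
Proof. exact: sqr_ge0. Qed.

Lemma rep_sqE f x s v : Cc f -> in_dom (fibre x) s ->
  (rep_sq f x s v)%:C%C = qform (gram f) s v.
Proof. exact: l2norm_regular_rep. Qed.

(** The energy is the form of the identity and sees [gram xi] on units only, hence the separate
    hypothesis on the diagonal. *)
Lemma pieces_norm f xi N e x s v : Cc f -> Cc xi -> Ibound (gram f) N -> 0 <= e ->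
  in_dom (fibre x) s ->
  (forall a b, a \in s -> b \in s -> gram f (gmul a (ginv b)) != 0 ->
     normc (1 - gram xi (gmul a (ginv b))) <= e) ->
  (forall a, a \in s -> normc (1 - gram xi (gmul a (ginv a))) <= e) ->
  exists2 t, in_dom (fibre x) t &
    `|\sum_(d <- t) rep_sq f x s (piece xi d v) - rep_sq f x s v| <= e * N * energy s v /\
    `|\sum_(d <- t) energy s (piece xi d v) - energy s v| <= e * energy s v.
Proof.
move=> cf cxi fN e0 sx he hd.
have [t tx tP] := col_support HG EG cxi sx; exists t => //; split.
  rewrite -normc_complex rmorphB rmorph_sum /= (rep_sqE _ cf sx).
  under eq_bigr do rewrite (rep_sqE _ cf sx).
  rewrite (pieces_qform _ _ sx tx tP) normcB.
  have -> : qform (gram f) s v - qform (fun c => gram f c * gram xi c) s v =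
      qform (fun c => gram f c * (1 - gram xi c)) s v.
    rewrite /qform -sumrB; apply: eq_bigr => a _; rewrite -sumrB; apply: eq_bigr => b _.
    by ring.
  exact: (qform_Ibound v fN e0 sx).
have -> : `|\sum_(d <- t) energy s (piece xi d v) - energy s v| =
    normc (\sum_(a <- s) gram xi (gmul a (ginv a)) * (v a * (v a)^*) -
           \sum_(a <- s) v a * (v a)^*).
  by rewrite -normc_complex -(pieces_energy _ sx tx tP) -energyE -rmorphB.
rewrite -sumrB.
apply: le_trans (normc_sum _ _) _; rewrite /energy mulr_sumr big_seq [leRHS]big_seq.
apply: ler_sum => a asx.
rewrite -[X in _ - X]mul1r -mulrBl Normc.normcM normcB -normc_sqrE normc_complex.
by rewrite ger0_norm ?sqr_ge0// ler_wpM2r ?sqr_ge0// hd.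
Qed.

(** A vector supported in a translate of [L] by [c] is first moved to the unit [grng c], where
    nothing changes because the kernel depends only on a b^-1 = (a c^-1)(b c^-1)^-1, and then along
    the sections to [y], where finitely many kernel values change little. The neighbourhood depends
    on [L] and not on the vector. *)
Lemma near_transport f (L : set G) y (e : R) : Cc f -> compact L -> 0 < e ->
  \forall y' \near y, forall c, grng c = y' ->
  forall s v, in_dom (fibre (gsrc c)) s -> (forall a, a \in s -> L (gmul a (ginv c))) ->
  exists s' v', [/\ in_dom (fibre y) s', energy s' v' = energy s v &
    `|rep_sq f (gsrc c) s v - rep_sq f y s' v'| <= e * energy s v].
Proof.
move=> cf cL e0.
have [s0 [sigma [us sy sc hn]]] := local_sections HG EG y cL.
have [ck _] := gram_Cc HG EG cf.
(* A row or column of the difference kernel has [m] entries, each below [e1], so the Schur test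
   yields at most [m * e1 <= e]. *)
pose m : R := (size s0)%:R; pose e1 := e / (m + 1).
have m1 : 0 < m + 1 by rewrite ltr_wpDl.
have e10 : 0 < e1 by exact: divr_gt0.
have hk : \forall y' \near y, forall a, a \in s0 -> forall b, b \in s0 ->
    normc (gram f (gmul (sigma a y') (ginv (sigma b y'))) - gram f (gmul a (ginv b))) < e1.
  apply: near_seq => a a0; apply: near_seq => b b0.
  have [_ sa] := sc a a0; have [_ sb] := sc b b0.
  have h : (fun y' => gmul (sigma a y') (ginv (sigma b y'))) @ y --> gmul a (ginv b).
    apply: gmul_cvg => //.
    - by apply: (cvg_comp _ _ sb); exact: ginv_continuous.
    - by rewrite grng_inv (sy a)// (sy b).
    - by apply: filterS hn => y' [h1 _ _]; rewrite grng_inv !h1.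
  have hg : (fun y' => gram f (gmul (sigma a y') (ginv (sigma b y')))) @ y -->
      gram f (gmul a (ginv b)) by exact: (cvg_comp _ _ h (ck _)).
  by have /cvgCP/(_ _ e10) := hg.
near=> y' => c cy s v sx sL.
have [h1 h2 h3] : [/\ forall a, a \in s0 -> gsrc (sigma a y') = y',
      uniq [seq sigma a y' | a <- s0] &
      forall b, L b -> gsrc b = y' -> b \in [seq sigma a y' | a <- s0]].
  by near: y'; exact: hn.
have h4 : forall a, a \in s0 -> forall b, b \in s0 ->
    normc (gram f (gmul (sigma a y') (ginv (sigma b y'))) - gram f (gmul a (ginv b))) < e1.
  by near: y'; exact: hk.
(* [tau] sends an arrow over [y] to the matching arrow over [gsrc c]; [v'] reads [v] along [tau],
   with value 0 at matches outside [s]. *)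
pose tau a := gmul (sigma a y') c.
pose v0 b := if b \in s then v b else 0.
pose v' a := v0 (tau a).
have s1x : in_dom (fibre (gsrc c)) [seq tau a | a <- s0].
  split; last by move=> _ /mapP[a a0 ->]; rewrite /fibre /= gsrc_mul// h1.
  rewrite (map_comp (fun b => gmul b c) (fun a => sigma a y')) map_inj_in_uniq// => b b'.
  move=> /mapP[a a0 ->] /mapP[a' a0' ->]; apply: gmul_inj; by rewrite h1.
have ss1 a : a \in s -> a \in [seq tau a | a <- s0].
  move=> asx; have ax := sx.2 a asx.
  have /mapP[a' a0' e'] : gmul a (ginv c) \in [seq sigma a y' | a <- s0].
    by apply: h3; [exact: sL|rewrite gsrc_div// ax].
  by apply/mapP; exists a' => //; rewrite /tau -e' gmulVK// ax.
have v0s a : a \in s -> v0 a = v a by rewrite /v0 => ->.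
have v0n a : a \notin s -> v0 a = 0 by rewrite /v0 => /negPf ->.
have E1 : energy s0 v' = energy s v.
  rewrite /energy /v' -(big_map tau predT (fun b => normc (v0 b) ^+ 2)).
  rewrite [RHS](eq_big_seq (fun b => normc (v0 b) ^+ 2)); last by move=> a /v0s ->.
  apply: big_support; [exact: s1x.1|exact: sx.1| |].
    by move=> a _ /v0n ->; rewrite Normc.normc0 expr0n.
  by move=> a /ss1 ->.
have s0y : in_dom (fibre y) s0 by [].
exists s0, v'; split => //.
have -> : `|rep_sq f (gsrc c) s v - rep_sq f y s0 v'| =
    normc (qform (gram f) s v - qform (gram f) s0 v').
  by rewrite -normc_complex -(rep_sqE _ cf sx) -(rep_sqE _ cf s0y) -rmorphB.
have -> : qform (gram f) s v = \sum_(a <- s0) \sum_(b <- s0)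
    gram f (gmul (sigma a y') (ginv (sigma b y'))) * (v' b * (v' a)^*).
  have -> : qform (gram f) s v = qform (gram f) [seq tau a | a <- s0] v0.
    rewrite /qform (eq_big_seq (fun a => \sum_(b <- [seq tau a | a <- s0])
      gram f (gmul a (ginv b)) * (v0 b * (v0 a)^*))).
      apply: big_support; [exact: sx.1|exact: s1x.1| |].
        by move=> a /ss1 ->.
      by move=> a _ /v0n ->; apply: big1 => b _; rewrite conjC0 !mulr0.
    move=> a asx; rewrite (v0s a asx) (eq_big_seq (fun b =>
      gram f (gmul a (ginv b)) * (v0 b * (v a)^*))); last by move=> b /v0s ->.
    apply: big_support; [exact: sx.1|exact: s1x.1| |].
      by move=> b /ss1 ->.
    by move=> b _ /v0n ->; rewrite mul0r mulr0.
  rewrite /qform big_map; apply: eq_big_seq => a a0; rewrite big_map; apply: eq_big_seq => b b0.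
  congr (gram f _ * _).
  have ts d : d \in s0 -> gsrc (tau d) = gsrc c by move=> d0; rewrite gsrc_mul// h1.
  have tc d : d \in s0 -> gmul (tau d) (ginv c) = sigma d y' by move=> d0; rewrite gmulK// h1.
  rewrite -(gmul_divK (a := tau a) (b := c)) ?ts//.
  by rewrite -[X in gmul _ X]ginv_mul ?ts// !tc.
rewrite /qform -sumrB; under eq_bigr do rewrite -sumrB.
under eq_bigr do under eq_bigr do rewrite -mulrBl.
rewrite -E1.
have me : m * e1 <= e.
  rewrite /e1 mulrA ler_pdivrMr// mulrC ler_wpM2l ?(ltW e0)//; lra.
have cst (u : R) : \sum_(b <- s0) u = m * u.
  by rewrite big_const_seq count_predT iter_addr_0 /m mulr_natl.
apply: le_trans (ler_wpM2r (energy_ge0 _ _) me).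
apply: schur_test => b b0; rewrite -cst big_seq [leRHS]big_seq; apply: ler_sum => a a0.
  by apply/ltW; exact: h4.
by apply/ltW; exact: h4.
Unshelve. all: by end_near. Qed.

End Localization.

Lemma half_frac (R : realType) (e M : R) : 0 < e -> 0 <= M -> e / (2 * (M + 1)) * M <= e / 2.
Proof.
move=> e0 M0; have M1 : 0 < M + 1 by rewrite ltr_wpDl.
have -> : e / (2 * (M + 1)) * M = e / 2 * (M / (M + 1)) by field; rewrite gt_eqF.
rewrite ler_piMr//; first by rewrite divr_ge0// ltW.
by rewrite ler_pdivrMr// mul1r lerDl.
Qed.

(** * The reduced algebra and the ideal of the open reduction *)

Section CredAlgebra.
Variables (R : realType) (G : topGroupoid).
Hypothesis HG : hausdorff_space G.
Hypothesis EG : etale G.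
Hypothesis CG : compact [set: gobj G].
Implicit Types (a b c : G) (x y : gobj G) (f g : G -> R[i]) (s : seq G).
Implicit Types (S T : opfield R G).

Lemma regular_repZ (k : R[i]) f x xi : Cc f ->
  regular_rep (fun a => k * f a) x xi = k *: regular_rep f x xi.
Proof.
move=> cf; apply: val_inj; apply/funext => c.
change (regular_rep (fun a => k * f a) x xi c = k * regular_rep f x xi c).
have [cx|cx] := pselect (fibre x c); last by rewrite !l2_out// mulr0.
have [s sx sP] := finite_row1 HG EG cf cx.
rewrite !(regular_rep_seq EG (s := s))//.
- by rewrite mulr_sumr; apply: eq_bigr => a _; rewrite mulrA.
- by move=> a ax; rewrite mulf_eq0 => /norP[/(sP a ax)].
- exact: CcZ.
- by move=> a ax; rewrite !mulf_eq0 => /norP[/norP[_ /(sP a ax)]].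
Qed.

Lemma regular_repN f x : Cc f -> regular_rep (fun a => (-1) * f a) x = - regular_rep f x.
Proof.
move=> cf; apply: val_inj; apply/funext => xi; rewrite [LHS]regular_repZ//.
by rewrite scaleN1r.
Qed.

Lemma Cred_regular_rep f : Cc f -> Cred R G (regular_rep f).
Proof. by move=> cf e e0; exists f => // x; rewrite subrr opnorm0 ltW. Qed.

Lemma Cred_bounded T : Cred R G T ->
  exists2 M : R, 0 <= M & forall x, opnorm (T x) <= M.
Proof.
move=> /(_ 1 ltr01)[f cf Tf]; have [M M0 fM] := regular_rep_bounded HG EG CG cf.
exists (1 + M) => [|x]; first exact: addr_ge0.
rewrite -(subrK (regular_rep f x) (T x)); apply: le_trans (opnormD _ _) _.
by rewrite lerD.
Qed.

Lemma CredD S T : Cred R G S -> Cred R G T -> Cred R G (fun x => S x + T x).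
Proof.
move=> hS hT e e0; have e2 : 0 < e / 2 by exact: divr_gt0.
have [f cf Sf] := hS _ e2; have [g cg Tg] := hT _ e2.
exists (fun a => f a + g a) => [|x]; first exact: CcD.
rewrite regular_repD// opprD addrACA; apply: le_trans (opnormD _ _) _.
by rewrite [leRHS]splitr lerD.
Qed.

Lemma CredN T : Cred R G T -> Cred R G (fun x => - T x).
Proof.
move=> hT e e0; have [f cf Tf] := hT _ e0.
exists (fun a => (-1) * f a) => [|x]; first exact: CcZ.
by rewrite regular_repN// -opprD opnormN.
Qed.

Lemma CredB S T : Cred R G S -> Cred R G T -> Cred R G (fun x => S x - T x).
Proof. by move=> hS /CredN; exact: CredD. Qed.

Lemma CredM S T : Cred R G S -> Cred R G T -> Cred R G (fun x => S x * T x).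
Proof.
move=> hS hT e e0; have [M M0 TM] := Cred_bounded hT.
have h1 : 0 < e / (2 * (M + 1)) by rewrite divr_gt0// mulr_gt0// ltr_wpDl.
have [f cf Sf] := hS _ h1; have [N N0 fN] := regular_rep_bounded HG EG CG cf.
have h2 : 0 < e / (2 * (N + 1)) by rewrite divr_gt0// mulr_gt0// ltr_wpDl.
have [g cg Tg] := hT _ h2.
exists (gconv f g) => [|x]; first exact: gconv_Cc.
rewrite regular_rep_gconv//.
have -> : S x * T x - regular_rep f x * regular_rep g x =
    (S x - regular_rep f x) * T x + regular_rep f x * (T x - regular_rep g x).
  by rewrite mulrBl mulrBr addrA subrK.
apply: le_trans (opnormD _ _) _; rewrite [leRHS]splitr lerD//.
  apply: le_trans (opnormM _ _) _.
  apply: le_trans (ler_pM (opnorm_ge0 _) (opnorm_ge0 _) (Sf x) (TM x)) _.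
  exact: half_frac.
apply: le_trans (opnormM _ _) _.
apply: le_trans (ler_pM (opnorm_ge0 _) (opnorm_ge0 _) (fN x) (Tg x)) _.
by rewrite mulrC half_frac.
Qed.

Lemma Cred_closed T : (forall e : R, 0 < e -> exists2 S, Cred R G S &
  forall x, opnorm (T x - S x) <= e) -> Cred R G T.
Proof.
move=> h e e0; have e2 : 0 < e / 2 by exact: divr_gt0.
have [S hS TS] := h _ e2; have [f cf Sf] := hS _ e2.
exists f => // x; rewrite -(subrK (S x) (T x)) -addrA; apply: le_trans (opnormD _ _) _.
by rewrite [leRHS]splitr lerD.
Qed.

Definition units : set G := range (@gid G).

Lemma units_compact : compact units.
Proof.
apply: continuous_compact => //; apply: continuous_subspaceT => x.
exact: gid_continuous.
Qed.

(** For [a] near a unit, [a] and the identity at its range lie in one set on which the range map is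
    injective, so they coincide. *)
Lemma units_open : open units.
Proof.
rewrite openE => _ [x _ <-]; rewrite /interior.
have [U [oU Ux _ _ [g _ gK]]] := EG (gid x).
have n1 : nbhs (gid x) U by exact: open_nbhs_nbhs.
have n2 : nbhs (gid x) [set a | U (gid (grng a))].
  have h : (fun a => gid (grng a)) @ gid x --> gid x.
    have := cvg_comp _ _ (@grng_continuous G (gid x)) (@gid_continuous G _).
    by rewrite grng_id.
  exact: h _ n1.
apply: filterS2 n1 n2 => a Ua Ua'; exists (grng a) => //.
by have := gK _ Ua'; rewrite grng_id (gK _ Ua).
Qed.

(** The units are compact and open, so their indicator is in C_c(G); it is the identity of the
    convolution algebra. *)
Definition unit_fun a : R[i] := (a \in units)%:R.

Lemma unit_fun_Cc : Cc unit_fun.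
Proof.
apply: (Cc_intro HG _ units_compact).
  move=> a; rewrite /unit_fun; apply/cvgCP => e e0.
  have [ua|ua] := pselect (units a).
    have : nbhs a units by apply: open_nbhs_nbhs; split => //; exact: units_open.
    apply: filterS => b ub; rewrite !mem_set// subrr Normc.normc0//.
  have : nbhs a (~` units).
    apply: open_nbhs_nbhs; split => //; apply: closed_openC.
    exact: compact_closed HG units_compact.
  by apply: filterS => b ub; rewrite !memNset// subrr Normc.normc0.
by move=> a; rewrite /unit_fun; case: (boolP (a \in units)) => [/set_mem//|]; rewrite eqxx.
Qed.

Lemma units_div a b : gsrc a = gsrc b -> units (gmul a (ginv b)) -> a = b.
Proof.
move=> ab [z _ zE].
have zb : z = grng b by rewrite -(gsrc_id z) zE gsrc_div.
have := gmulVK ab; rewrite -zE zb g1mul => ->//.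
Qed.

Lemma regular_rep1 x : regular_rep unit_fun x = 1.
Proof.
apply: bop_ext => xi c cx; rewrite (regular_rep_seq EG (s := [:: c]) unit_fun_Cc cx).
- rewrite big_seq1 gmulV /unit_fun mem_set ?mul1r//; by exists (grng c).
- by split => // a; rewrite inE => /eqP ->.
move=> a ax; rewrite mulf_eq0 => /norP[+ _]; rewrite /unit_fun.
case: (boolP (_ \in units)) => [/set_mem h _|]; last by rewrite eqxx.
by rewrite inE eq_sym; apply/eqP; apply: units_div h; rewrite cx ax.
Qed.

Lemma Cred1 : Cred R G (fun x => 1).
Proof.
move=> e e0; exists unit_fun => [|x]; first exact: unit_fun_Cc.
by rewrite regular_rep1 subrr opnorm0 ltW.
Qed.

Lemma CredX T n : Cred R G T -> Cred R G (fun x => T x ^+ n).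
Proof.
move=> hT; elim: n => [|n IH].
  rewrite (_ : (fun x => _) = (fun=> 1)); first exact: Cred1.
  by apply: functional_extensionality_dep => x; rewrite expr0.
have -> : (fun x => T x ^+ n.+1) = (fun x => T x * T x ^+ n).
  by apply: functional_extensionality_dep => x; rewrite exprS.
exact: (CredM hT IH).
Qed.

Lemma Cred_sum n (F : nat -> opfield R G) : (forall i, Cred R G (F i)) ->
  Cred R G (fun x => \sum_(i < n) F i x).
Proof.
move=> hF; elim: n => [|n IH].
  have -> : (fun x => \sum_(i < 0) F i x) = (fun x => 1 - 1).
    by apply: functional_extensionality_dep => x; rewrite big_ord0 subrr.
  exact: CredB Cred1 Cred1.
have -> : (fun x => \sum_(i < n.+1) F i x) = (fun x => \sum_(i < n) F i x + F n x).
  by apply: functional_extensionality_dep => x; rewrite big_ord_recr.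
exact: (CredD IH (hF n)).
Qed.

Lemma opnormX x (A : bop R (fibre x)) n : opnorm (A ^+ n) <= opnorm A ^+ n.
Proof.
elim: n => [|n IH]; first by rewrite !expr0 opnorm1_le.
rewrite !exprS; apply: le_trans (opnormM _ _) _.
by rewrite ler_wpM2l// opnorm_ge0.
Qed.

(** A Neumann series, convergent uniformly in the unit, so that its sum stays in [Cred]. One side is
    enough: it is used at boundary units, where invertibility of the operator makes a left inverse
    two-sided. *)
Lemma Cred_left_inverse T : Cred R G T -> (forall x, opnorm (1 - T x) <= 1 / 2) ->
  exists2 S, Cred R G S & forall x, S x * T x = 1.
Proof.
move=> hT T2.
have hE : Cred R G (fun x => 1 - T x) by exact: (CredB Cred1 hT).
pose P n x := \sum_(i < n) (1 - T x) ^+ i.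
have hP n : Cred R G (P n).
  by apply: (@Cred_sum n (fun i x => (1 - T x) ^+ i)) => i; exact: CredX.
pose r n : R := 2 * (1 / 2) ^+ n.
have r_cvg : r @ \oo --> 0.
  rewrite -[0](mulr0 2); apply: cvgM; first exact: cvg_cst.
  by apply: cvg_expr; rewrite ger0_norm; lra.
have En x n : opnorm ((1 - T x) ^+ n) <= (1 / 2) ^+ n.
  apply: le_trans (opnormX _ _) _.
  by apply: lerXn2r; rewrite ?nnegrE ?opnorm_ge0 ?T2//; lra.
(* The induction needs the telescoping bound [r n - r m]; each new term of norm at most (1/2)^n is
   exactly r n - r (n + 1). *)
have Pd x n m : (n <= m)%N -> opnorm (P m x - P n x) <= r n - r m.
  move=> /subnK <-; elim: (m - n)%N => [|k IH]; first by rewrite !add0n !subrr opnorm0.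
  rewrite addSn {1}/P big_ord_recr /= -/(P (k + n)%N x) addrAC.
  apply: le_trans (opnormD _ _) _.
  have := En x (k + n)%N; have := IH; rewrite /r exprS; lra.
have r0 n : 0 <= r n by rewrite mulr_ge0// exprn_ge0//; lra.
have Pr x n m : (n <= m)%N -> opnorm (P m x - P n x) <= r n.
  by move=> nm; apply: le_trans (Pd x n m nm) _; rewrite gerBl.
have lim x : exists A : bop R (fibre x), forall n, opnorm (A - P n x) <= r n.
  exact: (@bop_complete R G (fibre x) (P^~ x) r (@Pr x) r_cvg).
have [S SP] : exists S : opfield R G, forall x n, opnorm (S x - P n x) <= r n.
  by exists (fun x => projT1 (cid (lim x))) => x n; exact: (projT2 (cid (lim x)) n).
have rsmall e : 0 < e -> exists n, r n <= e.
  move=> e0; have /cvgrPdist_lt/(_ _ e0)[n _ hn] := r_cvg.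
  by exists n; have := hn n (leqnn n); rewrite /= sub0r normrN ger0_norm// => /ltW.
exists S => [|x].
  apply: (@Cred_closed S) => e /rsmall[n hn]; exists (P n); first exact: hP.
  by move=> x; exact: le_trans (SP x n) hn.
apply/eqP; rewrite -subr_eq0; apply/eqP/opnorm_eq0.
apply: (@le_of_eps _ _ _ (opnorm (T x) + 1)); first by rewrite addr_ge0 ?opnorm_ge0.
move=> e /rsmall[n hn]; rewrite add0r.
have PT : P n x * T x = 1 - (1 - T x) ^+ n.
  rewrite /P; elim: n {hn} => [|n IH]; first by rewrite big_ord0 mul0r expr0 subrr.
  rewrite big_ord_recr /= mulrDl IH exprSr mulrBr mulr1 opprB -addrA.
  by congr (_ + _); rewrite addrC.
have -> : S x * T x - 1 = (S x - P n x) * T x - (1 - T x) ^+ n.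
  by rewrite mulrBl PT opprB addrAC addrA subrK.
apply: le_trans (opnormD _ _) _; rewrite opnormN [leRHS]mulrDl mul1r lerD//.
  apply: le_trans (opnormM _ _) _; rewrite mulrC ler_wpM2l ?opnorm_ge0//.
  exact: le_trans (SP x n) hn.
apply: le_trans (En x n) _; apply: le_trans hn; rewrite /r.
by rewrite ler_peMl ?ler1n// exprn_ge0// divr_ge0.
Qed.

End CredAlgebra.

(** * Functions small on the boundary are close to functions supported over [X] *)

Section Exactness.
Variables (R : realType) (G : topGroupoid) (X : set (gobj G)).
Hypothesis HG : hausdorff_space G.
Hypothesis EG : etale G.
Hypothesis CG : compact [set: gobj G].
Hypothesis IX : invariant_units X.
Hypothesis OX : open X.
Implicit Types (a b c : G) (x y : gobj G) (f g : G -> R[i]) (s : seq G).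
Implicit Types (S T : opfield R G) (v : G -> R[i]).

Lemma invariantE c : X (grng c) <-> X (gsrc c).
Proof.
have h : (@grng G @^-1` X) c <-> (@gsrc G @^-1` X) c by rewrite IX.
exact: h.
Qed.

Lemma boundaryE c : redset (boundary X) c <-> ~ X (gsrc c).
Proof. by split => [[]//|h]; split => //=; move=> /invariantE. Qed.

(* A form of amenability of the reduction to [Y] in terms of positive definite
   compactly supported functions [gram xi] on the whole groupoid. *)
Definition schur_amenable (Y : set (gobj G)) := forall (K : set G) (e : R),
  compact K -> 0 < e -> exists2 xi : G -> R[i], Cc xi &
    forall c, K c -> redset Y c -> normc (1 - gram xi c) <= e.

(** This is L^-1 L. If d a^-1 and d b^-1 are in [L], then a b^-1 is in it, whatever d is: this makes
    the size of the pieces uniform. *)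
Definition quot_set (L : set G) : set G :=
  [set c | exists a b, [/\ L a, L b, grng a = grng b & c = gmul (ginv a) b]].

Lemma quot_set_compact L : compact L -> compact (quot_set L).
Proof.
move=> cL; have := compact_mul HG (compact_inv cL) cL; congr compact.
apply/seteqP; split => [_ [_ [b [[a La <-] Lb ab ->]]]|_ [a [b [La Lb ab ->]]]].
  by exists a, b; split => //; rewrite -ab gsrc_inv.
by exists (ginv a), b; split => //; rewrite gsrc_inv.
Qed.

Lemma piece_support (xi : G -> R[i]) x d a b : fibre x d -> fibre x a -> fibre x b ->
  xi (gmul d (ginv a)) != 0 -> xi (gmul d (ginv b)) != 0 ->
  quot_set (supp xi) (gmul a (ginv b)).
Proof.
move=> dx ax bx da db.
have da' : gsrc d = gsrc a by rewrite dx ax.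
have db' : gsrc d = gsrc b by rewrite dx bx.
exists (gmul d (ginv a)), (gmul d (ginv b)); split.
- exact: in_supp.
- exact: in_supp.
- by rewrite !grng_div.
- by rewrite ginv_mul// gmul_divK -?da'.
Qed.

Lemma rep_sq_filter f x s v :
  rep_sq f x s v = rep_sq f x [seq a <- s | v a != 0] v.
Proof.
rewrite /rep_sq; congr (l2norm (regular_rep f x _) ^+ 2).
apply: val_inj; apply/funext => a; rewrite /= /fvec_fun mem_filter.
by have [->|] := eqVneq (v a) 0; rewrite //= !if_same.
Qed.

Lemma energy_filter s v : energy s v = energy [seq a <- s | v a != 0] v.
Proof.
rewrite /energy big_filter [RHS]big_mkcond; apply: eq_bigr => a _.
by have [->|//] := eqVneq (v a) 0; rewrite Normc.normc0 expr0n.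
Qed.

Lemma in_dom_filter (D : set G) s (p : pred G) : in_dom D s -> in_dom D [seq a <- s | p a].
Proof.
by move=> [us sD]; split => [|a]; [exact: filter_uniq|rewrite mem_filter => /andP[_ /sD]].
Qed.

Lemma rep_sq_le (A : R) f x s v : in_dom (fibre x) s -> opnorm (regular_rep f x) <= A ->
  rep_sq f x s v <= A ^+ 2 * energy s v.
Proof.
move=> sx hA; rewrite /rep_sq -(l2norm_fvec v sx).
have := le_opnorm (regular_rep f x) (fvec (fibre x) s v).
have := l2norm_ge0 (regular_rep f x (fvec (fibre x) s v)).
move: (l2norm (regular_rep f x _)) => n n0.
have := l2norm_ge0 (fvec (fibre x) s v); move: (l2norm (fvec (fibre x) s v)) => m m0 h.
have A0 : 0 <= A by exact: le_trans (opnorm_ge0 _) hA.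
rewrite -exprMn ler_pXn2r ?nnegrE ?mulr_ge0//.
by apply: le_trans h _; rewrite ler_wpM2r.
Qed.

Lemma opnorm_rep_sq (A : R) f x : 0 <= A ->
  (forall s v, in_dom (fibre x) s -> rep_sq f x s v <= A ^+ 2 * energy s v) ->
  opnorm (regular_rep f x) <= A.
Proof.
move=> A0 h; apply: (opnorm_le A0); apply: (bop_bound_dense A0) => s v sx.
have := h s v sx; rewrite /rep_sq -(l2norm_fvec v sx).
have := l2norm_ge0 (regular_rep f x (fvec (fibre x) s v)).
move: (l2norm (regular_rep f x _)) => n n0.
have := l2norm_ge0 (fvec (fibre x) s v); move: (l2norm (fvec (fibre x) s v)) => m m0.
by rewrite -exprMn ler_pXn2r ?nnegrE ?mulr_ge0.
Qed.

(* Near the boundary, a vector is cut by [xi] into pieces whose supports are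
   right translates of a fixed compact set, on which the representation at [x]
   is close to that at a boundary point. *)
Lemma small_near_boundary f (e : R) : schur_amenable (boundary X) -> Cc f -> 0 < e ->
  (forall w, ~ X w -> opnorm (regular_rep f w) <= e) ->
  exists V : set (gobj G), [/\ open V, ~` X `<=` V &
    forall x s v, in_dom (fibre x) s -> (forall a, a \in s -> V (grng a)) ->
      rep_sq f x s v <= (3 * e) ^+ 2 * energy s v].
Proof.
move=> am cf e0 fw.
have [N gN] := Ibound_ex HG EG CG (gram_Cc HG EG cf); have [N0 _ _] := gN.
pose K := supp (gram f) `|` @units G.
have cK : compact K.
  by apply: compactU; [exact: supp_compact (gram_Cc HG EG cf)|exact: units_compact].
(* With closeness [2 * e1], the bound 1/4 keeps the energies of the pieces below 3/2 of the total,
   and [e1 * N <= e ^+ 2] keeps the Schur error below 2 e^2; together 2 + 2 * 3/2 = 5 <= 9. *)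
pose e1 : R := Num.min (1 / 4) (e ^+ 2 / (N + 1)).
have N1 : 0 < N + 1 by rewrite ltr_wpDl.
have e10 : 0 < e1 by rewrite lt_min; apply/andP; split; [lra|rewrite divr_gt0// exprn_gt0].
have e14 : e1 <= 1 / 4 by rewrite ge_min lexx.
have e1N : e1 * N <= e ^+ 2.
  apply: le_trans (_ : e1 * (N + 1) <= _); first by rewrite ler_wpM2l ?(ltW e10)// lerDl.
  by rewrite -ler_pdivlMr// ge_min lexx orbT.
have [xi cxi xiP] := am K e1 cK e10.
have [cgx _] := gram_Cc HG EG cxi.
(* Both clauses are relaxed, [2 * e1] for [e1] and [2 * e ^+ 2] for [e ^+ 2], so that they persist
   near a boundary unit. *)
pose P y' := (forall c, K c -> gsrc c = y' -> normc (1 - gram xi c) <= 2 * e1) /\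
  (forall c, grng c = y' -> forall s v, in_dom (fibre (gsrc c)) s ->
     (forall a, a \in s -> quot_set (supp xi) (gmul a (ginv c))) ->
     rep_sq f (gsrc c) s v <= 2 * e ^+ 2 * energy s v).
have nP y : ~ X y -> \forall y' \near y, P y'.
  move=> Xy.
  (* The arrows of [K] where [gram xi] is bad form a compact set; its sources omit the boundary unit
     [y], and hence a neighbourhood of it. *)
  pose C := K `&` [set c | 2 * e1 <= normc (1 - gram xi c)].
  have cn : continuous (fun c => normc (1 - gram xi c)).
    by move=> c; apply: cvg_normc; apply: cvgB (cgx c); exact: cvg_cst.
  have cC : compact C.
    apply: compact_closedI => //.
    by apply: (@preimage_closed _ _ _ [set r : R | 2 * e1 <= r]) => [c _|];
      [exact: cn|exact: closed_ge].
  have clC : closed (@gsrc G @` C).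
    apply: compact_closed; first exact: gobj_hausdorff.
    by apply: continuous_compact => //; apply: continuous_subspaceT; exact: gsrc_continuous.
  have nC : ~ (@gsrc G @` C) y.
    move=> [c [Kc /= hc] cy].
    have := xiP c Kc; rewrite boundaryE cy => /(_ Xy) h; lra.
  have n1 : \forall y' \near y, ~ (@gsrc G @` C) y'.
    by apply: open_nbhs_nbhs; split => //; exact: closed_openC.
  have n2 := near_transport HG EG y cf (quot_set_compact (supp_compact cxi)) (exprn_gt0 2 e0).
  apply: filterS2 n1 n2 => y' h1 h2; split.
    move=> c Kc cy; rewrite leNgt; apply/negP => hc; apply: h1; exists c => //.
    by split => //=; exact: ltW.
  move=> c cy s v sx sL; have [s' [v' [s'y Ee]]] := h2 c cy s v sx sL.
  rewrite ler_norml => /andP[_ h].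
  have := rep_sq_le v' s'y (fw y Xy); rewrite Ee => h'.
  move: h h'; move: (rep_sq f (gsrc c) s v) (rep_sq f y s' v') (energy s v) (e ^+ 2).
  by move=> u1 u2 u3 u4; lra.
exists (interior P); split; [exact: open_interior|exact: nP|].
move=> x s v sx sV.
have sP a : a \in s -> P (grng a) by move=> /sV /interior_subset.
have hab a b : a \in s -> b \in s -> gram f (gmul a (ginv b)) != 0 ->
    normc (1 - gram xi (gmul a (ginv b))) <= 2 * e1.
  move=> asx bs gab; have [h _] := sP b bs; apply: h; first by left; exact: in_supp.
  by rewrite gsrc_div// (sx.2 a asx) (sx.2 b bs).
have haa a : a \in s -> normc (1 - gram xi (gmul a (ginv a))) <= 2 * e1.
  move=> asx; have [h _] := sP a asx; apply: h; last by rewrite gsrc_div.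
  by right; exists (grng a) => //; rewrite gmulV.
have e120 : 0 <= 2 * e1 by rewrite mulr_ge0// ltW.
have [t tx [h1 h2]] := pieces_norm HG EG v cf cxi gN e120 sx hab haa.
have hp d : d \in t ->
    rep_sq f x s (piece xi d v) <= 2 * e ^+ 2 * energy s (piece xi d v).
  move=> dt; rewrite rep_sq_filter energy_filter.
  have s2x := in_dom_filter (fun a => piece xi d v a != 0) sx.
  set s2 := [seq a <- s | piece xi d v a != 0] in s2x *.
  (* Any arrow [c] of the support serves as centre: by [piece_support] the support lies in the
     translate of [quot_set (supp xi)] by [c]. Empty support means the zero vector. *)
  case E : s2 => [|c s2'].
    rewrite /energy big_nil mulr0 /rep_sq (_ : fvec _ _ _ = 0).
      by rewrite -(scale0r 0) bopZ scale0r l2norm0 expr0n.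
    by apply: val_inj; apply/funext => a; rewrite /= /fvec_fun in_nil.
  rewrite -E.
  have cs2 : c \in s2 by rewrite E inE eqxx.
  have := cs2; rewrite mem_filter => /andP[pc cs].
  have [_ h] := sP c cs; have cx := sx.2 c cs.
  have := h c erefl s2 (piece xi d v); rewrite cx; apply => //.
  move=> a; rewrite mem_filter => /andP[pa asx].
  apply: (piece_support (tx.2 d dt) (sx.2 a asx) cx).
    by apply: contra_neq pa; rewrite /piece => ->; rewrite mul0r.
  by apply: contra_neq pc; rewrite /piece => ->; rewrite mul0r.
have h3 : \sum_(d <- t) rep_sq f x s (piece xi d v) <=
    2 * e ^+ 2 * \sum_(d <- t) energy s (piece xi d v).
  by rewrite mulr_sumr big_seq [leRHS]big_seq; apply: ler_sum.
move: h1 h2; rewrite !ler_norml => /andP[h1 _] /andP[_ h2].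
have E0 := energy_ge0 s v; have ee := sqr_ge0 e.
have q1 : e1 * N * energy s v <= e ^+ 2 * energy s v by rewrite ler_wpM2r.
have q2 : e1 * energy s v <= 1 / 4 * energy s v by rewrite ler_wpM2r.
have q3 : \sum_(d <- t) energy s (piece xi d v) <= 3 / 2 * energy s v by lra.
have q4 := ler_wpM2l (mulr_ge0 (ler0n _ 2) ee) q3.
have q5 : 0 <= e ^+ 2 * energy s v by exact: mulr_ge0.
rewrite exprMn; move: h1 h3 q1 q4 q5.
move: (\sum_(d <- t) rep_sq _ _ _ _) (\sum_(d <- t) energy _ _) (rep_sq f x s v) => u1 u2 u3.
move: (energy s v) (e ^+ 2) => E2 e2 h1 h3 q1 q4 q5.
nra.
Qed.

Lemma boundary_closed : closed (~` X).
Proof. exact: open_closedC. Qed.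

(** [f] is cut by a function of the source into [g], supported over [X], and [h]. As s(c a^-1) =
    r(a), cutting the kernel by the source amounts to cutting the vector by the range, so [h] is
    tested only on vectors with ranges near the boundary. *)
Lemma exact_Cc f (e : R) : schur_amenable (boundary X) -> Cc f -> 0 < e ->
  (forall w, ~ X w -> opnorm (regular_rep f w) <= e) ->
  exists g, [/\ Cc g, exists2 K, compact K & K `<=` redset X /\ (forall a, g a != 0 -> K a) &
    forall x, opnorm (regular_rep f x - regular_rep g x) <= 3 * e].
Proof.
move=> am cf e0 fw; have [V [oV XV hV]] := small_near_boundary am cf e0 fw.
have nG : normal_space (gobj G) by apply: compact_normal => //; exact: gobj_hausdorff.
have [|u [cu u01 uX uV]] := urysohn_function R nG boundary_closed (open_closedC oV).
  by apply/seteqP; split => // x [/XV].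
pose psi (x : gobj G) : R := Num.max 0 (2 * u x - 1).
have cpsi : continuous psi by exact: continuous_ramp.
have psi01 x : 0 <= psi x <= 1.
  have /andP[h1 h2] := u01 x; rewrite /psi le_max lexx/= ge_max ler01/=; lra.
have cphi (k : gobj G -> R) : continuous k -> continuous (fun a => (k (gsrc a))%:C%C : R[i]).
  by move=> ck a; apply: cvg_complex; apply: (cvg_comp _ k _ (ck _)); exact: gsrc_continuous.
pose g a := (psi (gsrc a))%:C%C * f a.
pose h a := (1 - psi (gsrc a))%:C%C * f a.
have cg : Cc g by apply: CcMl => //; exact: cphi.
have ch : Cc h.
  apply: CcMl => //; apply: (cphi (fun x => 1 - psi x)) => x.
  by apply: cvgB (cpsi x); exact: cvg_cst.
have fE : f = fun a => g a + h a.
  by apply/funext => a; rewrite /g /h -mulrDl -rmorphD /= [psi _ + _]addrC subrK mul1r.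
exists g; split => // [|x].
  exists (supp f `&` (fun a => u (gsrc a)) @^-1` [set r | 1 / 2 <= r]).
    apply: compact_closedI; first exact: supp_compact.
    apply: preimage_closed; last exact: closed_ge.
    move=> a _; apply: (cvg_comp _ u _ (cu _)); exact: gsrc_continuous.
  split => [a [_ /= ua]|a].
    suff Xa : X (gsrc a) by split => //; exact/invariantE.
    by apply: contrapT => /uX ua0; rewrite ua0 in ua; lra.
  rewrite /g mulf_eq0 => /norP[pa fa]; split; first exact: in_supp.
  rewrite /= leNgt; apply/negP => hu; move/eqP: pa; apply.
  rewrite /psi max_l//; lra.
rewrite fE regular_repD// addrAC subrr add0r.
apply: opnorm_rep_sq => [|s v sx]; first by rewrite mulr_ge0// ltW.
(* [v1] vanishes where [u] is 1, that is on arrows with range outside [V]. *)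
pose v1 a := (1 - psi (grng a))%:C%C * v a.
have -> : rep_sq h x s v = rep_sq f x s v1.
  rewrite /rep_sq; congr (l2norm _ ^+ 2); apply: val_inj; apply/funext => c.
  change (regular_rep h x (fvec (fibre x) s v) c = regular_rep f x (fvec (fibre x) s v1) c).
  have [cx|cx] := pselect (fibre x c); last by rewrite !l2_out.
  rewrite !regular_rep_fvec//; apply: eq_big_seq => a asx.
  by rewrite /h /v1 gsrc_div ?cx ?(sx.2 a asx)//; ring.
rewrite rep_sq_filter; apply: le_trans (hV x _ v1 (in_dom_filter _ sx) _) _.
  move=> a; rewrite mem_filter => /andP[va _]; apply: contrapT => /uV uva.
  move/eqP: va; apply; rewrite /v1 /psi uva max_r; last by lra.
  by rewrite (_ : 1 - _ = 0) ?mul0r//; lra.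
rewrite -energy_filter ler_wpM2l ?sqr_ge0//; apply: ler_sum => a _.
rewrite /v1 Normc.normcM normc_complex.
rewrite ler_pXn2r ?nnegrE ?mulr_ge0 ?normc_ge0// ler_piMl ?normc_ge0//.
by have /andP[h1 h2] := psi01 (grng a); rewrite ger0_norm; lra.
Qed.

End Exactness.

Lemma valL_out (U V : Type) (A : set U) (v : V) (f : A -> V) a :
  ~ A a -> valL_ v f a = v.
Proof. by move=> nA; rewrite /valL_ oinv_set_val /= insubN// memNset. Qed.

Lemma valL_in (U V : Type) (A : set U) (v : V) (f : A -> V) (a : A) :
  valL_ v f (val a) = f a.
Proof. by rewrite /valL_ oinv_set_val /= valK. Qed.

(** * Inversion modulo the ideal *)

Section Inversion.
Variables (R : realType) (G : topGroupoid) (X : set (gobj G)).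
Hypothesis HG : hausdorff_space G.
Hypothesis EG : etale G.
Hypothesis CG : compact [set: gobj G].
Hypothesis IX : invariant_units X.
Hypothesis OX : open X.
Implicit Types (a b c : G) (x y : gobj G) (f g : G -> R[i]) (s : seq G).
Implicit Types (S T : opfield R G) (v : G -> R[i]).

Lemma reduction_extension g (K : set G) : Cc g -> compact K -> K `<=` redset X ->
  (forall a, g a != 0 -> K a) ->
  exists2 f : reduction X -> R[i], Cc f & valL_ 0 f = g.
Proof.
move=> [cg _] cK KX gK.
pose f (a : redset X) : R[i] := g (val a).
exists f; last first.
  apply/funext => a; have [Xa|Xa] := pselect (redset X a).
    by rewrite (valL_in 0 f (exist (fun b => b \in redset X) a (mem_set Xa))).
  rewrite valL_out//; apply/esym; apply: contrapT => /eqP /gK /KX; exact: Xa.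
have cK' := compact_set_val cK KX.
have clK' : closed ((fun a : redset X => val a) @^-1` K).
  apply: preimage_closed; last exact: compact_closed.
  by move=> a _; exact: set_val_continuous.
split; last by apply: (closed_compact_closure clK' cK') => a /= /gK.
move=> a; apply: (cvg_comp _ g _ (cg _)); exact: set_val_continuous.
Qed.

Lemma reduction_rep_vanish (f : reduction X -> R[i]) w : ~ X w ->
  regular_rep (valL_ 0 f) w = 0.
Proof.
move=> Xw; apply: regular_rep_unique => xi c cw.
rewrite (_ : (0 : bop R (fibre w)) xi c = 0)// fsbig1// => a aw.
rewrite valL_out ?mul0r// => -[_ /=]; rewrite gsrc_div ?cw ?aw//.
by move=> /(invariantE IX); rewrite aw.
Qed.

Lemma Cred_reduction_vanish T w : Cred_reduction R X T -> ~ X w -> T w = 0.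
Proof.
move=> hT Xw; apply: opnorm_eq0; apply/ler_addgt0Pl => e e0; rewrite addr0.
by have [f _ /(_ w)] := hT e e0; rewrite reduction_rep_vanish// subr0.
Qed.

Lemma exact_Cred T (e : R) : schur_amenable R (boundary X) -> Cred R G T -> 0 < e ->
  (forall w, ~ X w -> opnorm (T w) <= e) ->
  exists f : reduction X -> R[i], [/\ Cc f, Cc (valL_ 0 f) &
    forall x, opnorm (T x - regular_rep (valL_ 0 f) x) <= 7 * e].
Proof.
move=> am hT e0 Tw; have [f cf Tf] := hT e e0.
(* Replacing [T] by [f] costs [e], so [f] is bounded by [2 * e] on the boundary; then
   [3 * (2 * e) + e = 7 * e]. *)
have [|w Xw|g [cg [K cK [KX gK]] fg]] := exact_Cc HG EG CG IX OX am cf (e := 2 * e).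
- by rewrite mulr_gt0.
- rewrite -(subrK (T w) (regular_rep f w)); apply: le_trans (opnormD _ _) _.
  by rewrite opnormB; have := Tf w; have := Tw w Xw; lra.
have [h ch hg] := reduction_extension cg cK KX gK.
exists h; split => //; first by rewrite hg.
move=> x; rewrite hg -(subrK (regular_rep f x) (T x)) -addrA.
by apply: le_trans (opnormD _ _) _; have := Tf x; have := fg x; lra.
Qed.

(** Exactness of the sequence of reduced algebras: with [Cred_reduction_vanish], the ideal is the
    kernel of restriction to the boundary. *)
Lemma exact_vanish T : schur_amenable R (boundary X) -> Cred R G T ->
  (forall w, ~ X w -> T w = 0) -> Cred_reduction R X T.
Proof.
move=> am hT Tw e e0; have e7 : 0 < e / 7 by exact: divr_gt0.
have [|f [cf _ Tf]] := exact_Cred am hT e7.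
  by move=> w /Tw ->; rewrite opnorm0 ltW.
by exists f => // x; apply: le_trans (Tf x) _; rewrite mulrC divfK.
Qed.

(** The expansion of |v - t K v|^2, carried out on a list containing the supports of both vectors
    instead of through [inner]. *)
Lemma l2norm_sub_rep k x s v (t : R) : Cc k -> in_dom (fibre x) s ->
  l2norm (fvec (fibre x) s v - t%:C%C *: regular_rep k x (fvec (fibre x) s v)) ^+ 2 =
  energy s v - 2 * t * complex.Re (qform k s v) +
  t ^+ 2 * l2norm (regular_rep k x (fvec (fibre x) s v)) ^+ 2.
Proof.
move=> ck sx; have [u [uu ux] uP] := col_support HG EG ck sx.
pose S := undup (s ++ u).
have Sx : in_dom (fibre x) S.
  split; first exact: undup_uniq.
  by move=> a; rewrite mem_undup mem_cat => /orP[/sx.2|/ux].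
pose v0 a := if a \in s then v a else 0.
pose z c := \sum_(a <- s) k (gmul c (ginv a)) * v a.
have zS c : fibre x c -> z c != 0 -> c \in S.
  move=> cx zc; rewrite mem_undup mem_cat; apply/orP; right; apply: contrapT => cu.
  move/eqP: zc; apply; rewrite /z big_seq big1// => a asx.
  have [->|ka] := eqVneq (k (gmul c (ginv a))) 0; first by rewrite mul0r.
  by exfalso; apply: cu; exact: (uP a).
have E1 : regular_rep k x (fvec (fibre x) s v) = fvec (fibre x) S z.
  apply: val_inj; apply/funext => c.
  change (regular_rep k x (fvec (fibre x) s v) c = fvec (fibre x) S z c).
  have [cx|cx] := pselect (fibre x c); last by rewrite !l2_out.
  rewrite (regular_rep_fvec EG v ck cx sx) (fvecE z c Sx) -/(z c); case: ifPn => // cS.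
  by apply/eqP; apply: contraNT cS; exact: zS.
have E2 : fvec (fibre x) s v - t%:C%C *: fvec (fibre x) S z =
    fvec (fibre x) S (fun c => v0 c - t%:C%C * z c).
  apply: val_inj; apply/funext => c.
  change (fvec (fibre x) s v c - t%:C%C * fvec (fibre x) S z c =
    fvec (fibre x) S (fun c => v0 c - t%:C%C * z c) c).
  rewrite !fvecE// /v0; case: ifPn => [cs|cs].
    by have -> : c \in S by rewrite mem_undup mem_cat cs.
  by case: ifPn => // _; rewrite mulr0 subr0.
rewrite E1 E2 !l2norm_fvec//.
have qE : qform k s v = \sum_(c <- S) z c * (v0 c)^*.
  have -> : qform k s v = \sum_(c <- s) z c * (v0 c)^*.
    apply: eq_big_seq => a asx; rewrite /z /v0 asx mulr_suml.
    by apply: eq_bigr => b _; rewrite mulrA.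
  apply: big_support; [exact: sx.1|exact: Sx.1| |].
    by move=> a asx; rewrite mem_undup mem_cat asx.
  by move=> a _ /negPf as0; rewrite /v0 as0 conjC0 mulr0.
have vE : energy s v = energy S v0.
  transitivity (energy s v0); first by apply: eq_big_seq => a; rewrite /v0 => ->.
  apply: big_support; [exact: sx.1|exact: Sx.1| |].
    by move=> a asx; rewrite mem_undup mem_cat asx.
  by move=> a _ /negPf as0; rewrite /v0 as0 Normc.normc0 expr0n.
rewrite vE qE raddf_sum /energy !mulr_sumr -sumrB -big_split /=; apply: eq_bigr => c _.
have nE (w : R[i]) : normc w ^+ 2 = complex.Re w ^+ 2 + complex.Im w ^+ 2.
  by case: w => p q; rewrite /= sqr_sqrtr// addr_ge0 ?sqr_ge0.
rewrite !nE; case: (v0 c) => p q; case: (z c) => p' q' /=.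
rewrite !mul0r !subr0 !addr0; ring.
Qed.

Lemma invertible_modulo_of_bounded T (C : R) : schur_amenable R (boundary X) ->
  Cred R G T -> (forall w, ~ X w -> exists2 B, inverse_of (T w) B & opnorm B <= C) ->
  invertible_modulo (Cred R G) (Cred_reduction R X) T.
Proof.
move=> am hT; wlog C1 : C / 1 <= C => [H hC|TC].
  apply: (H (Num.max 1 C)) => [|w /hC[B TB BC]]; first by rewrite le_max lexx.
  by exists B => //; rewrite le_max BC orbT.
have C0 : 0 < C by lra.
(* On the boundary [T] is invertible, so a left inverse is the inverse there; both defects vanish on
   the boundary and [exact_vanish] puts them in the ideal. *)
suff [S hS ST] : exists2 S, Cred R G S & forall w, ~ X w -> S w * T w = 1.
  have TS w : ~ X w -> T w * S w = 1.
    move=> Xw; have [B [TB BT] _] := TC w Xw.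
    by have -> : S w = B by rewrite -[S w]mulr1 -TB mulrA ST// mul1r.
  have h1 : Cred R G (fun x => T x * S x - 1).
    exact: (CredB HG EG (CredM HG EG CG hT hS) (Cred1 (R := R) HG EG CG)).
  have h2 : Cred R G (fun x => S x * T x - 1).
    exact: (CredB HG EG (CredM HG EG CG hS hT) (Cred1 (R := R) HG EG CG)).
  exists S; first exact: hS.
  split; [apply: (exact_vanish am h1)|apply: (exact_vanish am h2)] => w Xw.
    by rewrite TS// subrr.
  by rewrite ST// subrr.
(* An element over [X] brings A T within 7/16 < 1/2 of 1 at all units, where the Neumann series
   applies; that element is invisible on the boundary. *)
suff [A hA AT] : exists2 A, Cred R G A & forall w, ~ X w -> opnorm (A w * T w - 1) <= 1 / 16.
  have hD : Cred R G (fun x => A x * T x - 1).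
    by exact: (CredB HG EG (CredM HG EG CG hA hT) (Cred1 (R := R) HG EG CG)).
  have e16 : 0 < 1 / 16 :> R by lra.
  have [f [_ cf Df]] := exact_Cred am hD e16 AT.
  have hW : Cred R G (fun x => A x * T x - regular_rep (valL_ 0 f) x).
    exact: (CredB HG EG (CredM HG EG CG hA hT) (Cred_regular_rep cf)).
  have [|S hS SW] := Cred_left_inverse HG EG CG hW.
    move=> x; rewrite (_ : 1 - _ = - (A x * T x - 1 - regular_rep (valL_ 0 f) x)).
      by rewrite opnormN; apply: le_trans (Df x) _; lra.
    by rewrite !opprB [RHS]addrCA.
  exists (fun x => S x * A x) => [|w Xw]; first exact: (CredM HG EG CG hS hA).
  by have := SW w; rewrite reduction_rep_vanish// subr0 mulrA.
(* [d * C = 1 / 64] keeps [f] bounded below on the boundary, with constant [2 * C], and makes the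
   final replacement of [f] by [T] harmless. *)
pose d : R := (64 * C)^-1.
have d0 : 0 < d by rewrite invr_gt0 mulr_gt0.
have dC : d * C = 1 / 64 by rewrite /d; field; rewrite gt_eqF.
have [f cf Tf] := hT d d0.
have csf : Cc (star f) by exact: star_Cc.
have [M0 M00 sfM0] := regular_rep_bounded HG EG CG csf.
pose M := M0 + 1; have M1 : 1 <= M by rewrite lerDr.
have sfM x : opnorm (regular_rep (star f) x) <= M.
  by apply: le_trans (sfM0 x) _; rewrite lerDl.
have Mp : 0 < M by lra.
(* With K = f* f one has |K v| <= M |f v|, so |v - t K v|^2 <= |v|^2 - t |f v|^2 <= (1 - t / (4
   C^2)) |v|^2 on the boundary. [M >= 1] gives [t <= 1] and a nonnegative [q2]. *)
pose t : R := (M ^+ 2)^-1; have t0 : 0 < t by rewrite invr_gt0 exprn_gt0.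
have tM : t ^+ 2 * M ^+ 2 = t by rewrite /t; field; rewrite gt_eqF.
pose p a := t%:C%C * star f a.
have cp : Cc p by exact: CcZ.
have hE : Cred R G (fun x => 1 - regular_rep p x * regular_rep f x).
  exact: (CredB HG EG (Cred1 (R := R) HG EG CG) (CredM HG EG CG (Cred_regular_rep cp) (Cred_regular_rep cf))).
pose E x : bop R (fibre x) := 1 - regular_rep p x * regular_rep f x.
pose q2 : R := 1 - t / (4 * C ^+ 2).
have C2 : 0 < C ^+ 2 by rewrite exprn_gt0.
have q21 : q2 < 1 by rewrite gtrBl divr_gt0// mulr_gt0.
have q20 : 0 <= q2.
  rewrite subr_ge0 ler_pdivrMr ?mulr_gt0// mul1r.
  have C21 : 1 <= C ^+ 2 by rewrite exprn_ege1.
  have t1 : t <= 1 by rewrite /t invf_le1 ?exprn_gt0// exprn_ege1.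
  lra.
have [q q0 qE] : exists2 q, 0 <= q & q ^+ 2 = q2.
  by exists (Num.sqrt q2); [exact: sqrtr_ge0|exact: sqr_sqrtr].
have q1 : q < 1 by rewrite -(@ltr_pXn2r _ 2)// ?nnegrE// qE expr1n.
have Ew w : ~ X w -> opnorm (E w) <= q.
  move=> Xw; apply: (opnorm_le q0); apply: (bop_bound_dense q0) => s v sx.
  have cg : Cc (gram f) by exact: gram_Cc.
  set xi := fvec (fibre w) s v.
  have -> : E w xi = xi - t%:C%C *: regular_rep (gram f) w xi.
    rewrite (_ : E w xi = xi - regular_rep p w (regular_rep f w xi))//.
    by rewrite regular_repZ// [gram f]/(gconv (star f) f) regular_rep_gconv.
  have e1 := l2norm_sub_rep v t cg sx; rewrite -/xi in e1.
  rewrite -(rep_sqE HG EG v cf sx) /= in e1.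
  have e2 : l2norm (regular_rep (gram f) w xi) <= M * l2norm (regular_rep f w xi).
    rewrite [gram f]/(gconv (star f) f) regular_rep_gconv//.
    apply: le_trans (le_opnorm (regular_rep (star f) w) _) _.
    by rewrite ler_wpM2r ?l2norm_ge0.
  have e3 : l2norm xi <= 2 * C * l2norm (regular_rep f w xi).
    have [B TB BC] := TC w Xw.
    have h1 : l2norm xi <= C * l2norm (T w xi).
      apply: le_trans (inverse_bounded_below xi TB) _.
      by rewrite ler_wpM2r ?l2norm_ge0.
    have h2 : l2norm (T w xi) <= l2norm (regular_rep f w xi) + d * l2norm xi.
      have -> : T w xi = regular_rep f w xi + (T w - regular_rep f w) xi.
        rewrite (_ : (T w - regular_rep f w) xi = T w xi - regular_rep f w xi)//.
        by rewrite addrC subrK.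
      apply: le_trans (l2normD _ _) _; rewrite lerD2l.
      by apply: le_trans (le_opnorm _ xi) _; rewrite ler_wpM2r ?l2norm_ge0.
    have := ler_wpM2l (ltW C0) h2; rewrite mulrDr mulrA [C * d]mulrC dC.
    have := l2norm_ge0 xi; have := l2norm_ge0 (regular_rep f w xi); lra.
  move: e1 e2 e3; rewrite /rep_sq -(l2norm_fvec v sx) -/xi.
  have := l2norm_ge0 (xi - t%:C%C *: regular_rep (gram f) w xi).
  have := l2norm_ge0 (regular_rep (gram f) w xi); have := l2norm_ge0 (regular_rep f w xi).
  have := l2norm_ge0 xi.
  move: (l2norm (xi - _)) (l2norm (regular_rep (gram f) w xi)).
  move: (l2norm (regular_rep f w xi)) (l2norm xi) => r n u z n0 r0 z0 u0 e1 e2 e3.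
  rewrite -(@ler_pXn2r _ 2)// ?nnegrE ?mulr_ge0// exprMn qE e1 /q2.
  have e2' : t ^+ 2 * z ^+ 2 <= t * r ^+ 2.
    rewrite -[X in _ <= X * _]tM -[leRHS]mulrA ler_pM2l ?exprn_gt0// -exprMn.
    by rewrite ler_pXn2r ?nnegrE// mulr_ge0// ltW.
  have e3' : t / (4 * C ^+ 2) * n ^+ 2 <= t * r ^+ 2.
    rewrite -mulrA ler_pM2l// mulrC ler_pdivrMr ?mulr_gt0//.
    have -> : r ^+ 2 * (4 * C ^+ 2) = (2 * C * r) ^+ 2 by ring.
    by rewrite ler_pXn2r ?nnegrE// !mulr_ge0// ltW.
  lra.
have [n qn] : exists n, q ^+ n <= 1 / 32.
  have : (fun n => q ^+ n) @ \oo --> 0 by apply: cvg_expr; rewrite ger0_norm.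
  have e32 : 0 < 1 / 32 :> R by lra.
  move=> /cvgrPdist_lt/(_ _ e32)[n _ hn]; exists n; have := hn n (leqnn n).
  by rewrite /= sub0r normrN ger0_norm ?exprn_ge0// => /ltW.
have hEn i : Cred R G (fun x => E x ^+ i) by exact: (CredX HG EG CG i hE).
(* A truncated geometric series in E = 1 - t f* f, multiplied by t f*; then A f telescopes to 1 -
   E^n. *)
pose A x := (\sum_(i < n) E x ^+ i) * regular_rep p x.
have hA : Cred R G A.
  exact: (CredM HG EG CG (Cred_sum HG EG CG n hEn) (Cred_regular_rep cp)).
exists A; first exact: hA.
move=> w Xw.
have Af : A w * regular_rep f w = 1 - E w ^+ n.
  rewrite /A -mulrA (_ : regular_rep p w * regular_rep f w = 1 - E w); last first.
    by rewrite /E opprB addrC subrK.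
  elim: (n) => [|k IH]; first by rewrite big_ord0 mul0r expr0 subrr.
  by rewrite big_ord_recr /= mulrDl IH exprSr mulrBr mulr1 addrA subrK.
have [B [TB BT] BC] := TC w Xw.
have En : opnorm (E w ^+ n) <= 1 / 32.
  apply: le_trans (opnormX _ _) _; apply: le_trans qn.
  by apply: lerXn2r; rewrite ?nnegrE ?opnorm_ge0 ?Ew.
have AT : A w * T w - 1 = A w * (T w - regular_rep f w) - E w ^+ n.
  by rewrite mulrBr Af opprB addrAC addrA subrK.
have h1 : opnorm (A w * T w - 1) <= opnorm (A w) * d + 1 / 32.
  rewrite AT; apply: le_trans (opnormD _ _) _; rewrite opnormN lerD//.
  by apply: le_trans (opnormM _ _) _; rewrite ler_wpM2l ?opnorm_ge0.
(* The norm of A is bounded through A = (A T) B, since its series depends on [f]. With z the norm of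
   A T - 1, this gives z <= (1 + z) / 64 + 1 / 32, hence z <= 1 / 21. *)
have h2 : opnorm (A w) <= (1 + opnorm (A w * T w - 1)) * C.
  apply: (@le_trans _ _ (opnorm (A w * T w * B))); first by rewrite -mulrA TB mulr1.
  apply: le_trans (opnormM _ _) _; apply: ler_pM; rewrite ?opnorm_ge0//.
  have h := opnormD (A w * T w - 1) 1; rewrite subrK in h.
  by apply: le_trans h _; rewrite addrC lerD2r opnorm1_le.
move: h1 h2; move: (opnorm (A w)) (opnorm (A w * T w - 1)) => u z h1 h2.
have h3 := ler_wpM2r (ltW d0) h2; rewrite -mulrA [C * d]mulrC dC in h3.
lra.
Qed.

End Inversion.

(** An averaging argument: some piece has a quotient no worse than the global one, and positive
    energy. *)
Lemma sum_ratio (R : realType) (I : eqType) (t : seq I) (x y : I -> R) (C : R) :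
  (forall i, 0 <= x i) -> (forall i, 0 <= y i) ->
  \sum_(i <- t) x i <= C * \sum_(i <- t) y i -> 0 < \sum_(i <- t) y i ->
  exists i, [/\ i \in t, 0 < y i & x i <= C * y i].
Proof.
move=> x0 y0; elim: t => [|i t IH]; first by rewrite !big_nil ltxx.
rewrite !big_cons mulrDr => h1 h2.
have sx : 0 <= \sum_(j <- t) x j by exact: sumr_ge0.
have sy : 0 <= \sum_(j <- t) y j by exact: sumr_ge0.
have [xi|xi] := leP (x i) (C * y i); last first.
  have hx : \sum_(j <- t) x j <= C * \sum_(j <- t) y j by lra.
  have hy : 0 < \sum_(j <- t) y j.
    rewrite lt_def sy andbT; apply/eqP => s0; rewrite s0 mulr0 addr0 in h1; lra.
  by have [j [jt yj xj]] := IH hx hy; exists j; rewrite inE jt orbT.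
have [yi|yi] := ltP 0 (y i); first by exists i; rewrite inE eqxx.
have yi0 : y i = 0 by apply/eqP; rewrite eq_le yi y0.
rewrite yi0 mulr0 add0r in h1; rewrite yi0 add0r in h2.
have hx : \sum_(j <- t) x j <= C * \sum_(j <- t) y j by have := x0 i; lra.
by have [j [jt yj xj]] := IH hx h2; exists j; rewrite inE jt orbT.
Qed.

Lemma bop_sq_compare (R : realType) (T : choiceType) (D : set T) (A B : bop R D) (e : R) xi :
  0 <= e -> opnorm (A - B) <= e ->
  l2norm (A xi) ^+ 2 <= 2 * l2norm (B xi) ^+ 2 + 2 * e ^+ 2 * l2norm xi ^+ 2.
Proof.
move=> e0 AB; have : l2norm (A xi) <= l2norm (B xi) + e * l2norm xi.
  have -> : A xi = B xi + (A - B) xi.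
    by rewrite (_ : (A - B) xi = A xi - B xi)// addrC subrK.
  apply: le_trans (l2normD _ _) _; rewrite lerD2l.
  by apply: le_trans (le_opnorm _ xi) _; rewrite ler_wpM2r ?l2norm_ge0.
have := l2norm_ge0 (A xi); have := l2norm_ge0 (B xi); have := l2norm_ge0 xi.
move: (l2norm (A xi)) (l2norm (B xi)) (l2norm xi) => a b c c0 b0 a0 h.
have ec : 0 <= e * c by exact: mulr_ge0.
apply: (@le_trans _ _ ((b + e * c) ^+ 2)); first by rewrite ler_pXn2r ?nnegrE ?addr_ge0.
have := sqr_ge0 (b - e * c); nra.
Qed.

(** * Uniform lower bounds on the boundary *)

Section UniformLowerBound.
Variables (R : realType) (G : topGroupoid) (X : set (gobj G)).
Hypothesis HG : hausdorff_space G.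
Hypothesis EG : etale G.
Hypothesis CG : compact [set: gobj G].
Hypothesis IX : invariant_units X.
Hypothesis OX : open X.
Implicit Types (a b c : G) (x y : gobj G) (f g : G -> R[i]) (s : seq G).
Implicit Types (S T : opfield R G) (v : G -> R[i]).

Definition op_sq T x s v : R := l2norm (T x (fvec (fibre x) s v)) ^+ 2.

Lemma op_sq_compare T f (e : R) x s v : 0 <= e -> in_dom (fibre x) s ->
  opnorm (T x - regular_rep f x) <= e ->
  op_sq T x s v <= 2 * rep_sq f x s v + 2 * e ^+ 2 * energy s v /\
  rep_sq f x s v <= 2 * op_sq T x s v + 2 * e ^+ 2 * energy s v.
Proof.
move=> e0 sx Tf; rewrite -(l2norm_fvec v sx); split; apply: bop_sq_compare => //.
by rewrite opnormB.
Qed.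

(** The factor 8 is three factors 2: from [T] to [f], from the energies of the pieces, at least half
    the total, and from [f] back to [T]. The inclusion of [s'] in [s] is what allows iteration. *)
Lemma localize T (e : R) : schur_amenable R (boundary X) -> Cred R G T -> 0 < e ->
  exists2 L : set G, compact L & forall w s v (rho : R), ~ X w -> in_dom (fibre w) s ->
    0 < energy s v -> op_sq T w s v <= rho * energy s v ->
    exists s' v', [/\ in_dom (fibre w) s', {subset s' <= s}, 0 < energy s' v',
      forall a b, a \in s' -> b \in s' -> L (gmul a (ginv b)) &
      op_sq T w s' v' <= (8 * rho + e) * energy s' v'].
Proof.
(* The accumulated errors are 2 * (4 rho + 6 d^2) + 2 d^2 = 8 rho + 14 d^2; [d <= 1] gives
   [d ^+ 2 <= d <= e / 14]. *)
move=> am hT e0; pose d : R := Num.min 1 (e / 14).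
have d0 : 0 < d by rewrite lt_min ltr01 divr_gt0.
have d1 : d <= 1 by rewrite ge_min lexx.
have d14 : d ^+ 2 <= e / 14.
  by apply: le_trans (_ : d <= _); [rewrite expr2 ler_piMl// ltW|rewrite ge_min lexx orbT].
have [f cf Tf] := hT d d0.
have [N gN] := Ibound_ex HG EG CG (gram_Cc HG EG cf); have [N0 _ _] := gN.
pose K := supp (gram f) `|` @units G.
have cK : compact K.
  by apply: compactU; [exact: supp_compact (gram_Cc HG EG cf)|exact: units_compact].
pose e1 : R := Num.min (1 / 2) (d ^+ 2 / (N + 1)).
have N1 : 0 < N + 1 by rewrite ltr_wpDl.
have e10 : 0 < e1 by rewrite lt_min; apply/andP; split; [lra|rewrite divr_gt0// exprn_gt0].
have e12 : e1 <= 1 / 2 by rewrite ge_min lexx.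
have e1N : e1 * N <= d ^+ 2.
  apply: le_trans (_ : e1 * (N + 1) <= _); first by rewrite ler_wpM2l ?(ltW e10)// lerDl.
  by rewrite -ler_pdivlMr// ge_min lexx orbT.
have [xi cxi xiP] := am K e1 cK e10.
exists (quot_set (supp xi)); first exact: (quot_set_compact HG (supp_compact cxi)).
move=> w s v rho Xw sx E0 hT0.
have hab a b : a \in s -> b \in s -> gram f (gmul a (ginv b)) != 0 ->
    normc (1 - gram xi (gmul a (ginv b))) <= e1.
  move=> asx bs gab; apply: xiP; first by left; exact: in_supp.
  apply/(boundaryE IX); have ax := sx.2 a asx; have bx := sx.2 b bs.
  by rewrite gsrc_div ?ax ?bx// => /(invariantE IX); rewrite bx.
have haa a : a \in s -> normc (1 - gram xi (gmul a (ginv a))) <= e1.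
  move=> asx; apply: xiP; first by right; exists (grng a) => //; rewrite gmulV.
  apply/(boundaryE IX); have ax := sx.2 a asx.
  by rewrite gsrc_div// => /(invariantE IX); rewrite ax.
have [t tx [h1 h2]] := pieces_norm HG EG v cf cxi gN (ltW e10) sx hab haa.
have [_ h3] := op_sq_compare v (ltW d0) sx (Tf w).
move: h1 h2; rewrite !ler_norml => /andP[_ h1] /andP[h2 _].
have q1 : e1 * N * energy s v <= d ^+ 2 * energy s v by rewrite ler_wpM2r// ltW.
have q2 : e1 * energy s v <= 1 / 2 * energy s v by rewrite ler_wpM2r// ltW.
have q3 : energy s v <= 2 * \sum_(c <- t) energy s (piece xi c v) by lra.
have rho0 : 0 <= rho.
  by rewrite -(pmulr_lge0 _ E0); apply: le_trans hT0; exact: sqr_ge0.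
have q4 : \sum_(c <- t) rep_sq f w s (piece xi c v) <= (2 * rho + 3 * d ^+ 2) * energy s v.
  by move: h1 h3 q1 hT0; rewrite mulrDl -!mulrA; lra.
have q5 : \sum_(c <- t) rep_sq f w s (piece xi c v) <=
    (4 * rho + 6 * d ^+ 2) * \sum_(c <- t) energy s (piece xi c v).
  apply: le_trans q4 _.
  apply: (@le_trans _ _ ((2 * rho + 3 * d ^+ 2) * (2 * \sum_(c <- t) energy s (piece xi c v)))).
    by rewrite ler_wpM2l// addr_ge0// mulr_ge0// ?sqr_ge0.
  by rewrite mulrA mulrDl; rewrite le_eqVlt; apply/orP; left; apply/eqP; ring.
have q6 : 0 < \sum_(c <- t) energy s (piece xi c v) by lra.
have [c [ct ec hc]] := sum_ratio (fun c => rep_sq_ge0 f w s (piece xi c v))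
  (fun c => energy_ge0 s (piece xi c v)) q5 q6.
have s'x := in_dom_filter (fun a => piece xi c v a != 0) sx.
exists [seq a <- s | piece xi c v a != 0], (piece xi c v); split => //.
- by move=> a; rewrite mem_filter => /andP[].
- by rewrite -energy_filter.
- move=> a b; rewrite !mem_filter => /andP[pa asx] /andP[pb bs].
  apply: (piece_support (tx.2 c ct) (sx.2 a asx) (sx.2 b bs)).
    by apply: contra_neq pa; rewrite /piece => ->; rewrite mul0r.
  by apply: contra_neq pb; rewrite /piece => ->; rewrite mul0r.
have [h4 _] := op_sq_compare (piece xi c v) (ltW d0) s'x (Tf w).
apply: le_trans h4 _; rewrite -rep_sq_filter -energy_filter.
move: hc; move: (rep_sq f w s (piece xi c v)) (energy s (piece xi c v)) ec => u1 u2 u20 hc.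
have q7 : d ^+ 2 * u2 <= e / 14 * u2 by rewrite ler_wpM2r// ltW.
move: hc; rewrite !mulrDl -!mulrA; lra.
Qed.

(* Localizing repeatedly inside the piece found at the previous, coarser scale
   yields almost minimal vectors at all the scales [L j] around one point [c]. *)
Lemma nested_localize T (L : nat -> set G) (r e : nat -> R) :
  (forall n w s v (rho : R), ~ X w -> in_dom (fibre w) s ->
    0 < energy s v -> op_sq T w s v <= rho * energy s v ->
    exists s' v', [/\ in_dom (fibre w) s', {subset s' <= s}, 0 < energy s' v',
      forall a b, a \in s' -> b \in s' -> L n (gmul a (ginv b)) &
      op_sq T w s' v' <= (8 * rho + e n) * energy s' v']) ->
  (forall n, 8 * r n.+1 + e n <= r n) ->
  forall n w s v, ~ X w -> in_dom (fibre w) s -> 0 < energy s v ->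
    op_sq T w s v <= r n * energy s v ->
    exists2 c, c \in s & forall j, (j < n)%N -> exists s' v',
      [/\ in_dom (fibre w) s', 0 < energy s' v',
        forall a, a \in s' -> L j (gmul a (ginv c)) &
        op_sq T w s' v' <= r j * energy s' v'].
Proof.
move=> hL hr; elim=> [|n IH] w s v Xw sx E0 hT.
  case: s sx E0 hT => [|c s] _; first by rewrite /energy big_nil ltxx.
  by exists c => //; rewrite inE eqxx.
have [s1 [v1 [s1x s1s E1 L1 T1]]] := hL n w s v _ Xw sx E0 hT.
have T1' : op_sq T w s1 v1 <= r n * energy s1 v1.
  by apply: le_trans T1 _; rewrite ler_wpM2r// ltW.
have [c cs1 hc] := IH w s1 v1 Xw s1x E1 T1'.
exists c => [|j]; first exact: s1s.
rewrite ltnS leq_eqVlt => /orP[/eqP ->|/hc//].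
(* The centre [c] found deeper inside belongs to [s1], so it is a centre for [s1] too. *)
by exists s1, v1; split => // a as1; exact: L1.
Qed.

(** The inverse at [y] chooses [j]; only then does [L j] determine the neighbourhood, through
    [near_transport]. *)
Lemma near_lower_bound T (L : nat -> set G) (r : nat -> R) y B :
  Cred R G T -> (forall n, compact (L n)) -> r @ \oo --> 0 -> inverse_of (T y) B ->
  exists j, \forall y' \near y, forall c, grng c = y' -> forall s v,
    in_dom (fibre (gsrc c)) s -> 0 < energy s v ->
    (forall a, a \in s -> L j (gmul a (ginv c))) ->
    r j * energy s v < op_sq T (gsrc c) s v.
Proof.
move=> hT cL r0 TB; pose b := opnorm B + 1.
have b1 : 1 <= b by rewrite lerDr opnorm_ge0.
have b0 : 0 < b ^+ 2 by rewrite exprn_gt0//; lra.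
have b21 : 1 <= b ^+ 2 by exact: exprn_ege1.
(* [k] bounds |T v|^2 / |v|^2 from below at [y]. Transport would give at most 4 r_j + 6 d^2 + k / 8
   < k / 4 + k / 8 + k / 8 = k / 2. *)
pose k : R := (b ^+ 2)^-1; have k0 : 0 < k by rewrite invr_gt0.
have k1 : k <= 1 by rewrite invf_le1.
have [j _ hj] : \forall j \near \oo, r j < k / 16.
  have k16 : 0 < k / 16 by rewrite divr_gt0.
  have /cvgrPdist_lt/(_ _ k16) := r0; apply: filterS => j.
  by rewrite sub0r normrN => /(le_lt_trans (ler_norm _)).
exists j; have {}hj := hj j (leqnn j).
have [d d0 d2] : exists2 d, 0 < d & d ^+ 2 <= k / 48.
  have k48 : 0 < k / 48 by rewrite divr_gt0.
  exists (k / 48) => //; rewrite expr2 ler_piMl ?(ltW k48)//; lra.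
have [f cf Tf] := hT d d0.
have k16 : 0 < k / 16 by rewrite divr_gt0.
have := near_transport HG EG y cf (cL j) k16; apply: filterS => y' h c cy s v sx E0 sL.
rewrite ltNge; apply/negP => hr.
have [s' [v' [s'y E' ]]] := h c cy s v sx sL.
rewrite ler_norml => /andP[h1 _].
have [_ h2] := op_sq_compare v (ltW d0) sx (Tf (gsrc c)).
have [h3 _] := op_sq_compare v' (ltW d0) s'y (Tf y); rewrite E' in h3.
have h4 : k * energy s v <= op_sq T y s' v'.
  rewrite -E' -(l2norm_fvec v' s'y) /k mulrC ler_pdivrMr// mulrC /op_sq -exprMn.
  have hB := inverse_bounded_below (fvec (fibre y) s' v') TB.
  rewrite ler_pXn2r ?nnegrE ?mulr_ge0 ?l2norm_ge0//; last by lra.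
  apply: le_trans hB _; rewrite ler_wpM2r ?l2norm_ge0//.
  by rewrite lerDl.
move: h1 h2 h3 h4 hr.
move: (op_sq T y s' v') (rep_sq f y s' v') (rep_sq f (gsrc c) s v).
move: (op_sq T (gsrc c) s v) (energy s v) E0 => u1 u2 u20 u3 u4 u5 h1 h2 h3 h4 hr.
have q1 : d ^+ 2 * u2 <= k / 48 * u2 by rewrite ler_wpM2r// ltW.
have q2 : r j * u2 < k / 16 * u2 by rewrite ltr_pM2r.
have q3 : 0 < k * u2 by rewrite mulr_gt0.
lra.
Qed.

Lemma bounded_inverses T : schur_amenable R (boundary X) -> Cred R G T ->
  (forall w, ~ X w -> invertible (T w)) ->
  exists C : R, forall w, ~ X w -> exists2 B, inverse_of (T w) B & opnorm B <= C.
Proof.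
move=> am hT Tinv.
(* r n = 16^-n makes 8 r (n + 1) + r n / 2 equal to r n; [k n] is its square root, since the final
   bound is on norms. *)
pose k n : R := (1 / 4) ^+ n; pose r n : R := k n ^+ 2.
have k0 n : 0 < k n by rewrite exprn_gt0//; lra.
have r0 n : 0 < r n by rewrite exprn_gt0.
have kc : k @ \oo --> 0 by apply: cvg_expr; rewrite ger0_norm; lra.
have rc : r @ \oo --> 0.
  rewrite -[0](mulr0 0) (_ : r = fun n => k n * k n); first exact: cvgM.
  by apply/funext => n; rewrite /r expr2.
have rS n : r n.+1 = r n / 16 by rewrite /r (_ : k n.+1 = 1 / 4 * k n); [field|rewrite /k exprS].
have /choice[L hL] : forall n, exists L : set G, compact L /\
  forall w s v (rho : R), ~ X w -> in_dom (fibre w) s ->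
    0 < energy s v -> op_sq T w s v <= rho * energy s v ->
    exists s' v', [/\ in_dom (fibre w) s', {subset s' <= s}, 0 < energy s' v',
      forall a b, a \in s' -> b \in s' -> L (gmul a (ginv b)) &
      op_sq T w s' v' <= (8 * rho + r n / 2) * energy s' v'].
  move=> n; have rn : 0 < r n / 2 by rewrite divr_gt0.
  by have [L cL LP] := localize am hT rn; exists L.
have rr n : 8 * r n.+1 + r n / 2 <= r n by rewrite rS; lra.
(* [P] grows with [n], which turns a finite choice of scales into a single bound [N]. *)
pose P (n : nat) y' := exists2 j, (j <= n)%N & forall c, grng c = y' -> forall s v,
    in_dom (fibre (gsrc c)) s -> 0 < energy s v ->
    (forall a, a \in s -> L j (gmul a (ginv c))) ->
    r j * energy s v < op_sq T (gsrc c) s v.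
have cX : compact (~` X) by apply: (subclosed_compact (boundary_closed OX) CG).
have [N _ hN] : \forall n \near \oo, ~` X `<=` P n.
  move: cX => /compact_near_coveringP; apply => y Xy.
  have [B TB] := Tinv y Xy.
  have [j hj] := near_lower_bound hT (fun n => (hL n).1) rc TB.
  exists ([set y' | forall c, grng c = y' -> forall s v,
    in_dom (fibre (gsrc c)) s -> 0 < energy s v ->
    (forall a, a \in s -> L j (gmul a (ginv c))) ->
    r j * energy s v < op_sq T (gsrc c) s v], [set n | (j <= n)%N]).
    by split => //; exists j.
  by move=> [y' n] [/= h jn]; exists j.
have {}hN := hN N (leqnn N).
have low w s v : ~ X w -> in_dom (fibre w) s -> 0 < energy s v ->
    r N.+1 * energy s v < op_sq T w s v.
  move=> Xw sx E0; rewrite ltNge; apply/negP => h.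
  (* Starting at level [N.+1] produces vectors at every scale j <= N around [c]; one of these scales
     is forbidden at the boundary unit [grng c]. *)
  have [c cs hc] := nested_localize (fun n => (hL n).2) rr Xw sx E0 h.
  have cw := sx.2 c cs.
  have Xc : ~ X (grng c) by move=> /(invariantE IX); rewrite cw.
  have [j jN hj] := hN _ Xc.
  have [s' [v' [s'x E' L' T']]] := hc j jN.
  have := hj c erefl s' v'; rewrite cw => /(_ s'x E' L'); lra.
exists (k N.+1)^-1 => w Xw; have [B TB] := Tinv w Xw; exists B => //.
have lowT xi : k N.+1 * l2norm xi <= l2norm (T w xi).
  apply: (bop_bounded_below_dense (ltW (k0 _))) => s v sx.
  rewrite -(@ler_pXn2r _ 2)// ?nnegrE ?mulr_ge0 ?l2norm_ge0 ?(ltW (k0 _))//.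
  rewrite [leLHS]exprMn (l2norm_fvec v sx).
  have [E0|E0] := ltP 0 (energy s v); first by apply/ltW; exact: low.
  have -> : energy s v = 0 by apply/eqP; rewrite eq_le E0 energy_ge0.
  by rewrite mulr0 sqr_ge0.
apply: opnorm_le => [|xi]; first by rewrite invr_ge0 ltW.
rewrite mulrC ler_pdivlMr// mulrC; apply: le_trans (lowT _) _.
by have [TB1 _] := TB; rewrite (_ : T w (B xi) = (T w * B) xi)// TB1.
Qed.

End UniformLowerBound.

(** * From topological amenability to Schur multipliers *)

Section AtomicSums.
Context {d : measure_display} {T : measurableType d} {R : realType} {I : eqType}.
Variables (mu : {finite_measure set T -> \bar R}) (pi : T -> I).
Hypothesis mpi : forall i, measurable (pi @^-1` [set i]).
Implicit Types (s : seq I) (phi : I -> R).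

Lemma finite_measure_fineK (A : set T) : measurable A -> (fine (mu A))%:E = mu A.
Proof. by move=> mA; rewrite fineK// fin_num_measure. Qed.

Lemma atomic_sumE s phi t : uniq s ->
  (\sum_(i <- s) (phi i)%:E * (\1_(pi @^-1` [set i]) t)%:E)%E =
  (if pi t \in s then phi (pi t) else 0)%:E.
Proof.
move=> us; have E i : ((phi i)%:E * (\1_(pi @^-1` [set i]) t)%:E)%E =
    (if i == pi t then phi (pi t) else 0)%:E.
  rewrite indicE; have [->|it] := eqVneq i (pi t).
    by rewrite mem_set// mule1.
  by rewrite memNset ?mule0// => /esym/eqP; rewrite (negPf it).
rewrite (eq_bigr _ (fun i _ => E i)) sumEFin; congr (_%:E).
case: ifPn => [ts|ts].
  rewrite (bigD1_seq (pi t))//= eqxx big1 ?addr0// => i /negPf -> //.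
rewrite big_seq big1// => i si; case: eqP => // ie.
by rewrite -ie si in ts.
Qed.

Lemma integral_atomic_sum s phi : (forall i, 0 <= phi i) ->
  (\int[mu]_t (\sum_(i <- s) (phi i)%:E * (\1_(pi @^-1` [set i]) t)%:E) =
  (\sum_(i <- s) phi i * fine (mu (pi @^-1` [set i])))%:E)%E.
Proof.
move=> phi0; rewrite ge0_integral_sum//; last 2 first.
- move=> i; apply: emeasurable_funM; first exact: measurable_cst.
  by apply/measurable_EFinP; exact: measurable_indic.
- by move=> i t _; rewrite mule_ge0 ?lee_fin.
rewrite -sumEFin; apply: eq_bigr => i _.
rewrite ge0_integralZl_EFin//; last by apply/measurable_EFinP; exact: measurable_indic.
by rewrite integral_indic// setIT EFinM finite_measure_fineK.
Qed.

Lemma measurable_atomic_sum s phi : measurable_fun [set: T]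
  (fun t => (\sum_(i <- s) (phi i)%:E * (\1_(pi @^-1` [set i]) t)%:E)%E).
Proof.
apply: emeasurable_sum => i; apply: emeasurable_funM; first exact: measurable_cst.
by apply/measurable_EFinP; exact: measurable_indic.
Qed.

Lemma atomic_sum_le_integral s phi : uniq s -> (forall i, 0 <= phi i) ->
  measurable_fun [set: T] (fun t => phi (pi t)) ->
  ((\sum_(i <- s) phi i * fine (mu (pi @^-1` [set i])))%:E <= \int[mu]_t (phi (pi t))%:E)%E.
Proof.
move=> us phi0 mphi; rewrite -integral_atomic_sum//; apply: ge0_le_integral => //.
- by move=> t _; rewrite atomic_sumE// lee_fin; case: ifP.
- exact: measurable_atomic_sum.
- exact/measurable_EFinP.
- by move=> t _; rewrite atomic_sumE// lee_fin; case: ifP.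
Qed.

(** Off a null set the integrand meets finitely many atoms. In the application [N] is the complement
    of the fibre and [pi] the inclusion of the reduction in [G]. *)
Lemma atomic_sum_eq_integral s phi (N : set T) : uniq s -> (forall i, 0 <= phi i) ->
  measurable_fun [set: T] (fun t => phi (pi t)) -> measurable N -> mu N = 0%E ->
  (forall t, ~ N t -> phi (pi t) != 0 -> pi t \in s) ->
  (\int[mu]_t (phi (pi t))%:E = (\sum_(i <- s) phi i * fine (mu (pi @^-1` [set i])))%:E)%E.
Proof.
move=> us phi0 mphi mN N0 h; rewrite -integral_atomic_sum//.
apply: ge0_ae_eq_integral => //.
- exact/measurable_EFinP.
- exact: measurable_atomic_sum.
- by move=> t _; rewrite lee_fin.
- by move=> t _; rewrite atomic_sumE// lee_fin; case: ifP.
exists N; split => // t /= nt; apply: contrapT => Nt; apply: nt => _.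
rewrite atomic_sumE//; case: ifPn => // ts; congr (_%:E); apply/eqP.
by apply: contraNT ts; exact: h.
Qed.

End AtomicSums.

Lemma continuous_borel_measurable (R : realType) (H : topGroupoid) (w : gobj H) (f : H -> R) :
  continuous f -> measurable_fun [set: borel w] (f : borel w -> R).
Proof.
move=> /continuousP cf; apply: (measurability _ (RGenOpens.measurableE R)).
move=> _ [_ [a [b ->]] <-]; rewrite setTI; apply: sub_sigma_algebra.
by apply: cf; exact: interval_open.
Qed.

Lemma closed_borel (H : topGroupoid) (w : gobj H) (A : set H) : closed A ->
  measurable (A : set (borel w)).
Proof.
move=> cA; rewrite -[A]setCK; apply: measurableC; apply: sub_sigma_algebra.
exact: closed_openC.
Qed.

Lemma compact_seq_bigcup (X : topologicalType) (I : eqType) (s : seq I) (K : I -> set X) :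
  (forall i, compact (K i)) -> compact [set x | exists2 i, i \in s & K i x].
Proof.
move=> cK; elim: s => [|i s IH].
  by rewrite (_ : mkset _ = set0); [exact: compact0|apply/seteqP; split => // x [j]].
rewrite (_ : mkset _ = K i `|` [set x | exists2 i, i \in s & K i x]).
  exact: compactU.
apply/seteqP; split => [x [j]|x [Kx|[j js Kx]]].
- by rewrite inE => /orP[/eqP ->|js] Kx; [left|right; exists j].
- by exists i => //; rewrite inE eqxx.
- by exists j => //; rewrite inE js orbT.
Qed.

(** * Densities of Radon measures on discrete fibres *)

Section FibreMeasures.
Variables (R : realType) (G : topGroupoid) (X : set (gobj G)).
Hypothesis HG : hausdorff_space G.
Hypothesis LG : locally_compact [set: G].
Hypothesis EG : etale G.
Hypothesis CG : compact [set: gobj G].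
Hypothesis IX : invariant_units X.
Hypothesis OX : open X.
Let Y := boundary X.
Let H := reduction Y.
Implicit Types (a b c : G) (w : gobj H) (phi psi chi : G -> R) (s : seq G).

Lemma redset_closed : closed (redset Y).
Proof.
by apply: closedI; apply: preimage_closed; try exact: (boundary_closed OX);
  move=> a _; [exact: grng_continuous|exact: gsrc_continuous].
Qed.

Lemma redset_boundary a w : gsrc a = val w -> redset Y a.
Proof. by move=> aw; apply/(boundaryE IX); rewrite aw; exact: (set_valP w). Qed.

Lemma gobj_reduction_compact : compact [set: gobj H].
Proof.
have cY : compact Y by apply: (subclosed_compact (boundary_closed OX) CG).
have := @compact_set_val (gobj G) Y Y cY (fun _ => id).
congr compact; apply/seteqP; split => // w _ /=; exact: set_valP.
Qed.

(** The explicit [w] fixes the measurable type [borel w], whose carrier does not depend on it. *)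
Definition arr w (b : borel w) : G := val (b : redset Y).

Lemma arr_continuous w phi : continuous phi ->
  continuous (fun b : H => phi (arr (b : borel w))).
Proof.
move=> cphi b; apply: (cvg_comp _ phi _ (cphi _)); exact: set_val_continuous.
Qed.

Lemma arr_measurable w phi : continuous phi ->
  measurable_fun [set: borel w] (fun b : borel w => phi (arr b)).
Proof.
by move=> cphi; apply: (@continuous_borel_measurable R H w); exact: arr_continuous.
Qed.

Lemma arr_closed w (A : set G) : closed A -> closed ((fun b : H => arr (b : borel w)) @^-1` A).
Proof.
by move=> cA; apply: preimage_closed => // b _; exact: set_val_continuous.
Qed.

Lemma arr_fibre_measurable w a : measurable (@arr w @^-1` [set a]).
Proof.
have ca : closed [set a] by exact/accessible_closed_set1/hausdorff_accessible.
exact: (@closed_borel H w _ (@arr_closed w _ ca)).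
Qed.

Lemma fibre_reductionE w (b : borel w) : fibre w b <-> gsrc (arr b) = val w.
Proof.
by split => [<-//|bw]; apply: val_inj.
Qed.

Lemma fibre_measurable w : measurable (~` fibre w : set (borel w)).
Proof.
apply: measurableC; apply: closed_borel.
rewrite (_ : fibre w = (fun b : H => arr (b : borel w)) @^-1` (fibre (val w))).
  by apply: arr_closed; exact: fibre_closed.
by apply/seteqP; split => b /= /fibre_reductionE.
Qed.

Variable mu : forall w : gobj H, {finite_measure set (borel w) -> \bar R}.
Hypothesis mu_radon : forall w, radon (mu w).
Hypothesis mu_mass : forall w, (mu w [set: borel w] <= 1)%E /\ mu w (~` fibre w) = 0%E.
Hypothesis mu_cont : forall f : H -> R[i], Cc f -> continuous (fun w => cintegral (mu w) f).

(** The density against counting measure of the measure at [gsrc a]. It is defined on all of [G],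
    with value 0 off the boundary, so that it can be multiplied by cutoffs of [G]. *)
Definition dens a : R :=
  if pselect (Y (gsrc a)) is left Ya then
    let w := exist (fun x => x \in Y) (gsrc a) (mem_set Ya) : gobj H in
    fine (mu w (@arr w @^-1` [set a]))
  else 0.

Lemma densE w a : gsrc a = val w -> dens a = fine (mu w (@arr w @^-1` [set a])).
Proof.
move=> aw; rewrite /dens; case: pselect => [Ya|].
  by have -> : exist (fun x => x \in Y) (gsrc a) (mem_set Ya) = w by exact: val_inj.
by rewrite aw => /(_ (set_valP w)).
Qed.

Lemma dens_ge0 a : 0 <= dens a.
Proof. by rewrite /dens; case: pselect => // Ya; exact: fine_ge0. Qed.

Definition fint w phi : R := fine (\int[mu w]_b (phi (arr b))%:E)%E.

Lemma fibre_integralE w phi s : continuous phi -> (forall a, 0 <= phi a) ->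
  in_dom (fibre (val w)) s -> (forall a, gsrc a = val w -> phi a != 0 -> a \in s) ->
  fint w phi = \sum_(a <- s) phi a * dens a.
Proof.
move=> cphi phi0 sx sP; have [_ mw0] := mu_mass w.
rewrite /fint (@atomic_sum_eq_integral _ _ _ _ _ _ (@arr_fibre_measurable w) s phi
  (~` fibre w) sx.1 phi0 (@arr_measurable w phi cphi) (@fibre_measurable w) mw0) /=.
  by apply: eq_big_seq => a asx; rewrite -densE// (sx.2 a asx).
by move=> b /contrapT /fibre_reductionE; exact: sP.
Qed.

Lemma fibre_integral_ge w phi s : continuous phi -> (forall a, 0 <= phi a <= 1) ->
  in_dom (fibre (val w)) s -> \sum_(a <- s) phi a * dens a <= fint w phi.
Proof.
move=> cphi phi01 sx.
have phi0 a : 0 <= phi a by have /andP[] := phi01 a.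
have h := @atomic_sum_le_integral _ _ _ _ (mu w) _ (@arr_fibre_measurable w) s phi
  sx.1 phi0 (@arr_measurable w phi cphi).
have h1 : (\int[mu w]_b (phi (arr b))%:E <= 1)%E.
  apply: le_trans (_ : \int[mu w]_b (cst 1%E b) <= 1)%E; last first.
    by rewrite integral_cst// mul1e; have [] := mu_mass w.
  apply: ge0_le_integral => //.
  - by move=> b _; rewrite lee_fin.
  - by apply/measurable_EFinP; exact: (@arr_measurable w phi cphi).
  - by move=> b _; rewrite lee_fin; have /andP[] := phi01 (arr b).
have h0 : (0 <= \int[mu w]_b (phi (arr b))%:E)%E by apply: integral_ge0 => b _; rewrite lee_fin.
rewrite -lee_fin /fint fineK; last by rewrite ge0_fin_numE// (le_lt_trans h1)// ltry.
apply: le_trans h; rewrite le_eqVlt; apply/orP; left; apply/eqP; congr (_%:E).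
by apply: eq_big_seq => a asx; rewrite -densE// (sx.2 a asx).
Qed.

Lemma fint_ge0 w phi : (forall a, 0 <= phi a) -> 0 <= fint w phi.
Proof. by move=> phi0; apply/fine_ge0/integral_ge0 => b _; rewrite lee_fin. Qed.

Lemma fint_bounded w phi : continuous phi -> (forall a, 0 <= phi a <= 1) ->
  (\int[mu w]_b (phi (arr b))%:E <= mu w [set: borel w])%E.
Proof.
move=> cphi phi01; have phi0 a : 0 <= phi a by have /andP[] := phi01 a.
apply: le_trans (_ : \int[mu w]_b (cst 1%E b) <= _)%E; last first.
  by rewrite integral_cst// mul1e.
apply: ge0_le_integral => //.
- by move=> b _; rewrite lee_fin.
- by apply/measurable_EFinP; exact: (@arr_measurable w phi cphi).
- by move=> b _; rewrite lee_fin; have /andP[] := phi01 (arr b).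
Qed.

Lemma fint_fineK w phi : continuous phi -> (forall a, 0 <= phi a <= 1) ->
  ((fint w phi)%:E = \int[mu w]_b (phi (arr b))%:E)%E.
Proof.
move=> cphi phi01; have phi0 a : 0 <= phi a by have /andP[] := phi01 a.
rewrite /fint fineK// ge0_fin_numE; last by apply: integral_ge0 => b _; rewrite lee_fin.
apply: le_lt_trans (fint_bounded w cphi phi01) _.
by have [h _] := mu_mass w; apply: le_lt_trans h _; rewrite ltry.
Qed.

Lemma fint_le w phi psi : continuous phi -> continuous psi ->
  (forall a, 0 <= phi a <= 1) -> (forall a, 0 <= psi a <= 1) ->
  (forall a, phi a <= psi a) -> fint w phi <= fint w psi.
Proof.
move=> cphi cpsi phi01 psi01 h; rewrite -lee_fin !fint_fineK//.
apply: ge0_le_integral => //.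
- by move=> b _; rewrite lee_fin; have /andP[] := phi01 (arr b).
- by apply/measurable_EFinP; exact: (@arr_measurable w phi cphi).
- by apply/measurable_EFinP; exact: (@arr_measurable w psi cpsi).
- by move=> b _; rewrite lee_fin.
Qed.

Lemma fint_compl w phi : continuous phi -> (forall a, 0 <= phi a <= 1) ->
  fint w phi + fint w (fun a => 1 - phi a) <= 1.
Proof.
move=> cphi phi01.
have cpsi : continuous (fun a => 1 - phi a).
  by move=> a; apply: cvgB (cphi a); exact: cvg_cst.
have psi01 a : 0 <= 1 - phi a <= 1.
  by have /andP[] := phi01 a; rewrite subr_ge0 gerBl => -> ->.
rewrite -lee_fin EFinD !fint_fineK// -ge0_integralD//.
- rewrite (eq_integral (cst 1%E)); last first.
    by move=> b _; rewrite -EFinD addrC subrK.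
  by rewrite integral_cst// mul1e; have [] := mu_mass w.
- by move=> b _; rewrite lee_fin; have /andP[] := phi01 (arr b).
- by apply/measurable_EFinP; exact: (@arr_measurable w phi cphi).
- by move=> b _; rewrite lee_fin; have /andP[] := psi01 (arr b).
- by apply/measurable_EFinP; exact: (@arr_measurable w _ cpsi).
Qed.

Lemma fint_continuous phi : continuous phi -> compact (closure [set a | phi a != 0]) ->
  continuous (fun w => fint w phi).
Proof.
move=> cphi kphi w.
pose f (b : H) : R[i] := (phi (val (b : redset Y)))%:C%C.
have cf : Cc f.
  pose K := closure [set a | phi a != 0] `&` redset Y.
  have cK : compact K by apply: compact_closedI => //; exact: redset_closed.
  have cK' : compact ((fun b : redset Y => val b) @^-1` K).
    by apply: compact_set_val cK _ => a [].
  have clK' : closed ((fun b : redset Y => val b) @^-1` K).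
    apply: preimage_closed; last exact: compact_closed.
    by move=> a _; exact: set_val_continuous.
  split; last first.
    apply: (closed_compact_closure clK' cK') => b /= fb.
    split; last exact: set_valP.
    apply: subset_closure; apply: contra_neq fb => pb.
    by rewrite /f pb.
  by move=> b; exact: (cvg_complex (@arr_continuous w phi cphi b)).
have E u : fint u phi = complex.Re (cintegral (mu u) f) by [].
rewrite /continuous_at E (_ : (fun u => fint u phi) = (fun u => complex.Re (cintegral (mu u) f)))//.
have h := @mu_cont f cf w.
exact: (cvg_Re h).
Qed.

(** A bump [chi] supported in the domain of a local section sees one atom per fibre, so [chi * dens]
    is an integral, continuous in the unit by amenability; one divides by [chi], which is 1 at
    [a0]. *)
Lemma dens_continuous : {within redset Y, continuous dens}.
Proof.
apply/subspace_continuousP => a0 Ya0.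
have [U [sigma [oU Ua0 _ _ sK]]] := src_section EG a0.
have c0 : compact [set a0] by exact: compact_set1.
have [|chi [cchi chi01 chi1 chi0 kchi]] := bump_ex HG LG R c0 oU; first by move=> _ ->.
pose w0 : gobj H := exist (fun x => x \in Y) (gsrc a0) (mem_set Ya0.2).
have chip a : 0 <= chi a by have /andP[] := chi01 a.
have key w a : U a -> gsrc a = val w -> chi a * dens a = fint w chi.
  move=> Ua aw; rewrite (fibre_integralE (s := [:: a]) cchi chip) ?big_seq1//.
    by split => // b; rewrite inE => /eqP ->.
  move=> b bw cb; rewrite inE; apply/eqP.
  have Ub : U b by apply: contrapT => /chi0 cb0; rewrite cb0 eqxx in cb.
  by rewrite -(sK _ Ua) -(sK _ Ub) aw bw.
have d0 : dens a0 = fint w0 chi by rewrite -(key w0 a0)// chi1// mul1r.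
have cJ : (fun a => chi a * dens a) @ within (redset Y) (nbhs a0) --> fint w0 chi.
  apply/cvgrPdist_lt => e e0.
  have /cvgrPdist_lt/(_ _ e0)[_ [[V oV <-] /= Vw0 VS]] := @fint_continuous chi cchi kchi w0.
  have n1 : nbhs a0 U by exact: open_nbhs_nbhs.
  have n2 : nbhs a0 (@gsrc G @^-1` V).
    by apply: (@gsrc_continuous G a0); exact: open_nbhs_nbhs.
  apply: filterS2 n1 n2 => a Ua Va Ya.
  pose w : gobj H := exist (fun x => x \in Y) (gsrc a) (mem_set Ya.2).
  by rewrite (key w a)//; exact: (VS w).
have cchi' : chi @ within (redset Y) (nbhs a0) --> (1 : R).
  by rewrite -(chi1 a0)//; apply: cvg_within_filter; exact: cchi.
have cD : (fun a => chi a * dens a * (chi a)^-1) @ within (redset Y) (nbhs a0) --> dens a0.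
  rewrite d0 -[fint w0 chi]mulr1 -{1}invr1; apply: cvgM => //.
  by apply: cvgV => //; exact: oner_neq0.
apply: cvg_trans cD; apply: near_eq_cvg.
have : \forall a \near within (redset Y) (nbhs a0), chi a != 0.
  have /cvgrPdist_lt/(_ _ ltr01) := cchi'; apply: filterS => a ha.
  by apply: contraTN ha => /eqP ->; rewrite subr0 normr1 ltxx.
by apply: filterS => a ca; rewrite mulrAC mulfV// mul1r.
Qed.

(** Inner regularity gives a cutoff for one unit, continuity of the integral extends it to nearby
    units, and compactness of the boundary leaves finitely many, dominated by one bump. The second
    [d] makes the first inequality strict. *)
Lemma fint_tail (d : R) : 0 < d ->
  (forall w, ((1 - d)%:E <= mu w [set: borel w])%E) ->
  exists chi : G -> R, [/\ continuous chi, forall a, 0 <= chi a <= 1,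
    compact (closure [set a | chi a != 0]) & forall w, 1 - 2 * d <= fint w chi].
Proof.
move=> d0 hmu.
have bump w : exists chi : G -> R, [/\ continuous chi, forall a, 0 <= chi a <= 1,
    compact (closure [set a | chi a != 0]) & 1 - 2 * d < fint w chi].
  have : ((1 - 2 * d)%:E < mu w [set: borel w])%E.
    by apply: lt_le_trans (hmu w); rewrite lte_fin; lra.
  rewrite (mu_radon (@measurableT _ (borel w))).
  move=> /ereal_sup_gt[_ [K [cK _] <-] hK].
  have cK' : compact ((fun b : H => val (b : redset Y)) @` K).
    apply: continuous_compact => //; apply: continuous_subspaceT => b.
    exact: set_val_continuous.
  have [|chi [cchi chi01 chi1 _ kchi]] := bump_ex HG LG R cK' openT; first by [].
  exists chi; split => //; rewrite -lte_fin fint_fineK//; apply: lt_le_trans hK _.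
  have clK : closed (K : set H).
    rewrite (_ : K = (fun b : H => arr (b : borel w)) @^-1` ((fun b : H => val (b : redset Y)) @` K)).
      by apply: arr_closed; exact: compact_closed.
    by apply/seteqP; split => [b Kb|b [b' Kb' /val_inj <-]//]; exists b.
  have mK : measurable (K : set (borel w)) by exact: closed_borel.
  rewrite -(setIT K) -integral_indic//; apply: ge0_le_integral => //.
  - by apply/measurable_EFinP; exact: measurable_indic.
  - by apply/measurable_EFinP; exact: (@arr_measurable w chi cchi).
  - move=> b _; rewrite lee_fin indicE; case: (boolP (b \in _)) => [/set_mem Kb|_].
      by rewrite chi1//; exists b.
    by have /andP[] := chi01 (arr b).
have /choice[chi chiP] := bump.
have [|s [_ sP]] := compact_finite_cover (P := fun w => [set w' | 1 - 2 * d < fint w' (chi w)])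
    gobj_reduction_compact.
  move=> w _; have [cchi _ kchi hw] := chiP w.
  exact: (cvgr_gt _ (@fint_continuous (chi w) cchi kchi w) _ hw).
pose K := [set a | exists2 w, w \in s & closure [set a | chi w a != 0] a].
have cK : compact K.
  by apply: compact_seq_bigcup => w; have [] := chiP w.
have [|chi' [cchi' chi01' chi1' _ kchi']] := bump_ex HG LG R cK openT; first by [].
exists chi'; split => // w'; have [w ws /= hw] := sP w' I.
apply: le_trans (ltW hw) _; have [cchi chi01 kchi _] := chiP w.
apply: fint_le => // a; have [->|ca] := eqVneq (chi w a) 0; first by have /andP[] := chi01' a.
rewrite chi1'; first by have /andP[] := chi01 a.
by exists w => //; exact: subset_closure.
Qed.

(* The total variation is tested on the atoms of a fibre. *)
Lemma dens_translate (c : H) (d : R) s :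
  (Defs.total_variation (fun A => mu (gsrc c) A - rtranslate c (mu (grng c)) A) <= d%:E)%E ->
  in_dom (fibre (gsrc (val (c : redset Y)))) s ->
  \sum_(a <- s) `|dens a - dens (gmul a (ginv (val (c : redset Y))))| <= d.
Proof.
move=> hTV sx; set c0 := val (c : redset Y) in sx *.
pose arr' (b : H) : G := val (b : redset Y).
(* One cell per arrow of [s]; the last index holds the remaining arrows, whose contribution is
   dropped at the end. *)
pose A (i : 'I_(size s).+1) : set H :=
  if (i < size s)%N then arr' @^-1` [set nth c0 s i] else arr' @^-1` (~` [set` s]).
have mA i : <<s @open H >> (A i).
  rewrite /A; case: ifP => _; first exact: (@arr_fibre_measurable (gsrc c)).
  have cls : closed [set` s].
    apply: compact_closed => //; exact/finite_compact/finite_seq.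
  have mS := @closed_borel H (gsrc c) _ (@arr_closed (gsrc c) _ cls).
  exact: (@measurableC _ (borel (gsrc c)) _ mS).
have tA : trivIset [set: 'I_(size s).+1] A.
  move=> i j _ _ [b []]; rewrite /A; case: ifP => hi; case: ifP => hj //=.
  - move=> -> /eqP; rewrite nth_uniq//; last exact: sx.1.
    by move=> /eqP ij; exact: val_inj.
  - by move=> -> /=; rewrite mem_nth.
  - by move=> + bj; rewrite bj /= mem_nth.
  - move=> _ _; apply: val_inj => /=.
    have hi' : i = size s :> nat by apply/eqP; rewrite eqn_leq -ltnS ltn_ord leqNgt hi.
    have hj' : j = size s :> nat by apply/eqP; rewrite eqn_leq -ltnS ltn_ord leqNgt hj.
    by rewrite hi' hj'.
have uA : \bigcup_i A i = [set: H].
  apply/seteqP; split => // b _.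
  have [bs|bs] := boolP (arr' b \in s).
    have hi : (index (arr' b) s < (size s).+1)%N by rewrite ltnS index_size.
    by exists (Ordinal hi) => //; rewrite /A /= index_mem bs /= nth_index.
  by exists ord_max => //; rewrite /A /= ltnn; exact/negP.
have nuA (i : 'I_(size s)) :
    (mu (gsrc c) (A (widen_ord (leqnSn _) i)) -
     rtranslate c (mu (grng c)) (A (widen_ord (leqnSn _) i)) =
     (dens (nth c0 s i) - dens (gmul (nth c0 s i) (ginv c0)))%:E)%E.
  have ai := sx.2 _ (mem_nth c0 (ltn_ord i)).
  set a := nth c0 s i in ai *.
  have aw1 : gsrc a = val (gsrc c) by exact: ai.
  have ac : gsrc (gmul a (ginv c0)) = val (grng c) by rewrite gsrc_div.
  rewrite (densE aw1) (densE ac) EFinB !finite_measure_fineK; last 2 first.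
    exact: arr_fibre_measurable.
    exact: arr_fibre_measurable.
  rewrite /A /= ltn_ord; congr (_ - _)%E; rewrite /rtranslate; congr (mu _ _).
  apply/seteqP; split => [b [bc ba]|b ba].
    have bc' : gsrc (val (b : redset Y)) = grng c0 by exact: (congr1 val bc).
    have {}ba : arr' (gmul (b : H) c) = a := ba.
    have mE : arr' (gmul (b : H) c) = gmul (val (b : redset Y)) c0 by exact: (red_mulE bc).
    change (val (b : redset Y) = gmul a (ginv c0)).
    by rewrite -ba mE gmulK.
  have {}ba : val (b : redset Y) = gmul a (ginv c0) := ba.
  have bc : fibre (grng c) b by apply/(@fibre_reductionE (grng c)); rewrite /arr ba.
  split => //; have mE : arr' (gmul (b : H) c) = gmul (val (b : redset Y)) c0.
    exact: (red_mulE bc).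
  change (arr' (gmul (b : H) c) = a).
  by rewrite mE ba gmulVK.
rewrite -lee_fin; apply: le_trans hTV.
apply: le_trans (_ : (\sum_(i < (size s).+1) `|mu (gsrc c) (A i) -
    rtranslate c (mu (grng c)) (A i)|)%E <= _)%E; last first.
  by apply: ereal_sup_ubound; exists (size s).+1, A.
rewrite big_ord_recr /=; apply: le_trans (_ : _ <= _ + 0)%E _; last first.
  by apply: leeD2l; exact: abse_ge0.
rewrite adde0 (big_nth c0) big_mkord -sumEFin le_eqVlt; apply/orP; left; apply/eqP.
by apply: eq_bigr => i _; rewrite nuA.
Qed.

End FibreMeasures.

(** * Square roots of densities *)

Section AmenableSchur.
Variables (R : realType) (G : topGroupoid) (X : set (gobj G)).
Hypothesis HG : hausdorff_space G.
Hypothesis LG : locally_compact [set: G].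
Hypothesis EG : etale G.
Hypothesis CG : compact [set: gobj G].
Hypothesis IX : invariant_units X.
Hypothesis OX : open X.
Local Notation Y := (boundary X).
Local Notation H := (reduction Y).

(** The upper bound is the arithmetic-geometric mean inequality; for the lower one, u v is at least
    the square of the smaller factor. *)
Lemma geometric_mean_bounds (p q x y u v : R) : 0 <= p <= 1 -> 0 <= q <= 1 ->
  0 <= x -> 0 <= y -> 0 <= u -> 0 <= v -> u ^+ 2 = p * x -> v ^+ 2 = q * y ->
  p * x - (1 - q) * y - `|y - x| <= u * v <= (p * x + q * y) / 2.
Proof.
move=> /andP[p0 p1] /andP[q0 q1] x0 y0 u0 v0 hu hv; apply/andP; split; last first.
  by rewrite -hu -hv; have := sqr_ge0 (u - v); nra.
have a0 : 0 <= `|y - x| := normr_ge0 _.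
have ax : x - y <= `|y - x| by rewrite distrC ler_norm.
have [uv|vu] := leP u v.
  apply: (@le_trans _ _ (u ^+ 2)); last by rewrite expr2 ler_wpM2l.
  by rewrite hu; have := mulr_ge0 (_ : 0 <= 1 - q) y0; rewrite subr_ge0 => /(_ q1); lra.
apply: (@le_trans _ _ (v ^+ 2)); last by rewrite expr2 ler_wpM2r// ltW.
by rewrite hv; have : p * x <= x; [rewrite ler_piMl|lra].
Qed.

(** [xi] is the square root of a truncated density D, so [gram xi c] is a sum of geometric means of
    D(a c^-1) and D(a); these are close in l^1 by almost invariance, and each has mass close to
    1. *)
Lemma schur_amenable_of_topological :
  topologically_amenable R H -> schur_amenable R Y.
Proof.
move=> [m [mrad [mmass mcont mfull mtv]]] K e cK e0.
(* The losses are [2 * d] for the mass at the range, [2 * d] for the truncated part at the source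
   and [d] for invariance: 5 d < e. *)
pose d := e / 6; have d0 : 0 < d by rewrite divr_gt0.
have clY := redset_closed OX.
pose KY := K `&` redset Y.
have cKY : compact KY by exact: compact_closedI.
have cKH : compact ((fun a : redset Y => val a) @^-1` KY).
  by apply: compact_set_val cKY _ => a [].
have [n hn1 hn2] : exists2 n, (forall w : gobj H, (`|m n w [set: borel w] - 1| <= d%:E)%E) &
    forall c : H, KY (val (c : redset Y)) ->
     (Defs.total_variation (fun A => m n (gsrc c) A - rtranslate c (m n (grng c)) A) <= d%:E)%E.
  have h1 := mfull _ (gobj_reduction_compact CG OX) d d0.
  have h2 := mtv _ cKH d d0.
  have [N _ hN] : \forall n \near \oo, (forall x : gobj H, [set: gobj H] x ->
      (`|m n x [set: H] - 1| <= d%:E)%E) /\ (forall c : H, KY (val (c : redset Y)) ->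
     (Defs.total_variation (fun A => m n (gsrc c) A - rtranslate c (m n (grng c)) A) <= d%:E)%E).
    by apply: filterS2 h1 h2.
  have [hN1 hN2] := hN N (leqnn N).
  by exists N => [w|]; [exact: hN1|exact: hN2].
pose mu := m n.
have hmu (w : gobj H) : ((1 - d)%:E <= mu w [set: borel w])%E.
  have := hn1 w; rewrite -/mu -(@finite_measure_fineK _ _ R (mu w) _ (@measurableT _ (borel w))).
  by rewrite -EFinB lee_fin ler_norml lee_fin => /andP[h _]; lra.
have mass := mmass n.
have [chi [cchi chi01 kchi hchi]] := fint_tail HG LG CG OX (mrad n) mass (mcont n) d0 hmu.
have chi0 a : 0 <= chi a by have /andP[] := chi01 a.
pose D := dens mu.
have D0 a : 0 <= D a by exact: dens_ge0.
have cdens := dens_continuous HG LG EG OX mass (mcont n).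
have compl w := fint_compl mass w cchi chi01.
have fint1 (w : gobj H) : fint mu w chi <= 1.
  apply: le_trans (compl w); rewrite lerDl; apply: fint_ge0 => a.
  by have /andP[] := chi01 a; lra.
have ge w s := @fibre_integral_ge R G X HG mu mass w chi s cchi chi01.
have Yw a : redset Y a -> exists w : gobj H, gsrc a = val w.
  by move=> [_ Ya]; exists (exist (fun x => x \in Y) (gsrc a) (mem_set Ya)).
have [] := @compactly_supported_extension G HG LG R (redset Y) (closure [set a | chi a != 0])
  (fun a => chi a * D a) 1 clY kchi.
- apply/subspace_continuousP => a Ya.
  have /subspace_continuousP/(_ a Ya) hD := cdens.
  apply: cvgM hD; apply: cvg_within_filter; exact: cchi.
- move=> a Ya; have [w aw] := Yw a Ya.
  rewrite ger0_norm ?mulr_ge0//; apply: le_trans (fint1 w).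
  have := ge w [:: a]; rewrite big_seq1; apply; split => // b.
  by rewrite inE => /eqP ->.
- move=> a _ na; apply/eqP; rewrite mulf_eq0; apply/orP; left; apply: contraT => ca.
  by exfalso; apply: na; exact: subset_closure.
move=> g cg gE.
have [|chi2 [cchi2 chi201 chi21 _ kchi2]] := bump_ex HG LG R kchi openT; first by [].
(* Off the boundary the extension [g] may be negative and need not have compact support; the maximum
   and [chi2] repair this without changing [chi * D] on the boundary. *)
pose xi a : R := Num.sqrt (chi2 a * Num.max 0 (g a)).
have xi0 a : 0 <= xi a by exact: sqrtr_ge0.
have cxi : continuous xi.
  move=> a; apply: (cvg_comp _ (@Num.sqrt R)); last exact: sqrt_continuous.
  apply: cvgM; first exact: cchi2.
  by apply: (@continuous_max R G (fun=> 0) g); [exact: cvg_cst|exact: cg].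
have xi2 a : redset Y a -> xi a ^+ 2 = chi a * D a.
  move=> Ya; rewrite sqr_sqrtr; last first.
    by rewrite mulr_ge0 ?le_max ?lexx//; have /andP[] := chi201 a.
  rewrite gE// max_r ?mulr_ge0//.
  have [ca|ca] := eqVneq (chi a) 0; first by rewrite ca mul0r mulr0.
  by rewrite chi21 ?mul1r//; exact: subset_closure.
exists (fun a => (xi a)%:C%C).
  apply: (Cc_intro HG _ kchi2) => [a|a xa]; first by apply: cvg_complex; exact: cxi.
  apply: subset_closure; apply: contra_neq xa => ca.
  by rewrite /xi ca mul0r sqrtr0.
move=> c Kc Yc.
pose cH : H := exist (fun a => a \in redset Y) c (mem_set Yc).
pose ws : gobj H := gsrc cH; pose wr : gobj H := grng cH.
have TV := hn2 cH (conj Kc Yc).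
have cx : in_dom (fibre (gsrc c)) [:: c] by split => // a; rewrite inE => /eqP ->.
have [s1 s1x s1P] := fibre_finite HG EG (gsrc c) kchi.
have [s2 s2x s2P] := finite_col HG EG kchi cx.
(* [s] contains every arrow a over [gsrc c] with a or a c^-1 in the support of [chi], so the
   translated sum is the full integral at the range. *)
pose s := undup (s1 ++ s2).
have sx : in_dom (fibre (gsrc c)) s.
  split; first exact: undup_uniq.
  by move=> a; rewrite mem_undup mem_cat => /orP[/s1x.2|/s2x.2].
have Ya a : fibre (gsrc c) a -> redset Y a.
  by move=> ac; exact: (@redset_boundary G X IX a ws ac).
have Yac a : fibre (gsrc c) a -> redset Y (gmul a (ginv c)).
  by move=> ac; apply: (@redset_boundary G X IX _ wr); rewrite gsrc_div.
have chixi a : redset Y a -> chi a = 0 -> xi a = 0.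
  by move=> aY ca; apply/eqP; rewrite -sqrf_eq0 xi2// ca mul0r.
pose h := \sum_(a <- s) xi (gmul a (ginv c)) * xi a.
have -> : gram (fun a => (xi a)%:C%C) c = h%:C%C.
  rewrite /gram /gconv (fibre_sum_seq sx).
    rewrite rmorph_sum; apply: eq_big_seq => a asx; have ac := sx.2 a asx.
    rewrite /star ginv_mul//.
    by rewrite rmorphM /=; congr (_ * _); rewrite /Num.conj /= oppr0.
  move=> a ac; rewrite mulf_eq0 => /norP[_ xa]; rewrite mem_undup mem_cat s1P//.
  apply: subset_closure; apply: contra_neq xa => ca.
  by rewrite chixi//; exact: Ya.
have s'x : in_dom (fibre (grng c)) [seq gmul a (ginv c) | a <- s].
  split; last by move=> _ /mapP[a asx ->]; rewrite /fibre /= gsrc_div ?(sx.2 a asx).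
  rewrite map_inj_in_uniq ?undup_uniq// => a b /sx.2 ax /sx.2 bx.
  by apply: gmul_inj; rewrite grng_inv.
have E1 : \sum_(a <- s) chi (gmul a (ginv c)) * D (gmul a (ginv c)) = fint mu wr chi.
  rewrite (@fibre_integralE R G X HG mu mass wr chi [seq gmul a (ginv c) | a <- s])//.
    by rewrite big_map.
  move=> b bc cb; apply/mapP; exists (gmul b c); last by rewrite gmulK.
  rewrite mem_undup mem_cat (s2P c) ?orbT ?inE//.
    by rewrite /fibre /= gsrc_mul.
  by rewrite gmulK//; exact: subset_closure.
have E2 : \sum_(a <- s) chi a * D a <= 1 by apply: le_trans (fint1 ws); exact: (ge ws).
have E3 : \sum_(a <- s) (1 - chi a) * D a <= 2 * d.
  apply: (@le_trans _ _ (fint mu ws (fun a => 1 - chi a))).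
    apply: (@fibre_integral_ge R G X HG mu mass ws (fun a => 1 - chi a) s) => //.
      by move=> a; apply: cvgB (cchi a); exact: cvg_cst.
    by move=> a; have /andP[] := chi01 a; rewrite subr_ge0 gerBl => -> ->.
  by have := compl ws; have := hchi ws; lra.
have E4 : \sum_(a <- s) `|D a - D (gmul a (ginv c))| <= d.
  exact: (@dens_translate R G X HG mu cH d s TV sx).
have low : 1 - 5 * d <= h.
  apply: (@le_trans _ _ (\sum_(a <- s) (chi (gmul a (ginv c)) * D (gmul a (ginv c)) -
    (1 - chi a) * D a - `|D a - D (gmul a (ginv c))|))).
    by rewrite !sumrB E1; have := hchi wr; lra.
  rewrite /h big_seq [leRHS]big_seq; apply: ler_sum => a asx.
  have ac := sx.2 a asx.
  by have /andP[] := geometric_mean_bounds (chi01 (gmul a (ginv c))) (chi01 a)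
    (D0 _) (D0 _) (xi0 _) (xi0 _) (xi2 _ (Yac a ac)) (xi2 _ (Ya a ac)).
have up : h <= 1.
  apply: (@le_trans _ _ (\sum_(a <- s) (chi (gmul a (ginv c)) * D (gmul a (ginv c)) +
    chi a * D a) / 2)).
    rewrite /h big_seq [leRHS]big_seq; apply: ler_sum => a asx.
    have ac := sx.2 a asx.
    by have /andP[] := geometric_mean_bounds (chi01 (gmul a (ginv c))) (chi01 a)
      (D0 _) (D0 _) (xi0 _) (xi0 _) (xi2 _ (Yac a ac)) (xi2 _ (Ya a ac)).
  by rewrite -mulr_suml big_split /= E1; have := fint1 wr; lra.
rewrite (_ : 1 - h%:C%C = (1 - h)%:C%C); last by rewrite rmorphB rmorph1.
by rewrite normc_complex ger0_norm ?subr_ge0//; rewrite /d in low; lra.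
Qed.

End AmenableSchur.

(** * Reindexing unordered sums *)

Section SumReindex.
Variables (R : realType) (T : choiceType).

Lemma partial_sumE (F : T -> R[i]) (A : {fset T}) :
  summability.partial_sum F A = \sum_(a <- A) F a.
Proof. by rewrite finmap.big_seq_fsetE. Qed.

Lemma partial_sum_reindex_cvg (D D' : set T) (e g : T -> T) (F F' : T -> R[i]) (l : R[i]) :
  (forall b, D' b -> D (e b) /\ g (e b) = b) -> (forall a, D a -> D' (g a) /\ e (g a) = a) ->
  (forall a, ~ D a -> F a = 0) -> (forall b, ~ D' b -> F' b = 0) ->
  (forall b, D' b -> F' b = F (e b)) ->
  summability.partial_sum F @ summability.totally --> l ->
  summability.partial_sum F' @ summability.totally --> l.
Proof.
move=> he hg F0 F'0 FF' cF W /cF[A0 _ hA0].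
exists [fset g a | a in A0]%fset => // B /= B0.
(* The sum over [B] is compared with that over [A], the union of [A0] and the image of [B']; the
   extra elements of [A0] lie outside [D], where [F] vanishes. *)
pose B' := [seq b <- (B : seq T) | `[< D' b >]].
have uB : uniq (B : seq T) by exact: finmap.fset_uniq.
have uB' : uniq B' by exact: filter_uniq.
have B'D b : b \in B' -> D' b by rewrite mem_filter => /andP[/asboolP].
pose A := (A0 `|` [fset e b | b in B'])%fset.
have /hA0 : (A0 `<=` A)%fset by exact: finmap.fsubsetUl.
rewrite /preimage /= !partial_sumE.
suff -> : \sum_(a <- A) F a = \sum_(b <- B) F' b by [].
have -> : \sum_(b <- B) F' b = \sum_(b <- B') F' b.
  apply: big_support => // b; last by rewrite mem_filter => /andP[_ ->].
  by move=> bB; rewrite mem_filter bB andbT => /asboolP/F'0.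
have -> : \sum_(b <- B') F' b = \sum_(a <- [seq e b | b <- B']) F a.
  by rewrite big_map; apply: eq_big_seq => b /B'D /FF'.
apply: big_support.
- exact: finmap.fset_uniq.
- rewrite map_inj_in_uniq// => b b' /B'D Db /B'D Db' eb.
  by rewrite -(he b Db).2 eb (he b' Db').2.
- move=> a; rewrite finmap.in_fsetU => /orP[aA0 na|]; last first.
    by move=> /finmap.imfsetP[b /= bB' ->] /negP[]; exact: map_f.
  apply: F0 => Da; move/negP: na; apply; apply/mapP; exists (g a); last by rewrite (hg a Da).2.
  rewrite mem_filter; apply/andP; split; first by apply/asboolP; exact: (hg a Da).1.
  by apply: (finmap.fsubsetP B0); apply/finmap.imfsetP; exists a.
- move=> a /mapP[b bB' ->]; rewrite finmap.in_fsetU => /negP[]; apply/orP; right.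
  by apply/finmap.imfsetP; exists b.
Qed.

(** Both nets of partial sums have the same limits, so the equality holds even without summability,
    where [get] takes its default value on both sides. *)
Lemma sum_reindex (D D' : set T) (e g : T -> T) (F F' : T -> R[i]) :
  (forall b, D' b -> D (e b) /\ g (e b) = b) -> (forall a, D a -> D' (g a) /\ e (g a) = a) ->
  (forall a, ~ D a -> F a = 0) -> (forall b, ~ D' b -> F' b = 0) ->
  (forall b, D' b -> F' b = F (e b)) ->
  summability.sum F' = summability.sum F.
Proof.
move=> he hg F0 F'0 FF'; rewrite /summability.sum /lim /lim_in; congr get.
apply/funext => l; apply/propext; split; last exact: (partial_sum_reindex_cvg he hg).
apply: (partial_sum_reindex_cvg hg he) => // a Da.
by have [D'g ega] := hg a Da; rewrite FF'// ega.
Qed.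

End SumReindex.

(** * The symbol morphism *)

Section SymbolGamma.
Variables (R : realType) (G : topGroupoid) (X : set (gobj G)).
Hypothesis HG : hausdorff_space G.
Hypothesis EG : etale G.
Hypothesis CG : compact [set: gobj G].
Hypothesis IX : invariant_units X.
Hypothesis OX : open X.
Implicit Types (a b c : G) (x y : gobj G) (f : G -> R[i]) (S T : opfield R G).
Local Notation Y := (boundary X).

Lemma delta_fvec x a : delta R (fibre x) a = fvec (fibre x) [:: a] (fun=> 1).
Proof.
apply: val_inj; apply/funext => b; rewrite /= /fvec_fun inE.
by case: ifP.
Qed.

Lemma l2norm_delta x a : l2norm (delta R (fibre x) a) <= 1.
Proof.
rewrite -(@ler_pXn2r _ 2)// ?nnegrE ?l2norm_ge0// expr1n.
rewrite delta_fvec; have [ax|ax] := pselect (fibre x a).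
  rewrite l2norm_fvec; first by rewrite /energy big_seq1 Normc.normc1 expr1n.
  by split => // b; rewrite inE => /eqP ->.
rewrite (_ : fvec _ _ _ = 0); first by rewrite l2norm0 expr0n ler01.
apply: val_inj; apply/funext => b; rewrite /= /fvec_fun inE.
by case: eqP => [->|//]; rewrite memNset.
Qed.

Lemma coefE x (A : bop R (fibre x)) a b : fibre x b -> coef A a b = A (delta R (fibre x) a) b.
Proof. by move=> bx; rewrite /coef inner_delta. Qed.

Lemma coef_regular_rep f x a b : Cc f -> fibre x a -> fibre x b ->
  coef (regular_rep f x) a b = f (gmul b (ginv a)).
Proof.
move=> cf ax bx; rewrite coefE// delta_fvec regular_rep_fvec//.
  by rewrite big_seq1 mulr1.
by split => // c; rewrite inE => /eqP ->.
Qed.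

Lemma coef_approx x (A B : bop R (fibre x)) (e : R) a b : fibre x b -> opnorm (A - B) <= e ->
  normc (coef A a b - coef B a b) <= e.
Proof.
move=> bx AB; rewrite !coefE//.
apply: le_trans (l2norm_ge_coord ((A - B) (delta R (fibre x) a)) b) _.
apply: le_trans (le_opnorm (A - B) _) _.
by apply: le_trans AB; rewrite ler_piMr ?opnorm_ge0// l2norm_delta.
Qed.

Lemma symbol_continuous T : Cred R G T -> continuous_section (symbol Y T).
Proof.
(* Limits of arrows over [w i] lie over [w0] by uniqueness of limits in the unit space; the entries
   of lambda_x(f) are then values of [f] at convergent arrows. *)
move=> hT I F PF w w0 ww0; split => //= a b a0 b0 aw bw aa0 bb0.
have lim_fibre (u : I -> G) u0 : (forall i, fibre (val (w i)) (u i)) -> u @ F --> u0 ->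
    fibre (val w0) u0.
  move=> uw uu0.
  have h1 : (fun i => gsrc (u i)) @ F --> gsrc u0.
    exact: (cvg_comp _ _ uu0 (@gsrc_continuous G u0)).
  have h2 : (fun i => gsrc (u i)) @ F --> val w0.
    rewrite (_ : (fun i => gsrc (u i)) = (fun i => val (w i))).
      exact: (cvg_comp _ _ ww0 (@set_val_continuous _ _ w0)).
    by apply/funext => i; exact: uw.
  exact: (cvg_unique (gobj_hausdorff HG) h1 h2).
have a0w := lim_fibre a a0 aw aa0; have b0w := lim_fibre b b0 bw bb0.
apply/cvgCP => e e0; have e3 : 0 < e / 3 by exact: divr_gt0.
have [f cf Tf] := hT _ e3; have [ff _] := cf.
have h : (fun i => f (gmul (b i) (ginv (a i)))) @ F --> f (gmul b0 (ginv a0)).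
  have hm : (fun i => gmul (b i) (ginv (a i))) @ F --> gmul b0 (ginv a0).
    apply: gmul_cvg => //.
    - exact: (cvg_comp _ _ aa0 (@ginv_continuous G a0)).
    - by rewrite grng_inv a0w b0w.
    - by apply: filterE => i; rewrite grng_inv (aw i) (bw i).
  exact: (cvg_comp _ _ hm (ff _)).
have /cvgCP/(_ _ e3) := h; apply: filterS => i hi.
have h1 := coef_approx (a i) (bw i) (Tf (val (w i))).
have h2 := coef_approx a0 b0w (Tf (val w0)).
rewrite coef_regular_rep// in h1; rewrite coef_regular_rep// in h2.
rewrite normcB in h2; rewrite /symbol /limit_operator.
move: (coef (T (val (w i))) (a i) (b i)) (coef (T (val w0)) a0 b0) h1 h2 hi => z1 z2.
move: (f (gmul (b i) (ginv (a i)))) (f (gmul b0 (ginv a0))) => z3 z4 h1 h2 h3.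
have -> : z1 - z2 = (z1 - z3) + ((z3 - z4) + (z4 - z2)) by ring.
have := le_normc_add (z1 - z3) ((z3 - z4) + (z4 - z2)).
have := le_normc_add (z3 - z4) (z4 - z2); lra.
Qed.

(** The matrix of lambda_w(f) vanishes off [supp f], and over a boundary unit its arrows stay in the
    closed set [redset Y]. *)
Lemma symbol_Cu T w : Cred R G T -> Cu Y (symbol Y T w).
Proof.
move=> hT e e0; have [f cf Tf] := hT e e0.
exists (regular_rep f (val w)) => //.
have clY : closed Y by exact: open_closedC.
have clR : closed (redset Y).
  by apply: closedI; apply: preimage_closed => // a _; [exact: grng_continuous|exact: gsrc_continuous].
exists (supp f `&` redset Y); split.
- by apply: compact_closedI => //; exact: supp_compact.
- by move=> a [].
- move=> a b aw bw; rewrite coef_regular_rep// => fab; split; first exact: in_supp.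
  have ab : gsrc b = gsrc a by rewrite aw bw.
  apply/(boundaryE IX); rewrite gsrc_div// => /(invariantE IX); rewrite aw.
  exact: (set_valP w).
Qed.

Lemma rtrans_norm (c : G) (xi : l2 R (fibre (grng c))) : l2norm (rtrans xi) = l2norm xi.
Proof.
rewrite /l2norm; congr (Num.sqrt (fine _)).
rewrite [RHS](reindex_esum _ _ _ _ (rtrans_bij c)); apply: eq_esum => b bc.
by rewrite /= mem_set.
Qed.

Lemma rtransB (c : G) (xi eta : l2 R (fibre (grng c))) :
  rtrans (xi - eta) = rtrans xi - rtrans eta.
Proof.
apply: val_inj; apply/funext => b.
change (rtrans (xi - eta) b = rtrans xi b - rtrans eta b).
by rewrite /=; case: ifP => _; rewrite ?subr0.
Qed.

Lemma rtrans_inner (c : G) (xi eta : l2 R (fibre (grng c))) :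
  inner (rtrans xi) (rtrans eta) = inner xi eta.
Proof.
apply: (@sum_reindex R G (fibre (grng c)) (fibre (gsrc c)) (fun b => gmul b (ginv c))
  (fun a => gmul a c)).
- by move=> b bc; rewrite /fibre /= gsrc_div// gmulVK.
- by move=> a ac; rewrite /fibre /= gsrc_mul// gmulK.
- by move=> a ac; rewrite l2_out// mul0r.
- by move=> a ac; rewrite l2_out// mul0r.
- by move=> b bc; rewrite /= mem_set.
Qed.

Lemma rtrans_regular_rep f (c : G) (xi : l2 R (fibre (grng c))) : Cc f ->
  regular_rep f (gsrc c) (rtrans xi) = rtrans (regular_rep f (grng c) xi).
Proof.
move=> cf; apply: val_inj; apply/funext => b.
change (regular_rep f (gsrc c) (rtrans xi) b = rtrans (regular_rep f (grng c) xi) b).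
have [bc|bc] := pselect (fibre (gsrc c) b); last by rewrite !l2_out.
have bc' : fibre (grng c) (gmul b (ginv c)) by rewrite /fibre /= gsrc_div.
rewrite [RHS]/= mem_set// (regular_repP EG cf)// (regular_repP EG cf)//.
rewrite (reindex_fsbig _ _ _ _ (rtrans_bij c)); apply: eq_fsbigr => a ac'.
have ac := set_mem ac'; rewrite /= ac' [gmul (gmul b _) _](_ : _ = gmul b (ginv a))//.
by rewrite ginv_mul ?gmul_divK// ?ac.
Qed.

(** As [rtrans] preserves [inner], the identity amounts to [T] commuting with right translation;
    this is exact for lambda(f) and passes to norm limits. *)
Lemma symbol_equivariant T : Cred R G T -> equivariant (symbol Y T).
Proof.
move=> hT c xi eta; rewrite -rtrans_inner; congr inner.
pose c0 := val (c : redset Y).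
change (rtrans (T (grng c0) xi) = T (gsrc c0) (rtrans xi)).
apply/eqP; rewrite -subr_eq0; apply/eqP/l2norm_eq0; apply/eqP.
rewrite eq_le l2norm_ge0 andbT.
apply: (@le_of_eps _ _ _ (2 * l2norm xi)); first by rewrite mulr_ge0 ?l2norm_ge0.
move=> e e0; rewrite add0r; have [f cf Tf] := hT e e0.
have -> : rtrans (T (grng c0) xi) - T (gsrc c0) (rtrans xi) =
    rtrans ((T (grng c0) - regular_rep f (grng c0)) xi) -
    (T (gsrc c0) - regular_rep f (gsrc c0)) (rtrans xi).
  rewrite (_ : (T (grng c0) - regular_rep f (grng c0)) xi =
    T (grng c0) xi - regular_rep f (grng c0) xi)//.
  rewrite (_ : (T (gsrc c0) - regular_rep f (gsrc c0)) (rtrans xi) =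
    T (gsrc c0) (rtrans xi) - regular_rep f (gsrc c0) (rtrans xi))//.
  by rewrite rtransB rtrans_regular_rep// opprB addrA subrK.
apply: le_trans (l2normD _ _) _; rewrite l2normN rtrans_norm.
have h1 := le_opnorm (T (grng c0) - regular_rep f (grng c0)) xi.
have h2 := le_opnorm (T (gsrc c0) - regular_rep f (gsrc c0)) (rtrans xi).
rewrite rtrans_norm in h2.
have h3 := ler_wpM2r (l2norm_ge0 xi) (Tf (grng c0)).
have h4 := ler_wpM2r (l2norm_ge0 xi) (Tf (gsrc c0)).
rewrite -mulrA mulrC; lra.
Qed.

Lemma symbol_Gamma T : Cred R G T -> Gamma R Y (symbol Y T).
Proof.
move=> hT; split.
- exact: symbol_continuous.
- by move=> w; exact: symbol_Cu.
- by have [M _ hM] := Cred_bounded HG EG CG hT; exists M => w; exact: hM.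
- exact: symbol_equivariant.
Qed.

End SymbolGamma.

(** * The equivalence of the four conditions *)

Theorem theorem1p2 (R : realType) (G : topGroupoid) (X : set (gobj G)) :
  locally_compact_groupoid G -> sigma_compact G -> etale G ->
  compact [set: gobj G] ->
  invariant_units X -> open X -> dense X ->
  topologically_amenable R (reduction (boundary X)) ->
  forall T : opfield R G, Cred R G T ->
  [<-> invertible_modulo (Cred R G) (Cred_reduction R X) T ;
       invertible_in (Gamma R (boundary X)) (symbol (boundary X) T) ;
       (forall w : boundary X, invertible (limit_operator (boundary X) T w)) /\
       exists M : R, forall (w : boundary X) (S : bop R (fibre (val w))),
         inverse_of (limit_operator (boundary X) T w) S -> opnorm S <= M ;
       forall w : boundary X, invertible (limit_operator (boundary X) T w) ].
Proof.
move=> [HG LG _] _ EG CG IX OX _ am T hT; tfae.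
- move=> [S hS [TS ST]]; split; first exact: symbol_Gamma.
  exists (symbol (boundary X) S) => [|w]; first exact: symbol_Gamma.
  have Xw : ~ X (val w) := set_valP w.
  by split; apply/eqP; rewrite -subr_eq0; apply/eqP;
    [exact: (Cred_reduction_vanish IX TS Xw)|exact: (Cred_reduction_vanish IX ST Xw)].
(* Inverses are unique, so the norm bound carried by [Gamma] bounds all of them. *)
- move=> [_ [psi [_ _ [M psiM] _] Tpsi]]; split => [w|]; first by exists (psi w).
  exists M => w S TS; rewrite (inverse_unique TS (Tpsi w)); exact: psiM.
- by case.
(* The cycle closes from (4) directly to (1), uniform bounds being obtained on the way. *)
move=> Tinv; have sa := schur_amenable_of_topological HG LG EG CG IX OX am.
have [|C TC] := bounded_inverses HG EG CG IX OX sa hT.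
  by move=> w Xw; exact: (Tinv (exist (fun x => x \in boundary X) w (mem_set Xw))).
exact: (invertible_modulo_of_bounded HG EG CG IX OX sa hT TC).
Qed.
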